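(* Let $n\geq 3$ and $\alpha\geq 2$. Let $f\in\mathrm{Imm}^{\alpha}(\Gamma,\mathbf{R}^{n})$ be a curve with curvature $\kappa>0$, and let $\tilde\kappa\colon\Gamma\to\mathbf{R}$ be a $\mathcal{C}^{\alpha-2}$ function with $\tilde\kappa>\kappa$ everywhere on $\Gamma$. Let $P\subset\Gamma$ be any finite set of points. Then, for any $\varepsilon>0$, there exists a curve $\tilde f\in\mathrm{Imm}^\alpha(\Gamma,\mathbf{R}^n)$ such that (i) $\tilde f$ has curvature $\tilde\kappa$ (as a function on $\Gamma$); (ii) $\lvert \tilde f-f\rvert_1\leq\varepsilon$; (iii) if $f$ has unit speed, then $\tilde f$ has unit speed; (iv) $\tilde f$ is tangent to $f$ at every point of $P$.
   Context: $\Gamma$ denotes either a compact interval $[a,b]\subset\mathbf{R}$ (with $a<b$) or the circle $\mathbf{R}/((b-a)\mathbf{Z})$. The regularity $\alpha$ is an integer $\geq 2$ or $\infty$ (with $\infty-2=\infty$). $\mathcal{C}^\alpha(\Gamma,\mathbf{R}^n)$ is the space of $\mathcal{C}^\alpha$ maps $\Gamma\to\mathbf{R}^n$ with the topology induced by the $\mathcal{C}^\alpha$-norm $\lvert\,\cdot\,\rvert_\alpha$; in particular $\lvert g\rvert_1$ is the $\mathcal{C}^1$-norm, e.g. $\max\{\sup_\Gamma\lvert g\rvert,\sup_\Gamma\lvert g'\rvert\}$. $\mathrm{Imm}^{\alpha}(\Gamma,\mathbf{R}^n)\subset\mathcal{C}^\alpha(\Gamma,\mathbf{R}^n)$ is the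 space of (immersed) curves, i.e. maps $f$ with $f'$ nowhere zero. The tantrix of $f$ is $T:=f'/\lvert f'\rvert$, and the curvature of $f$ (for $\alpha\ge 2$) is the function $\kappa:=\lvert T'\rvert/\lvert f'\rvert$ on $\Gamma$. Unit speed means $\lvert f'\rvert\equiv 1$. ''$\tilde f$ is tangent to $f$ at $p\in\Gamma$'' means $\tilde f(p)=f(p)$ and the tantrices of $\tilde f$ and $f$ agree at $p$. *)

(* Defs.v *)
From HB Require Import structures.
From mathcomp Require Import all_boot all_order all_algebra.
From mathcomp Require Import all_classical all_reals all_analysis.
Import Order.TTheory GRing.Theory Num.Theory.
Import numFieldNormedType.Exports.

Set Implicit Arguments.
Unset Strict Implicit.
Unset Printing Implicit Defensive.

Local Open Scope classical_set_scope.
Local Open Scope ring_scope.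

Variant domain_kind := Interval | Circle.

(* The domain of a curve: the interval [a, b], or the circle R / (b - a)Z. *)
Record domain (R : realType) := Domain {
  dom_kind : domain_kind;
  dom_a : R;
  dom_b : R;
  dom_lt : dom_a < dom_b }.

(* Maps on either domain are represented by total functions on R. On an
   interval only the values on [a, b] are ever used; a map on the circle is
   given by its (b - a)-periodic lift to R, so that all of R is the set of
   parameters, each point of the circle being represented by its lifts. *)
Definition points (R : realType) (G : domain R) : set R :=
  match dom_kind G with
  | Interval => `[dom_a G, dom_b G]
  | Circle => setT
  end.

Definition map_on (R : realType) (T : Type) (G : domain R) (g : R -> T) : Prop :=
  match dom_kind G with
  | Interval => True
  | Circle => forall t, g (t + (dom_b G - dom_a G)) = g t
  end.

Section Calculus.
Context {R : realType} {V : normedModType R} (G : domain R).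

(* Difference quotients are taken within the domain, which gives the one-sided
   derivatives at the endpoints of an interval. On the circle [deriv_on G g] is
   the library's [derive1 g]. *)
Definition increments (t : R) : set_system R :=
  within [set h | points G (h + t)] 0^'.

Definition diff_quot (g : R -> V) (t h : R) : V := h^-1 *: (g (h + t) - g t).

Definition differentiable_on (g : R -> V) : Prop :=
  forall t, points G t -> cvg (diff_quot g t h @[h --> increments t]).

Definition deriv_on (g : R -> V) (t : R) : V :=
  lim (diff_quot g t h @[h --> increments t]).

Definition derivn_on (k : nat) (g : R -> V) : R -> V := iter k deriv_on g.

End Calculus.

Variant regularity := Finite of nat | Infinite.

Definition regularity_ge (m : nat) (alpha : regularity) : bool :=
  if alpha is Finite k then (m <= k)%N else true.

Definition regularity_sub (alpha : regularity) (m : nat) : regularity :=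
  if alpha is Finite k then Finite (k - m) else Infinite.

Section Curves.
Context {R : realType} (G : domain R).

Definition Ck (V : normedModType R) (k : nat) (g : R -> V) : Prop :=
  (forall j, (j < k)%N -> differentiable_on G (derivn_on G j g)) /\
  {within points G, continuous (derivn_on G k g)}.

Definition C_class (V : normedModType R) (alpha : regularity) (g : R -> V) : Prop :=
  map_on G g /\
  match alpha with
  | Finite k => Ck k g
  | Infinite => forall k, Ck k g
  end.

(* The library norm on 'rV[R]_n is the max norm. *)
Definition enorm (n : nat) (v : 'rV[R]_n) : R :=
  Num.sqrt (\sum_(i < n) v 0 i ^+ 2).

Definition Imm (n : nat) (alpha : regularity) (f : R -> 'rV[R]_n) : Prop :=
  C_class alpha f /\ forall t, points G t -> deriv_on G f t != 0.

Definition tantrix (n : nat) (f : R -> 'rV[R]_n) (t : R) : 'rV[R]_n :=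
  (enorm (deriv_on G f t))^-1 *: deriv_on G f t.

Definition curvature (n : nat) (f : R -> 'rV[R]_n) (t : R) : R :=
  enorm (deriv_on G (tantrix f) t) / enorm (deriv_on G f t).

Definition unit_speed (n : nat) (f : R -> 'rV[R]_n) : Prop :=
  forall t, points G t -> enorm (deriv_on G f t) = 1.

Definition C0norm (n : nat) (g : R -> 'rV[R]_n) : \bar R :=
  ereal_sup [set (enorm (g t))%:E | t in points G].

Definition C1norm (n : nat) (g : R -> 'rV[R]_n) : \bar R :=
  Order.max (C0norm g) (C0norm (deriv_on G g)).

Definition tangent_at (n : nat) (f1 f2 : R -> 'rV[R]_n) (p : R) : Prop :=
  f1 p = f2 p /\ tantrix f1 p = tantrix f2 p.

End Curves.

(* Main.v *)
(* A curve with speed [v] and tantrix [S] has curvature [kt] when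
   [enorm S' = kt * v], so it suffices to replace the tantrix [T] of [f] by a
   unit curve [S] that is close to [T], has derivative of norm [sig = kt * v],
   and satisfies [int v S = int v T] over every piece of a partition of the
   domain through [P]. The speed, and with it (iii), is unchanged.

   On a short piece, [T] is rotated in the plane of two unit vectors [a], [e],
   where [a] is close to [T] and [e] is orthogonal to [a] and to
   [u = T1 / enorm T1], by an angle that is a sum of [M] small bumps. The
   rotation moves [T] in a direction orthogonal to [u], so the new curve stays
   an immersion; as [enorm T1 < sig], the amplitude of each bump can be chosen
   so that the length of the piece under it becomes the integral of [sig].
   Reparametrizing to speed [sig] then moves points by at most the length of
   one bump, so the result is uniformly O(1/M)-close to [T].

   The length is convex in the amplitude and increases by a definite amount
   before it reaches the target, so the amplitude is Lipschitz in the initial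
   curve. Applied to the family [fam x = nrm (T + hump * x)], the corrugation
   is therefore a perturbation of small Lipschitz constant of the map
   [x |-> int v (fam x)]. That map is strongly monotone near [0] because [T] is
   not constant, hence some [x] gives [int v S = int v T]. *)

Require Import Defs.
From HB Require Import structures.
From mathcomp Require Import all_boot all_order all_algebra.
From mathcomp Require Import all_classical all_reals all_analysis.
From mathcomp Require Import ring lra.
Import Order.TTheory GRing.Theory Num.Theory.
Import numFieldNormedType.Exports.

Local Open Scope classical_set_scope.
Local Open Scope ring_scope.

(** * Differentiation along a subset of the line *)

(** Uniform closeness to [T] alone would not solve the integral constraint: the zero is found by
    minimizing the norm of a strongly monotone map, and monotonicity survives only perturbations
    that are small in the Lipschitz sense. Hence estimates on amplitude, speed and reparametrization
    come twice, for size and for variation with [x].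

    Rotation factors out of the velocity: the speed of the turned curve is [enorm (T1 + h' *: K T)],
    where [h] is the angle and [K] the infinitesimal rotation. It depends on [h] only through [h'],
    and the vector inside is affine in the amplitude, whence the convexity. A vector [e] orthogonal
    to both [a] and [u] exists because the dimension is at least 3.

    Reparametrizing the pieces one by one would leave smoothness at the partition points open. The
    pieces are glued before that, and one map [phi] of the whole domain is defined by equality of
    lengths. Lengths agree at the partition points, so [phi] fixes them and restricts to every
    piece; this is why the local results quantify over all solutions [phi]. Its class follows by
    bootstrapping from [phi' = sig / g (phi)]. *)

Definition cont {R : realType} {V : normedModType R} (D : set R) (g : R -> V) :=
  forall t, D t -> g s @[s --> within D (nbhs t)] --> g t.

(** Carathéodory's form: the slope [psi] is defined on all of [D] and converges to the derivative.
    The filter is not punctured, so [psi t] equals [l] when [t] is in [D], and the rules of calculus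
    become identities between slopes. One-sided derivatives at the ends of an interval are
    covered. *)
Definition isder {R : realType} {V : normedModType R} (D : set R) (g : R -> V)
    (t : R) (l : V) :=
  exists2 psi : R -> V, (forall s, D s -> g s = g t + (s - t) *: psi s) &
    psi s @[s --> within D (nbhs t)] --> l.

Definition derives {R : realType} {V : normedModType R} (D : set R) (g g' : R -> V) :=
  forall t, D t -> isder D g t (g' t).

(** Each derivative is quantified existentially, so closure properties are inductions that exhibit a
    derivative, without iterating [deriv_on]. *)
Fixpoint CK {R : realType} {V : normedModType R} (D : set R) (k : nat)
    (g : R -> V) : Prop :=
  if k is k'.+1 then exists2 g', derives D g g' & CK D k' g' else cont D g.

Section Filters.
Context {R : realType}.
Implicit Types (D E : set R) (t : R) (V W : normedModType R).

#[local] Instance within_nbhs_filter D (t : R) : Filter (within D (nbhs t)).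
Proof. exact: within_filter. Qed.

Lemma within_nbhs_proper D (t : R) : D t -> ProperFilter (within D (nbhs t)).
Proof.
move=> Dt; apply: Build_ProperFilter_ex => P [e /= e0 /(_ t)].
by move=> H; exists t; apply: H => //=; rewrite subrr normr0.
Qed.

Lemma cvg_within_at V D (g : R -> V) t (l : V) : D t ->
  g s @[s --> within D (nbhs t)] --> l -> g t = l.
Proof.
move=> Dt H; have := within_nbhs_proper D t Dt => PF.
apply/eqP; rewrite -subr_eq0 -normr_eq0; apply/eqP/le_anti; rewrite normr_ge0 andbT.
apply/ler_addgt0Pr => e e0; rewrite add0r distrC.
move/cvgrPdist_le: H => /(_ _ e0) [d /= d0 /(_ t)]; apply => //=.
by rewrite subrr normr0.
Qed.

Lemma cvg_withinP V D (g : R -> V) t (l : V) :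
  g s @[s --> within D (nbhs t)] --> l <->
  forall e, 0 < e -> exists2 d, 0 < d &
    forall s, D s -> `|s - t| < d -> `|g s - l| <= e.
Proof.
split=> [/cvgrPdist_le H e e0|H].
  have [d /= d0 Hd] := H _ e0; exists d => // s Ds std.
  by rewrite distrC; apply: Hd => //=; rewrite distrC.
apply/cvgrPdist_le => e e0; have [d d0 Hd] := H _ e0.
exists d => //= s /= st Ds; rewrite distrC; apply: Hd => //.
by rewrite distrC.
Qed.

Lemma within_sub D E (t : R) : D `<=` E -> within D (nbhs t) --> within E (nbhs t).
Proof.
by move=> DE P [d /= d0 H]; exists d => // x /H xP /DE.
Qed.

Lemma cont_sub V D E (g : R -> V) : D `<=` E -> cont E g -> cont D g.
Proof.
move=> DE H t Dt; apply: cvg_trans (H t (DE _ Dt)).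
exact: cvg_app (within_sub D E t DE).
Qed.

Lemma contP V D (g : R -> V) : {within D, continuous g} <-> cont D g.
Proof. exact: subspace_continuousP. Qed.

Lemma cvg_within_eq V D (f g : R -> V) t (l : V) : (forall s, D s -> f s = g s) ->
  f s @[s --> within D (nbhs t)] --> l -> g s @[s --> within D (nbhs t)] --> l.
Proof.
move=> fg /cvg_withinP H; apply/cvg_withinP => e /H [d d0 Hd].
by exists d => // s Ds sd; rewrite -fg //; apply: Hd.
Qed.

Lemma cont_ext V D (f g : R -> V) : (forall s, D s -> f s = g s) ->
  cont D f -> cont D g.
Proof.
move=> fg cf t Dt; rewrite -(fg t Dt).
exact: cvg_within_eq fg (cf t Dt).
Qed.

Lemma isder_cvg V D (g : R -> V) t (l : V) : D t -> isder D g t l ->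
  g s @[s --> within D (nbhs t)] --> g t.
Proof.
move=> Dt [psi gE psil].
apply: (@cvg_within_eq _ _ (fun s => g t + (s - t) *: psi s)).
  by move=> s Ds; rewrite (gE s Ds).
rewrite -[X in _ --> X]addr0 -[X in _ + X](scale0r l) -(subrr t).
apply: cvgD; first exact: cvg_cst.
apply: cvgZ psil; apply: cvgB; last exact: cvg_cst.
exact: cvg_within.
Qed.

Lemma derives_cont V D (g g' : R -> V) : derives D g g' -> cont D g.
Proof. by move=> H t Dt; apply: isder_cvg Dt (H t Dt). Qed.

Lemma isder_sub V D E (g : R -> V) t (l : V) : D `<=` E -> isder E g t l -> isder D g t l.
Proof.
move=> DE [psi gE psil]; exists psi; first by move=> s /DE; exact: gE.
apply: cvg_trans psil; exact: cvg_app (within_sub D E t DE).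
Qed.

Lemma derives_sub V D E (g g' : R -> V) : D `<=` E -> derives E g g' -> derives D g g'.
Proof. by move=> DE H t Dt; apply: isder_sub DE (H _ (DE _ Dt)). Qed.

Lemma isder_ext V D (f g : R -> V) t l : D t -> (forall s, D s -> f s = g s) ->
  isder D f t l -> isder D g t l.
Proof.
move=> Dt fg [psi fE psil]; exists psi => // s Ds.
by rewrite -fg // -fg // fE.
Qed.

Lemma derives_ext V D (f g f' g' : R -> V) : (forall s, D s -> f s = g s) ->
  (forall s, D s -> f' s = g' s) -> derives D f f' -> derives D g g'.
Proof.
by move=> fg fg' H t Dt; rewrite -fg' //; apply: isder_ext fg (H t Dt).
Qed.

Lemma isderP V D (g : R -> V) t (l : V) : D t ->
  isder D g t l <-> forall e, 0 < e -> exists2 d, 0 < d &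
    forall s, D s -> `|s - t| < d -> `|g s - g t - (s - t) *: l| <= e * `|s - t|.
Proof.
move=> Dt; split=> [[psi gE /cvg_withinP H] e e0|H].
  have [d d0 Hd] := H _ e0; exists d => // s Ds std.
  rewrite (gE s Ds) (addrC (g t)) addrK -scalerBr normrZ mulrC.
  by rewrite ler_wpM2r // Hd.
exists (fun s => if s == t then l else (s - t)^-1 *: (g s - g t)).
  move=> s Ds; case: eqP => [->|/eqP st]; first by rewrite subrr scale0r addr0.
  by rewrite scalerA mulfV ?subr_eq0 // scale1r addrC subrK.
apply/cvg_withinP => e e0; have [d d0 Hd] := H _ e0; exists d => // s Ds std.
case: eqP => [_|/eqP st]; first by rewrite subrr normr0 ltW.
have st0 : s - t != 0 by rewrite subr_eq0.
rewrite -[l in X in _ - X]scale1r -(mulVf st0) -scalerA -scalerBr normrZ.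
by rewrite normfV ler_pdivrMl ?normr_gt0 // mulrC; apply: Hd.
Qed.

Lemma isderD V D (f g : R -> V) t (l m : V) :
  isder D f t l -> isder D g t m -> isder D (fun s => f s + g s) t (l + m).
Proof.
move=> [p fE pl] [q gE qm]; exists (fun s => p s + q s); last exact: cvgD.
by move=> s Ds; rewrite fE // gE // scalerDr addrACA.
Qed.

Lemma isder_cst V D (c : V) (t : R) : isder D (fun=> c) t 0.
Proof.
exists (fun=> 0); last exact: cvg_cst.
by move=> s _; rewrite scaler0 addr0.
Qed.

Lemma isder_id D (t : R) : isder D (id : R -> R) t 1.
Proof.
exists (fun=> 1); last exact: cvg_cst.
by move=> s _; rewrite /= [_ *: _]mulr1 addrC subrK.
Qed.

Lemma isderN V D (f : R -> V) t l : isder D f t l -> isder D (fun s => - f s) t (- l).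
Proof.
move=> [p fE pl]; exists (fun s => - p s); last exact: cvgN.
by move=> s Ds; rewrite fE // scalerN opprD.
Qed.

Lemma isderB V D (f g : R -> V) t (l m : V) :
  isder D f t l -> isder D g t m -> isder D (fun s => f s - g s) t (l - m).
Proof. by move=> ? ?; apply: isderD => //; exact: isderN. Qed.

Lemma isderZ V D (f : R -> R) (g : R -> V) t l m : D t ->
  isder D f t l -> isder D g t m ->
  isder D (fun s => f s *: g s) t (l *: g t + f t *: m).
Proof.
move=> Dt Hf Hg; have gc := isder_cvg V D g t m Dt Hg.
case: Hf Hg => [p fE pl] [q gE qm].
exists (fun s => p s *: g s + f t *: q s).
  move=> s Ds; rewrite fE // scalerDl {1}gE // scalerDr -addrA; congr (_ + _).
  by rewrite scalerDr addrC !scalerA [f t * _]mulrC.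
by apply: cvgD; apply: cvgZ => //; exact: cvg_cst.
Qed.

Lemma isderM D (f g : R -> R) t l m : D t ->
  isder D f t l -> isder D g t m ->
  isder D (fun s => f s * g s) t (l * g t + f t * m).
Proof. exact: isderZ. Qed.

Lemma isderZl V D (c : R) (g : R -> V) t m :
  isder D g t m -> isder D (fun s => c *: g s) t (c *: m).
Proof.
move=> [q gE qm]; exists (fun s => c *: q s); last by apply: cvgZ => //; exact: cvg_cst.
by move=> s Ds; rewrite gE // scalerDr !scalerA mulrC.
Qed.

Lemma isderZr V D (f : R -> R) (w : V) t l :
  isder D f t l -> isder D (fun s => f s *: w) t (l *: w).
Proof.
move=> [p fE pl]; exists (fun s => p s *: w); last by apply: cvgZ => //; exact: cvg_cst.
by move=> s Ds; rewrite fE // scalerDl scalerA.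
Qed.

Lemma isder_comp V D E (phi : R -> R) (g : R -> V) t l m :
  D t -> (forall s, D s -> E (phi s)) ->
  isder D phi t l -> isder E g (phi t) m ->
  isder D (fun s => g (phi s)) t (l *: m).
Proof.
move=> Dt DE Hphi; have phic := isder_cvg R D phi t l Dt Hphi.
case: Hphi => [p pE pl] [q gE qm].
exists (fun s => p s *: q (phi s)).
  move=> s Ds; rewrite (gE _ (DE s Ds)) {1}(pE s Ds) (addrC (phi t)) addrK.
  by rewrite -scalerA.
apply: cvgZ pl _; apply/cvg_withinP => e e0.
have /cvg_withinP/(_ _ e0)[d d0 Hd] := qm.
(* Half of [d]: [cvg_withinP] yields a non-strict bound, and [Hd] asks for a strict one. *)
have d20 : 0 < d / 2 by rewrite divr_gt0.
have /cvg_withinP/(_ _ d20)[d' d'0 Hd'] := phic.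
exists d' => // s Ds sd; apply: Hd; first exact: DE.
by apply: le_lt_trans (Hd' _ Ds sd) _; rewrite ltr_pdivrMr // ltr_pMr // ltr1n.
Qed.

Lemma cvg_sqrt_within D (f : R -> R) t :
  f s @[s --> within D (nbhs t)] --> f t ->
  Num.sqrt (f s) @[s --> within D (nbhs t)] --> Num.sqrt (f t).
Proof. by move=> H; apply: continuous_cvg H; exact: sqrt_continuous. Qed.

Lemma isder_quot V D (g : R -> V) t l : D t ->
  isder D g t l <->
  (h^-1 *: (g (h + t) - g t)) @[h --> within [set h | D (h + t)] 0^'] --> l.
Proof.
move=> Dt; split.
- move=> /isderP => /(_ Dt) H; apply/cvgrPdist_le => e e0.
  have [d d0 Hd] := H _ e0.
  exists d => //= h /=; rewrite sub0r normrN => hd h0 Dh.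
  have := Hd (h + t) Dh; rewrite addrK => /(_ hd) HH.
  rewrite distrC -[l in X in _ - X]scale1r -(mulVf h0) -scalerA.
  by rewrite -scalerBr normrZ normfV ler_pdivrMl ?normr_gt0 // mulrC.
- move=> /cvgrPdist_le H; apply/isderP => // e e0.
  have [d /= d0 Hd] := H _ e0; exists d => // s Ds std.
  have [->|st] := eqVneq s t; first by rewrite !subrr scale0r subrr !normr0 mulr0.
  have st0 : s - t != 0 by rewrite subr_eq0.
  have := Hd (s - t); rewrite /= sub0r normrN => /(_ std st0).
  rewrite subrK => /(_ Ds) HH.
  have -> : g s - g t - (s - t) *: l = - ((s - t) *: (l - (s - t)^-1 *: (g s - g t))).
    by rewrite scalerBr scalerA mulfV // scale1r opprB.
  by rewrite normrN normrZ mulrC ler_wpM2r.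
Qed.

Lemma deriveE V (g : R -> V) (t : R) :
  (fun h => h^-1 *: ((g \o shift t) (h *: (1 : R)) - g t)) = fun h => h^-1 *: (g (h + t) - g t).
Proof. by apply/funext => h /=; rewrite [h *: _]mulr1. Qed.

Lemma isder_is_derive V (D : set R) (g : R -> V) (t : R) (l : V) :
  is_derive t 1 g l -> isder D g t l.
Proof.
move=> H; suff : isder setT g t l by apply: isder_sub.
case: H => gd gl; apply/isder_quot => //; rewrite -gl -deriveE.
by apply: cvg_trans gd; apply: cvg_app => P [d d0 Hd]; exists d => // h hd h0 _; exact: Hd.
Qed.

Lemma isderV D (f : R -> R) t (l : R) : D t -> f t != 0 ->
  isder D f t l -> isder D (fun s => (f s)^-1) t (- (f t)^-1 * (f t)^-1 * l).
Proof.
move=> Dt ft Hf; rewrite mulrC mulNr -expr2 exprVn.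
apply: (isder_comp _ _ setT _ (fun y => y^-1)) => //; apply: isder_is_derive.
have := @is_deriveV R (@idfun R) (f t) 1 1 ft (is_derive_id _ _).
by rewrite [_ *: _]mulr1.
Qed.

Lemma isder_sqrt D (f : R -> R) t (l : R) : D t -> 0 < f t ->
  isder D f t l -> isder D (fun s => Num.sqrt (f s)) t ((2 * Num.sqrt (f t))^-1 * l).
Proof.
move=> Dt ft Hf; rewrite mulrC.
apply: (isder_comp _ _ setT _ Num.sqrt) => //; apply: isder_is_derive.
exact: is_derive1_sqrt.
Qed.

Lemma isder_derive V (D : set R) (g : R -> V) (t : R) (l : V) :
  (\forall s \near t, D s) -> isder D g t l -> is_derive t 1 g l.
Proof.
move=> Dn /(isder_quot _ _ _ _ _ (nbhs_singleton Dn)) H.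
have Hc : h^-1 *: ((g \o shift t) (h *: (1 : R)) - g t) @[h --> 0^'] --> l.
  rewrite deriveE; apply: cvg_trans H; apply: cvg_app => P [d /= d0 Hd].
  have [d' /= d'0 Hd'] := Dn; exists (Num.min d d'); first by rewrite /= lt_min d0 d'0.
  move=> h /=; rewrite sub0r normrN lt_min => /andP[hd hd'] h0; apply: Hd => //=.
    by rewrite sub0r normrN.
  by apply: Hd'; rewrite /= opprD addrCA subrr addr0 normrN.
by apply: DeriveDef; [apply/cvg_ex; exists l|apply/cvg_lim].
Qed.

End Filters.

(** * Calculus of functions of class C^k on a subset of the line *)

Section CKTheory.
Context {R : realType}.
Implicit Types (D E : set R) (t : R) (V W : normedModType R).
#[local] Existing Instance within_nbhs_filter.

Lemma CK_ext V D k (f g : R -> V) : (forall s, D s -> f s = g s) ->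
  CK D k f -> CK D k g.
Proof.
case: k => [|k] fg; first exact: cont_ext.
by case=> f' Hf Cf; exists f' => //; apply: derives_ext Hf.
Qed.

Lemma CK_sub V D E k (g : R -> V) : D `<=` E -> CK E k g -> CK D k g.
Proof.
move=> DE; elim: k g => [|k IH] g /=; first exact: cont_sub.
by case=> g' Hg /IH Cg; exists g' => //; apply: derives_sub Hg.
Qed.

Lemma CK_S V D k (g : R -> V) : CK D k.+1 g -> CK D k g.
Proof.
elim: k g => [|k IH] g; first by case=> g' /derives_cont.
by case=> g' Hg /IH Cg; exists g'.
Qed.

Lemma CK_le V D k m (g : R -> V) : (k <= m)%N -> CK D m g -> CK D k g.
Proof.
move=> /subnK <-; elim: (m - k)%N => [//|j IH]; rewrite addSn => /CK_S.
exact: IH.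
Qed.

Lemma CK_cst V D k (c : V) : CK D k (fun=> c).
Proof.
elim: k c => [|k IH] c; first by move=> t _; exact: cvg_cst.
by exists (fun=> 0) => // t _; exact: isder_cst.
Qed.

Lemma CK_id D k : CK D k (id : R -> R).
Proof.
case: k => [|k]; first by move=> t _; exact: cvg_within.
by exists (fun=> 1); [move=> t _; exact: isder_id|exact: CK_cst].
Qed.

Lemma CKD V D k (f g : R -> V) : CK D k f -> CK D k g -> CK D k (fun s => f s + g s).
Proof.
elim: k f g => [|k IH] f g /=.
  by move=> cf cg t Dt; apply: cvgD; [exact: cf|exact: cg].
move=> [f' Hf Cf] [g' Hg Cg]; exists (fun s => f' s + g' s); last exact: IH.
by move=> t Dt; apply: isderD; [exact: Hf|exact: Hg].
Qed.

Lemma CKN V D k (f : R -> V) : CK D k f -> CK D k (fun s => - f s).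
Proof.
elim: k f => [|k IH] f /=; first by move=> cf t Dt; apply: cvgN; exact: cf.
move=> [f' Hf Cf]; exists (fun s => - f' s); last exact: IH.
by move=> t Dt; apply: isderN; exact: Hf.
Qed.

Lemma CKB V D k (f g : R -> V) : CK D k f -> CK D k g -> CK D k (fun s => f s - g s).
Proof. by move=> Cf Cg; apply: CKD => //; exact: CKN. Qed.

Lemma CKZ V D k (f : R -> R) (g : R -> V) : CK D k f -> CK D k g ->
  CK D k (fun s => f s *: g s).
Proof.
elim: k f g => [|k IH] f g.
  by move=> cf cg t Dt; apply: cvgZ; [exact: cf|exact: cg].
move=> Cf Cg; have Cf' := CK_S _ _ _ _ Cf; have Cg' := CK_S _ _ _ _ Cg.
move: Cf Cg => [f' Hf Cf] [g' Hg Cg].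
exists (fun s => f' s *: g s + f s *: g' s); last by apply: CKD; exact: IH.
by move=> t Dt; apply: isderZ => //; [exact: Hf|exact: Hg].
Qed.

Lemma CKM D k (f g : R -> R) : CK D k f -> CK D k g -> CK D k (fun s => f s * g s).
Proof. exact: CKZ. Qed.

Lemma CK_sum V D k (I : Type) (r : seq I) (f : I -> R -> V) :
  (forall i, CK D k (f i)) -> CK D k (fun s => \sum_(i <- r) f i s).
Proof.
move=> Cf; elim: r => [|i r IH].
  by apply: (@CK_ext _ _ _ (fun=> 0)) (CK_cst _ _ _ _) => s _; rewrite big_nil.
apply: (@CK_ext _ _ _ (fun s => f i s + \sum_(j <- r) f j s)).
  by move=> s _; rewrite big_cons.
exact: CKD.
Qed.

Lemma cont_comp V D E (phi : R -> R) (g : R -> V) :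
  (forall s, D s -> E (phi s)) -> cont D phi -> cont E g ->
  cont D (fun s => g (phi s)).
Proof.
move=> DE cp cg t Dt; apply/cvg_withinP => e e0.
have /cvg_withinP/(_ _ e0)[d d0 Hd] := cg _ (DE _ Dt).
have d20 : 0 < d / 2 by rewrite divr_gt0.
have /cvg_withinP/(_ _ d20)[d' d'0 Hd'] := cp t Dt.
exists d' => // s Ds sd; apply: Hd; first exact: DE.
by apply: le_lt_trans (Hd' _ Ds sd) _; rewrite ltr_pdivrMr // ltr_pMr // ltr1n.
Qed.

Lemma CK_comp V D E k (phi : R -> R) (g : R -> V) :
  (forall s, D s -> E (phi s)) -> CK D k phi -> CK E k g ->
  CK D k (fun s => g (phi s)).
Proof.
move=> DE; elim: k g => [|k IH] g; first exact: cont_comp.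
move=> Cp; have Cp' := CK_S _ _ _ _ Cp.
move: Cp => [phi' Hp Cp] [g' Hg Cg].
exists (fun s => phi' s *: g' (phi s)); last by apply: CKZ => //; exact: IH.
by move=> t Dt; apply: (isder_comp _ D E) => //; [exact: Hp|apply: Hg; exact: DE].
Qed.

(** The derivative of the inverse is a polynomial in the inverse itself and [f'], so the induction
    applies to the same function one order lower. *)
Lemma CKV D k (f : R -> R) : (forall s, D s -> f s != 0) ->
  CK D k f -> CK D k (fun s => (f s)^-1).
Proof.
move=> f0; elim: k => [|k IH] Cf.
  by move=> t Dt; apply: cvgV; [exact: f0|exact: Cf].
have Ci := IH (CK_S _ _ _ _ Cf).
case: Cf => f' Hf Cf; exists (fun s => - (f s)^-1 * (f s)^-1 * f' s).
  by move=> t Dt; apply: isderV => //; [exact: f0|exact: Hf].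
by apply: CKM => //; apply: CKM => //; exact: CKN.
Qed.

Lemma CK_sqrt D k (f : R -> R) : (forall s, D s -> 0 < f s) ->
  CK D k f -> CK D k (fun s => Num.sqrt (f s)).
Proof.
move=> f0; elim: k => [|k IH] Cf.
  by move=> t Dt; apply: cvg_sqrt_within; exact: Cf.
have Ci := IH (CK_S _ _ _ _ Cf).
case: Cf => f' Hf Cf; exists (fun s => (2 * Num.sqrt (f s))^-1 * f' s).
  by move=> t Dt; apply: isder_sqrt => //; [exact: f0|exact: Hf].
apply: CKM => //; apply: CKV.
  by move=> s Ds; rewrite mulf_neq0 // gt_eqF // sqrtr_gt0 f0.
by apply: CKM => //; exact: CK_cst.
Qed.

Lemma isder_cos D t : isder D cos t (- sin t : R).
Proof. exact: isder_is_derive. Qed.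

Lemma isder_sin D t : isder D sin t (cos t : R).
Proof. exact: isder_is_derive. Qed.

Lemma CK_sin_cos D k : CK D k (sin : R -> R) /\ CK D k (cos : R -> R).
Proof.
elim: k => [|k [IHs IHc]].
  by split; apply: derives_cont => t _; [exact: isder_sin|exact: isder_cos].
split; [exists cos|exists (fun s => - sin s)] => //.
- by move=> t _; exact: isder_sin.
- by move=> t _; exact: isder_cos.
- exact: CKN.
Qed.

(** * Reduction of vector-valued maps to their coordinates *)

Section Coordinates.
Context {n : nat}.

Lemma mx_normrV (v : 'rV[R]_n) : `|v| = \big[Num.max/0]_ij `|v ij.1 ij.2|.
Proof. exact: mx_normrE. Qed.

Lemma mx_coord_le (v : 'rV[R]_n) i : `|v 0 i| <= `|v|.
Proof.
rewrite mx_normrV.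
exact: (le_bigmax 0 (fun ij : (ordinal 1 * ordinal n)%type => `|v ij.1 ij.2|) (0, i)).
Qed.

Lemma mx_norm_le (v : 'rV[R]_n) e : 0 <= e -> (forall i, `|v 0 i| <= e) -> `|v| <= e.
Proof.
move=> e0 H; rewrite mx_normrV.
by apply: bigmax_le => //= -[i j] _ /=; rewrite ord1.
Qed.

Lemma cvg_coord (F : set_system R) {FF : Filter F} (g : R -> 'rV[R]_n) (l : 'rV[R]_n) i :
  g s @[s --> F] --> l -> g s 0 i @[s --> F] --> l 0 i.
Proof.
move=> /cvgrPdist_le H; apply/cvgrPdist_le => e /H; apply: filterS => s Hs.
by apply: le_trans Hs; have := mx_coord_le (l - g s) i; rewrite !mxE.
Qed.

Lemma cvg_row_within D t (g : 'I_n -> R -> R) (l : 'rV[R]_n) :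
  (forall i, g i s @[s --> within D (nbhs t)] --> l 0 i) ->
  (\row_i g i s) @[s --> within D (nbhs t)] --> l.
Proof.
move=> H; apply/cvgrPdist_le => e e0.
have : \forall s \near within D (nbhs t), forall i, `|l 0 i - g i s| <= e.
  by apply: filter_forall => i; move/cvgrPdist_le: (H i); apply.
apply: filterS => s Hs; apply: mx_norm_le; first exact: ltW.
by move=> i; rewrite !mxE.
Qed.

Lemma isder_coord D (g : R -> 'rV[R]_n) t (l : 'rV[R]_n) i :
  isder D g t l -> isder D (fun s => g s 0 i) t (l 0 i).
Proof.
move=> [psi gE pl]; exists (fun s => psi s 0 i).
  by move=> s Ds; rewrite (gE s Ds) !mxE.
exact: cvg_coord.
Qed.

Lemma isder_row D t (g : 'I_n -> R -> R) (l : 'rV[R]_n) :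
  (forall i, isder D (g i) t (l 0 i)) -> isder D (fun s => \row_i g i s) t l.
Proof.
move=> H; have /choice[psi Hpsi] : forall i, exists psi : R -> R,
   (forall s, D s -> g i s = g i t + (s - t) *: psi s) /\
    psi s @[s --> within D (nbhs t)] --> l 0 i.
  by move=> i; case: (H i) => psi ? ?; exists psi.
exists (fun s => \row_i psi i s).
  by move=> s Ds; apply/rowP => i; rewrite !mxE (proj1 (Hpsi i) s Ds).
by apply: cvg_row_within => i; case: (Hpsi i).
Qed.

Lemma CK_coord D k (g : R -> 'rV[R]_n) i : CK D k g -> CK D k (fun s => g s 0 i).
Proof.
elim: k g => [|k IH] g; first by move=> cg t Dt; apply: cvg_coord; exact: cg.
case=> g' Hg Cg; exists (fun s => g' s 0 i); last exact: IH.
by move=> t Dt; apply: isder_coord; exact: Hg.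
Qed.

End Coordinates.
End CKTheory.

(** * Agreement with the derivatives and classes of the statement *)

Section Link.
Context {R : realType} (G : domain R).
Implicit Types (V : normedModType R).
#[local] Existing Instance within_nbhs_filter.

Lemma points_segment : `[dom_a G, dom_b G] `<=` points G.
Proof. by rewrite /points; case: (dom_kind G). Qed.

(* No point of the domain is isolated, so derivatives are unique. *)
Lemma increments_proper t : points G t -> ProperFilter (increments G t).
Proof.
move=> Gt; rewrite /increments; apply: Build_ProperFilter_ex.
move=> P [d /= d0 Hd]; have ab := dom_lt G.
pose e := Num.min (d / 2) ((dom_b G - dom_a G) / 2).
have e0 : 0 < e by rewrite lt_min !divr_gt0 // subr_gt0.
have ed : e < d by rewrite gt_min ltr_pdivrMr // ltr_pMr // ltr1n.
have eb : e <= (dom_b G - dom_a G) / 2 by rewrite ge_min lexx orbT.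
have [h hd [h0 hG]] : exists2 h, `|h| < d & h != 0 /\ points G (h + t).
  have [tb|tb] := leP t ((dom_a G + dom_b G) / 2).
  - exists e; first by rewrite gtr0_norm.
    split; first by rewrite gt_eqF.
    move: Gt; rewrite /points; case: (dom_kind G) => //=.
    by rewrite !in_itv /= => /andP[t1 t2]; apply/andP; split; lra.
  - exists (- e); first by rewrite normrN gtr0_norm.
    split; first by rewrite oppr_eq0 gt_eqF.
    move: Gt; rewrite /points; case: (dom_kind G) => //=.
    by rewrite !in_itv /= => /andP[t1 t2]; apply/andP; split; lra.
by exists h; apply: Hd => //=; rewrite sub0r normrN.
Qed.

Lemma isder_diff_quot V (g : R -> V) t l : points G t ->
  isder (points G) g t l <-> diff_quot g t h @[h --> increments G t] --> l.
Proof. exact: isder_quot. Qed.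

Lemma deriv_onE V (g : R -> V) t l : points G t ->
  isder (points G) g t l -> deriv_on G g t = l.
Proof.
move=> Gt /isder_diff_quot => /(_ Gt) H; have PF := increments_proper t Gt.
exact: cvg_lim.
Qed.

Lemma differentiable_onP V (g : R -> V) :
  differentiable_on G g <-> derives (points G) g (deriv_on G g).
Proof.
split=> H t Gt; first exact/isder_diff_quot/H.
by have /isder_diff_quot := H t Gt => /(_ Gt) /cvgP.
Qed.

Lemma deriv_on_ext V (f g : R -> V) t : points G t ->
  (forall s, points G s -> f s = g s) -> deriv_on G f t = deriv_on G g t.
Proof.
move=> Gt fg; rewrite /deriv_on; congr (lim _).
apply/seteqP; split=> P [d /= d0 Hd]; exists d => //= h hd h0 hG /=.
- by have := Hd h hd h0 hG; rewrite /diff_quot /= !fg.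
- by have := Hd h hd h0 hG; rewrite /diff_quot /= !fg.
Qed.

(** Points of a domain are never isolated, so any derivative exhibited in [CK] coincides with
    [deriv_on] there. This is the passage between the statement and all that follows. *)
Lemma Ck_CK V k (g : R -> V) : Ck G k g <-> CK (points G) k g.
Proof.
elim: k g => [|k IH] g.
  by split=> [[_ /contP]|cg]; last by split=> //; exact/contP.
have dS j : derivn_on G j.+1 g = derivn_on G j (deriv_on G g).
  by rewrite /derivn_on iterSr.
split=> [[H C]|].
  exists (deriv_on G g); first by apply/differentiable_onP; exact: (H 0%N).
  apply/IH; split; last by rewrite -dS.
  by move=> j jk; rewrite -dS; exact: H.
case=> g' Hg Cg.
have E : forall s, points G s -> g' s = deriv_on G g s.
  by move=> s Gs; rewrite (deriv_onE _ _ _ _ Gs (Hg s Gs)).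
have /IH[H C] := CK_ext _ _ _ _ _ E Cg.
split; last by rewrite dS.
case=> [_|j jk]; last by rewrite dS; apply: H.
by apply/differentiable_onP; apply: derives_ext Hg.
Qed.

End Link.

(** * Euclidean geometry *)

Definition dot {R : realType} {n : nat} (u v : 'rV[R]_n) : R :=
  \sum_(i < n) u 0 i * v 0 i.

Section Euclid.
Context {R : realType} {n : nat}.
Implicit Types (u v w z : 'rV[R]_n) (a b : R).

Lemma dotC u v : dot u v = dot v u.
Proof. by apply: eq_bigr => i _; rewrite mulrC. Qed.

Lemma dotDl u v w : dot (u + v) w = dot u w + dot v w.
Proof. by rewrite -big_split; apply: eq_bigr => i _; rewrite mxE mulrDl. Qed.

Lemma dotZl a u w : dot (a *: u) w = a * dot u w.
Proof. by rewrite /dot mulr_sumr; apply: eq_bigr => i _; rewrite mxE mulrA. Qed.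

Lemma dotDr u v w : dot w (u + v) = dot w u + dot w v.
Proof. by rewrite dotC dotDl !(dotC w). Qed.

Lemma dotZr a u w : dot w (a *: u) = a * dot w u.
Proof. by rewrite dotC dotZl dotC. Qed.

Lemma dotNl u w : dot (- u) w = - dot u w.
Proof. by rewrite -scaleN1r dotZl mulN1r. Qed.

Lemma dotNr u w : dot w (- u) = - dot w u.
Proof. by rewrite dotC dotNl dotC. Qed.

Lemma dot0l w : dot 0 w = 0.
Proof. by rewrite -(scale0r 0) dotZl mul0r. Qed.

Lemma dot0r w : dot w 0 = 0.
Proof. by rewrite dotC dot0l. Qed.

Lemma dot_ge0 u : 0 <= dot u u.
Proof. by apply: sumr_ge0 => i _; rewrite -expr2 sqr_ge0. Qed.

Lemma dot_eq0 u : dot u u = 0 -> u = 0.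
Proof.
move=> /eqP; rewrite psumr_eq0 => [/allP H|i _]; last by rewrite -expr2 sqr_ge0.
apply/rowP => i; have := H i; rewrite mem_index_enum mxE => /(_ isT).
by rewrite -expr2 sqrf_eq0 => /eqP.
Qed.

Definition dotE := (dotDl, dotDr, dotNl, dotNr, dotZl, dotZr).

Lemma enormE u : enorm u = Num.sqrt (dot u u).
Proof. by congr (Num.sqrt _); apply: eq_bigr => i _; rewrite expr2. Qed.

Lemma enorm_ge0 u : 0 <= enorm u.
Proof. exact: sqrtr_ge0. Qed.

Lemma sqr_enorm u : enorm u ^+ 2 = dot u u.
Proof. by rewrite enormE sqr_sqrtr // dot_ge0. Qed.

Lemma enorm_sqr_le u a : 0 <= a -> (enorm u <= a) = (dot u u <= a ^+ 2).
Proof. by move=> a0; rewrite -sqr_enorm ler_sqr // nnegrE ?enorm_ge0. Qed.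

Lemma enorm0 : enorm (0 : 'rV[R]_n) = 0.
Proof. by rewrite enormE dot0l sqrtr0. Qed.

Lemma enorm_eq0 u : enorm u = 0 -> u = 0.
Proof. by move=> H; apply: dot_eq0; rewrite -sqr_enorm H expr0n. Qed.

Lemma enorm_gt0 u : u != 0 -> 0 < enorm u.
Proof.
move=> u0; rewrite lt_neqAle enorm_ge0 andbT eq_sym.
by apply: contraNneq u0 => /enorm_eq0 ->.
Qed.

Lemma enormZ a u : enorm (a *: u) = `|a| * enorm u.
Proof. by rewrite !enormE dotZl dotZr mulrA -expr2 sqrtrM ?sqr_ge0 // sqrtr_sqr. Qed.

Lemma enormN u : enorm (- u) = enorm u.
Proof. by rewrite -scaleN1r enormZ normrN1 mul1r. Qed.

Lemma enormBC u v : enorm (u - v) = enorm (v - u).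
Proof. by rewrite -opprB enormN. Qed.

(** With [x], [y] the norms and [d] the inner product, the squared norm of [y *: u - x *: v] is
    [2 * (x * y) * (x * y - d)]. *)
Lemma cauchy_schwarz u v : dot u v <= enorm u * enorm v.
Proof.
have [->|u0] := eqVneq u 0; first by rewrite dot0l enorm0 mul0r.
have [->|v0] := eqVneq v 0; first by rewrite dot0r enorm0 mulr0.
have := dot_ge0 (enorm v *: u - enorm u *: v).
rewrite !dotE -!sqr_enorm (dotC v u).
have := enorm_gt0 _ u0; have := enorm_gt0 _ v0.
set x := enorm u; set y := enorm v; set d := dot u v => y0 x0 H.
have xy : 0 < x * y by rewrite mulr_gt0.
have : 0 <= (x * y) * (x * y - d) by nra.
by rewrite pmulr_rge0 // subr_ge0.
Qed.

Lemma norm_dot_le u v : `|dot u v| <= enorm u * enorm v.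
Proof.
rewrite ler_norml cauchy_schwarz andbT lerNl -dotNl -(enormN u).
exact: cauchy_schwarz.
Qed.

Lemma enormD u v : enorm (u + v) <= enorm u + enorm v.
Proof.
rewrite enorm_sqr_le ?addr_ge0 ?enorm_ge0 // !dotE -!sqr_enorm (dotC v u).
have := cauchy_schwarz u v; nra.
Qed.

Lemma enormB u v : enorm (u - v) <= enorm u + enorm v.
Proof. by rewrite -(enormN v) enormD. Qed.

Lemma enorm_dist u v w : enorm (u - w) <= enorm (u - v) + enorm (v - w).
Proof. by rewrite -{1}(subrK v u) -addrA enormD. Qed.

Lemma enorm_le_dist u v : enorm u <= enorm v + enorm (u - v).
Proof. by rewrite -{1}(subrK v u) addrC enormD. Qed.

Lemma ler_enorm_dist u v : `|enorm u - enorm v| <= enorm (u - v).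
Proof.
rewrite ler_norml; apply/andP; split.
- by have := enorm_le_dist v u; rewrite enormBC; lra.
- by have := enorm_le_dist u v; lra.
Qed.

Lemma enorm_coord u i : `|u 0 i| <= enorm u.
Proof.
rewrite -(ler_sqr) ?nnegrE ?enorm_ge0 // real_normK ?num_real // sqr_enorm.
by rewrite /dot (bigD1 i) //= -expr2 lerDl sumr_ge0 // => j _; rewrite -expr2 sqr_ge0.
Qed.

Lemma norm_le_enorm u : `|u| <= enorm u.
Proof. by apply: mx_norm_le (enorm_ge0 _) _ => i; exact: enorm_coord. Qed.

(** A crude factor that suffices to pass from the topology, which comes from the max norm, to
    Euclidean estimates. *)
Lemma enorm_le_norm u : enorm u <= n%:R * `|u|.
Proof.
have [n0|n0] := posnP n.
  have -> : u = 0 by apply/rowP => -[i Hi]; exfalso; rewrite n0 in Hi.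
  by rewrite enorm0 normr0 mulr0.
rewrite enorm_sqr_le ?mulr_ge0 //.
apply: (@le_trans _ _ (\sum_(i < n) `|u| ^+ 2)).
  apply: ler_sum => i _; rewrite -expr2 -[X in X <= _]real_normK ?num_real //.
  by rewrite ler_sqr ?nnegrE // mx_coord_le.
rewrite sumr_const card_ord -[X in X <= _]mulr_natl exprMn ler_wpM2r ?sqr_ge0 //.
by rewrite -natrX ler_nat -[X in (X <= _)%N]expn1 leq_pexp2l.
Qed.

(** * Differentiation of inner products and Euclidean norms *)

Section Regularity.
Variable D : set R.
Implicit Types (f g : R -> 'rV[R]_n) (t : R).
#[local] Existing Instance within_nbhs_filter.

Lemma isder_sum (I : Type) (r : seq I) (f : I -> R -> R) (l : I -> R) t :
  (forall i, isder D (f i) t (l i)) ->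
  isder D (fun s => \sum_(i <- r) f i s) t (\sum_(i <- r) l i).
Proof.
move=> H; elim: r => [|i r IH].
  rewrite big_nil; have -> : (fun s : R => \sum_(i <- [::]) f i s) = fun=> 0.
    by apply/funext => s; rewrite big_nil.
  exact: isder_cst.
rewrite big_cons.
have -> : (fun s : R => \sum_(j <- i :: r) f j s) =
          (fun s => f i s + \sum_(j <- r) f j s).
  by apply/funext => s; rewrite big_cons.
exact: isderD.
Qed.

Lemma isder_dot f g t l m : D t -> isder D f t l -> isder D g t m ->
  isder D (fun s => dot (f s) (g s)) t (dot l (g t) + dot (f t) m).
Proof.
move=> Dt Hf Hg; rewrite -big_split; apply: isder_sum => i.
by apply: isderM => //; exact: isder_coord.
Qed.

Lemma isder_dotr f z t l : isder D f t l ->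
  isder D (fun s => dot (f s) z) t (dot l z).
Proof.
move=> Hf; apply: isder_sum => i.
by apply: (isderZr R); exact: isder_coord.
Qed.

Lemma CK_dot k f g : CK D k f -> CK D k g -> CK D k (fun s => dot (f s) (g s)).
Proof.
by move=> Cf Cg; apply: CK_sum => i; apply: CKM; exact: CK_coord.
Qed.

Lemma CK_enorm k f : (forall s, D s -> f s != 0) -> CK D k f ->
  CK D k (fun s => enorm (f s)).
Proof.
move=> f0 Cf; apply: (@CK_ext _ _ _ _ (fun s => Num.sqrt (dot (f s) (f s)))).
  by move=> s Ds; rewrite enormE.
apply: CK_sqrt; last exact: CK_dot.
move=> s Ds; rewrite -sqr_enorm exprn_gt0 // enorm_gt0 //; exact: f0.
Qed.

Lemma cont_enorm f : cont D f -> cont D (fun s => enorm (f s)).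
Proof.
move=> cf t Dt; rewrite enormE.
apply: (@cvg_within_eq _ _ _ (fun s => Num.sqrt (dot (f s) (f s)))).
  by move=> s Ds; rewrite enormE.
apply: (cvg_sqrt_within D (fun s => dot (f s) (f s))).
exact: (CK_dot 0).
Qed.

Lemma isder_enorm f t l : f t != 0 -> D t -> isder D f t l ->
  isder D (fun s => enorm (f s)) t ((enorm (f t))^-1 * dot (f t) l).
Proof.
move=> ft Dt Hf; have e0 := enorm_gt0 _ ft.
have d0 : 0 < dot (f t) (f t) by rewrite -sqr_enorm exprn_gt0.
have H := isder_sqrt D _ t _ Dt d0 (isder_dot _ _ _ _ _ Dt Hf Hf).
have -> : (enorm (f t))^-1 * dot (f t) l =
    (2 * Num.sqrt (dot (f t) (f t)))^-1 * (dot l (f t) + dot (f t) l).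
  by rewrite -enormE (dotC l); field; rewrite gt_eqF.
by apply: isder_ext H => // s _; rewrite enormE.
Qed.

End Regularity.
End Euclid.

(** * Primitives and integrals *)

Section Primitive.
Context {R : realType}.
Implicit Types (p q r s t : R) (f g F G : R -> R).

Lemma derives_MVT p q F f : p < q -> derives `[p, q] F f ->
  exists2 c, p <= c <= q & F q - F p = f c * (q - p).
Proof.
move=> pq HF.
have cF : {within `[p, q], continuous F} by apply/contP; exact: derives_cont HF.
have HF' x : x \in `]p, q[%R -> is_derive x 1 F (f x).
  move=> xpq; apply: (isder_derive _ `[p, q]).
  - have : \forall y \near x, y \in `]p, q[%R by exact: near_in_itvoo.
    by apply: filterS => y; exact: subset_itv_oo_cc.
  - by apply: HF; exact: subset_itv_oo_cc.
have [c + ->] := MVT pq HF' cF; rewrite in_itv /= => /andP[pc cq].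
by exists c => //; rewrite !ltW.
Qed.

Lemma derives_le p q F f G g : p <= q -> derives `[p, q] F f ->
  derives `[p, q] G g -> (forall t, p <= t <= q -> f t <= g t) ->
  F q - F p <= G q - G p.
Proof.
rewrite le_eqVlt => /predU1P[<-|pq] HF HG fg; first by rewrite !subrr.
have HD : derives `[p, q] (fun t => G t - F t) (fun t => g t - f t).
  by move=> t pqt; apply: isderB; [exact: HG|exact: HF].
have [c pcq E] := derives_MVT _ _ _ _ pq HD.
have : 0 <= (g c - f c) * (q - p) by rewrite mulr_ge0 // subr_ge0 ?fg // ltW.
by rewrite -E; lra.
Qed.

Lemma derives_unique p q F f G g : p <= q -> derives `[p, q] F f ->
  derives `[p, q] G g -> (forall t, p <= t <= q -> f t = g t) ->
  F q - F p = G q - G p.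
Proof.
move=> pq HF HG fg; apply/le_anti/andP; split.
- by apply: derives_le HF HG _ => // t /fg ->.
- by apply: derives_le HG HF _ => // t /fg ->.
Qed.

Lemma derives_sub_itv (V : normedModType R) p q s t (g g' : R -> V) : p <= s -> t <= q ->
  derives `[p, q] g g' -> derives `[s, t] g g'.
Proof.
move=> ps tq; apply: derives_sub => x /=; rewrite !in_itv /= => /andP[sx xt].
by rewrite (le_trans ps sx) (le_trans xt tq).
Qed.

Lemma cont_setT f : cont setT f -> continuous f.
Proof.
move=> cf t; have := cf t I; rewrite withinET; exact.
Qed.

(** The fundamental theorem of the library differentiates an integral from a fixed left end, hence
    the half-line [- N < t]. The normalization at 0 makes the primitives for different [N] agree. *)
Lemma local_primitive f N : cont setT f -> 0 < N ->
  exists2 F, F 0 = 0 & forall t, - N < t -> is_derive t 1 F (f t).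
Proof.
move=> cf N0; have cf' := cont_setT _ cf.
pose F x := (\int[@lebesgue_measure R]_(t in [set` `[- N, x]%R]) (f t))%R.
have HF x : - N < x -> is_derive x 1 F (f x).
  move=> Nx.
  have int : (@lebesgue_measure R).-integrable `[- N, x + 1] (EFin \o f).
    apply: continuous_compact_integrable; first exact: segment_compact.
    exact: continuous_subspaceT.
  have xx1 : x < x + 1 by rewrite ltrDl.
  have [dF F1] := continuous_FTC1_closed xx1 int Nx (cf' x).
  by apply: DeriveDef; [exact: dF|rewrite -derive1E].
exists (fun t => F t - F 0); first by rewrite subrr.
move=> t Nt; have := HF t Nt => H.
rewrite -[f t]subr0.
exact: is_deriveB.
Qed.

Lemma primitive_setT f : cont setT f -> exists F, derives setT F f.
Proof.
move=> cf; have /choice[F HF] : forall k : nat, exists F : R -> R,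
    F 0 = 0 /\ forall t, - k.+1%:R < t -> is_derive t 1 F (f t).
  by move=> k; have [F ? ?] := local_primitive f k.+1%:R cf (ltr0Sn _ _); exists F.
have HD k t : - k.+1%:R < t -> isder setT (F k) t (f t).
  by move=> kt; apply: isder_is_derive; exact: (proj2 (HF k)).
have E k m t : `|t| < k.+1%:R -> `|t| < m.+1%:R -> F k t = F m t.
  rewrite !ltr_norml => /andP[t1 t2] /andP[t3 t4].
  have [t0|t0] := leP 0 t.
  - have := derives_unique 0 t (F k) f (F m) f t0; rewrite !(proj1 (HF _)) !subr0.
    apply => // x /=; rewrite in_itv /= => /andP[x0 xt];
      apply: (isder_sub _ _ setT) => //; apply: HD; apply: lt_le_trans x0;
      by rewrite oppr_lt0.
  - have := derives_unique t 0 (F k) f (F m) f (ltW t0).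
    rewrite !(proj1 (HF _)) !sub0r => H; apply: oppr_inj; apply: H => //;
      move=> x /=; rewrite in_itv /= => /andP[x0 xt];
      apply: (isder_sub _ _ setT) => //; apply: HD; exact: lt_le_trans x0.
(* The margin of 1 in [kP] lets the single primitive [F (k t)] serve at all points within distance 1
   of [t]. *)
pose k t := (Num.truncn `|t|).+1.
have kP t : `|t| + 1 < (k t).+1%:R.
  rewrite /k -natr1 ltrD2r.
  by have /andP[] := truncn_itv (normr_ge0 t).
exists (fun t => F (k t) t) => t _.
apply/isderP => // e e0.
have kt := kP t.
have Dt : - (k t).+1%:R < t.
  by have := ler_norm (- t); rewrite normrN; lra.
have /isderP/(_ _ e0)[//|d d0 Hd] := HD _ _ Dt.
exists (Num.min d 1); first by rewrite lt_min d0 ltr01.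
move=> s _; rewrite lt_min => /andP[sd s1].
rewrite (E (k s) (k t)); first by apply: Hd.
- by have := kP s; lra.
- by have := ler_distD t s 0; rewrite !subr0; lra.
Qed.

Definition clamp p q t := Num.max p (Num.min t q).

Lemma clamp_itv p q t : p <= q -> p <= clamp p q t <= q.
Proof.
by move=> pq; rewrite /clamp le_max lexx /= ge_max pq ge_min lexx orbT.
Qed.

Lemma clampK p q t : p <= t <= q -> clamp p q t = t.
Proof.
by move=> /andP[pt tq]; rewrite /clamp min_l // max_r.
Qed.

Lemma cont_clamp p q : cont setT (clamp p q).
Proof.
apply/contP; apply: continuous_subspaceT => t.
have cm : {for t, continuous (fun t => Num.min t q)}.
  by apply: (@continuous_min R R id (fun=> q)); [exact: cvg_id|exact: cvg_cst].
exact: (@continuous_max R R (fun=> p) _ t (cvg_cst _) cm).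
Qed.

(** Clamping the argument extends [f] continuously to the whole line. *)
Lemma primitive_seg (p q : R) f : p <= q -> cont `[p, q] f ->
  exists F, derives `[p, q] F f.
Proof.
move=> pq cf; have [|F HF] := primitive_setT (fun t => f (clamp p q t)).
  apply: cont_comp cf; last exact: cont_clamp.
  by move=> s _ /=; rewrite in_itv /= clamp_itv.
exists F; have := derives_sub _ _ _ _ _ (@subsetT _ `[p, q]%classic) HF.
by apply: derives_ext => // s /=; rewrite in_itv /= => /clampK ->.
Qed.

End Primitive.

Definition prim {R : realType} (p q : R) (f : R -> R) : R -> R :=
  xget (fun=> 0) [set F | derives `[p, q] F f].

(** The integral is the increment of a primitive; by [derives_unique] the primitive chosen by [prim]
    does not matter. Measure theory enters only through [local_primitive]. *)
Definition rint {R : realType} (p q : R) (f : R -> R) : R :=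
  prim p q f q - prim p q f p.

Definition vint {R : realType} {n : nat} (p q : R) (f : R -> 'rV[R]_n) : 'rV[R]_n :=
  \row_i rint p q (fun t => f t 0 i).

Section Integral.
Context {R : realType}.
Implicit Types (p q r s t : R) (f g F G : R -> R).

Lemma cont_sub_itv (V : normedModType R) p q s t (g : R -> V) : p <= s -> t <= q ->
  cont `[p, q] g -> cont `[s, t] g.
Proof.
move=> ps tq; apply: cont_sub => x /=; rewrite !in_itv /= => /andP[sx xt].
by rewrite (le_trans ps sx) (le_trans xt tq).
Qed.

Lemma primP p q f : p <= q -> cont `[p, q] f -> derives `[p, q] (prim p q f) f.
Proof. by move=> pq /(primitive_seg _ _ _ pq); exact: xgetPex. Qed.

Lemma rint_eq p q F f : p <= q -> derives `[p, q] F f -> rint p q f = F q - F p.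
Proof.
move=> pq HF; have : exists F, derives `[p, q] F f by exists F.
move=> /(@xgetPex _ (fun=> 0)) HP.
exact: (derives_unique _ _ _ _ _ _ pq HP HF).
Qed.

Lemma rint_le p q f g : p <= q -> cont `[p, q] f -> cont `[p, q] g ->
  (forall t, p <= t <= q -> f t <= g t) -> rint p q f <= rint p q g.
Proof.
move=> pq /(primP _ _ _ pq) Pf /(primP _ _ _ pq) Pg.
exact: derives_le.
Qed.

(** Functions equal on [[p, q]] have the same set of primitives there, hence the same chosen one. *)
Lemma rint_congr p q f g : (forall t, p <= t <= q -> f t = g t) ->
  rint p q f = rint p q g.
Proof.
move=> fg; rewrite /rint /prim.
suff -> : [set F | derives `[p, q] F f] = [set F | derives `[p, q] F g] by [].
by apply/seteqP; split=> F /=; apply: derives_ext => // s /=; rewrite in_itv /= => sI; rewrite fg.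
Qed.

Lemma rintD p q f g : p <= q -> cont `[p, q] f -> cont `[p, q] g ->
  rint p q (fun t => f t + g t) = rint p q f + rint p q g.
Proof.
move=> pq /(primP _ _ _ pq) Pf /(primP _ _ _ pq) Pg.
rewrite (rint_eq _ _ (fun t => prim p q f t + prim p q g t)) //.
  by rewrite /rint opprD addrACA.
by move=> t pqt; apply: isderD; [exact: Pf|exact: Pg].
Qed.

Lemma rintZ p q c f : p <= q -> cont `[p, q] f ->
  rint p q (fun t => c * f t) = c * rint p q f.
Proof.
move=> pq /(primP _ _ _ pq) Pf.
rewrite (rint_eq _ _ (fun t => c * prim p q f t)) //; first by rewrite /rint mulrBr.
by move=> t pqt; apply: (isderZl R); exact: Pf.
Qed.

Lemma rint_cst p q c : p <= q -> rint p q (fun=> c) = c * (q - p).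
Proof.
move=> pq; rewrite (rint_eq _ _ (fun t => c * t)) ?mulrBr // => t pqt.
by rewrite -[X in isder _ _ _ X]mulr1; apply: (isderZl R); exact: isder_id.
Qed.

Lemma rintN p q f : p <= q -> cont `[p, q] f -> rint p q (fun t => - f t) = - rint p q f.
Proof.
move=> pq cf; rewrite -mulN1r -(rintZ _ _ _ _ pq cf); congr rint; apply/funext => t.
by rewrite mulN1r.
Qed.

Lemma rintB p q f g : p <= q -> cont `[p, q] f -> cont `[p, q] g ->
  rint p q (fun t => f t - g t) = rint p q f - rint p q g.
Proof.
by move=> pq cf cg; rewrite rintD ?rintN //; exact: (CKN _ _ 0).
Qed.

Lemma rint_le_cst p q c f : p <= q -> cont `[p, q] f ->
  (forall t, p <= t <= q -> f t <= c) -> rint p q f <= c * (q - p).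
Proof.
move=> pq cf fc; rewrite -rint_cst //; apply: rint_le => //; exact: (CK_cst _ _ 0).
Qed.

Lemma rint_ge_cst p q c f : p <= q -> cont `[p, q] f ->
  (forall t, p <= t <= q -> c <= f t) -> c * (q - p) <= rint p q f.
Proof.
move=> pq cf fc; rewrite -rint_cst //; apply: rint_le => //; exact: (CK_cst _ _ 0).
Qed.

Lemma rint_ge0 p q f : p <= q -> cont `[p, q] f ->
  (forall t, p <= t <= q -> 0 <= f t) -> 0 <= rint p q f.
Proof. by move=> pq cf f0; rewrite -(mul0r (q - p)); exact: rint_ge_cst. Qed.

Lemma rint_sub p q s t F f : p <= s -> s <= t -> t <= q -> derives `[p, q] F f ->
  rint s t f = F t - F s.
Proof.
by move=> ps st tq HF; apply: rint_eq => //; apply: derives_sub_itv HF.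
Qed.

Lemma rint_chasles p q r f : p <= r -> r <= q -> cont `[p, q] f ->
  rint p q f = rint p r f + rint r q f.
Proof.
move=> pr rq cf; have pq := le_trans pr rq; have HP := primP _ _ _ pq cf.
rewrite (rint_sub p q p q _ f _ _ _ HP) // (rint_sub p q p r _ f _ _ _ HP) //.
by rewrite (rint_sub p q r q _ f _ _ _ HP) //; ring.
Qed.

Lemma rint_point p f : rint p p f = 0.
Proof. by rewrite /rint subrr. Qed.

Lemma rint_dist p q f g c : p <= q -> cont `[p, q] f -> cont `[p, q] g ->
  (forall t, p <= t <= q -> `|f t - g t| <= c) -> `|rint p q f - rint p q g| <= c * (q - p).
Proof.
move=> pq cf cg fg; rewrite -rintB // ler_norml -mulNr.
have cfg : cont `[p, q] (fun t => f t - g t) by exact: (CKB _ _ 0).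
by apply/andP; split; [apply: rint_ge_cst|apply: rint_le_cst] => // t /fg;
  rewrite ler_norml => /andP[].
Qed.

Lemma cont_bounded p q f : p <= q -> cont `[p, q] f ->
  exists2 C, 0 < C & forall t, p <= t <= q -> f t <= C.
Proof.
move=> pq /contP cf; have [c _ Hc] := EVT_max pq cf.
exists (`|f c| + 1); first by rewrite ltr_wpDl.
move=> t tpq; have /Hc : t \in `[p, q] by rewrite in_itv.
by have := ler_norm (f c); lra.
Qed.

Lemma cont_lower p q f : p <= q -> cont `[p, q] f ->
  (forall t, p <= t <= q -> 0 < f t) ->
  exists2 m, 0 < m & forall t, p <= t <= q -> m <= f t.
Proof.
move=> pq /contP cf f0; have [c cpq Hc] := EVT_min pq cf.
exists (f c) => [|t tpq]; first by apply: f0; rewrite in_itv in cpq.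
by apply: Hc; rewrite in_itv.
Qed.

Lemma cont_ivt p q f v : p <= q -> cont `[p, q] f -> f p <= v <= f q ->
  exists2 c, p <= c <= q & f c = v.
Proof.
move=> pq /contP cf /andP[v1 v2]; have [|c] := IVT pq cf (v := v).
  by rewrite ge_min v1 le_max v2 orbT.
by rewrite in_itv /= => ? ?; exists c.
Qed.

Lemma lip_cont (V : normedModType R) (D : set R) (g : R -> V) C :
  (forall s t, D s -> D t -> `|g s - g t| <= C * `|s - t|) -> cont D g.
Proof.
move=> H t Dt; apply/cvg_withinP => e e0.
exists (e / (`|C| + 1)); first by rewrite divr_gt0 // ltr_wpDl.
move=> s Ds; rewrite ltr_pdivlMr ?ltr_wpDl // => sd.
apply: le_trans (H _ _ Ds Dt) _; apply: le_trans (ltW sd).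
by rewrite mulrC ler_wpM2l // (le_trans (ler_norm C)) // lerDl.
Qed.

(** * Vector-valued integrals and the mean value inequality *)

Section Vector.
Context {n : nat}.
Implicit Types (u v : R -> 'rV[R]_n).

Lemma vint_eq p q u v : p <= q -> derives `[p, q] u v -> vint p q v = u q - u p.
Proof.
move=> pq H; apply/rowP => i; rewrite !mxE; apply: (rint_eq _ _ (fun t => u t 0 i)) => //.
by move=> t pqt; apply: isder_coord; exact: H.
Qed.

Lemma vprimitive p q v : p <= q -> cont `[p, q] v -> exists u, derives `[p, q] u v.
Proof.
move=> pq cv; exists (fun t => \row_i prim p q (fun t => v t 0 i) t).
move=> t pqt; apply: isder_row => i; apply: (primP p q) => //.
exact: (CK_coord _ 0).
Qed.

Lemma vprimitive_setT v : cont setT v -> exists u, derives setT u v.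
Proof.
move=> cv; have /choice[u Hu] : forall i, exists F, derives setT F (fun t => v t 0 i).
  by move=> i; apply: primitive_setT; exact: (CK_coord _ 0).
exists (fun t => \row_i u i t) => t _; apply: isder_row => i; exact: Hu.
Qed.

Lemma dot_vint p q v z : p <= q -> cont `[p, q] v ->
  dot (vint p q v) z = rint p q (fun t => dot (v t) z).
Proof.
move=> pq cv; have [u Hu] := vprimitive _ _ _ pq cv.
rewrite (vint_eq _ _ _ _ pq Hu) dotDl dotNl.
rewrite (rint_eq _ _ (fun t => dot (u t) z)) // => t pqt.
by apply: isder_dotr; exact: Hu.
Qed.

Lemma cont_dotr (D : set R) v z : cont D v -> cont D (fun t => dot (v t) z).
Proof. by move=> cv; apply: (CK_dot _ 0) => //; exact: (CK_cst _ _ 0). Qed.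

(** The scalar mean value theorem is applied to the inner product of [u] with the increment [w]
    itself; Cauchy-Schwarz then bounds the squared norm of [w] by [C * (t - s)] times its norm. *)
Lemma enorm_mvt p q u v C : derives `[p, q] u v ->
  (forall t, p <= t <= q -> enorm (v t) <= C) ->
  forall s t, p <= s <= q -> p <= t <= q -> enorm (u t - u s) <= C * `|t - s|.
Proof.
move=> Hu vC; have key s t : p <= s -> s <= t -> t <= q ->
    enorm (u t - u s) <= C * (t - s).
  move=> ps st tq; have Hs := derives_sub_itv _ _ _ _ _ _ _ ps tq Hu.
  set w := u t - u s.
  have C0 : 0 <= C.
    by apply: le_trans (enorm_ge0 _) (vC s _); rewrite ps (le_trans st tq).
  have [->|w0] := eqVneq w 0; first by rewrite enorm0 mulr_ge0 // subr_ge0.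
  have lt : s < t by rewrite lt_neqAle st andbT; apply: contraNneq w0 => E; rewrite /w E subrr.
  have wp := enorm_gt0 _ w0; rewrite -(ler_pM2r wp) -expr2 sqr_enorm {1}/w dotDl dotNl.
  have Hd : derives `[s, t] (fun x => dot (u x) w) (fun x => dot (v x) w).
    by move=> x xst; apply: isder_dotr; exact: Hs.
  have [c /andP[sc ct] ->] := derives_MVT _ _ _ _ lt Hd.
  rewrite mulrAC ler_wpM2r ?subr_ge0 //; apply: le_trans (cauchy_schwarz _ _) _.
  by rewrite ler_wpM2r ?enorm_ge0 // vC // (le_trans ps sc) (le_trans ct tq).
move=> s t /andP[ps sq] /andP[pt tq]; have [st|st] := leP s t.
  by rewrite ger0_norm ?subr_ge0 // key.
by rewrite ltr0_norm ?subr_lt0 // opprB enormBC key // ltW.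
Qed.

Lemma enorm_vint_le p q v C : p <= q -> cont `[p, q] v ->
  (forall t, p <= t <= q -> enorm (v t) <= C) -> enorm (vint p q v) <= C * (q - p).
Proof.
move=> pq cv vC; have [u Hu] := vprimitive _ _ _ pq cv; rewrite (vint_eq _ _ _ _ pq Hu).
have := enorm_mvt _ _ _ _ _ Hu vC p q; rewrite !lexx pq ger0_norm ?subr_ge0 //.
by apply.
Qed.

Lemma vintB p q u v : p <= q -> cont `[p, q] u -> cont `[p, q] v ->
  vint p q (fun t => u t - v t) = vint p q u - vint p q v.
Proof.
move=> pq cu cv; apply/rowP => i; rewrite !mxE.
rewrite -(rintB _ _ _ _ pq (CK_coord _ 0 _ i cu) (CK_coord _ 0 _ i cv)).
by congr rint; apply/funext => t; rewrite !mxE.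
Qed.

Lemma vint_congr p q u v : (forall t, p <= t <= q -> u t = v t) -> vint p q u = vint p q v.
Proof. by move=> uv; apply/rowP => i; rewrite !mxE; apply: rint_congr => t /uv ->. Qed.

End Vector.
End Integral.

(** * Bumps and periodization *)

(** The classical flat function exp(-1/y) with extra negative powers of [y]: these make the family
    closed under differentiation, up to linear combinations, so smoothness is an induction over all
    [m] at once. *)
Definition flat {R : realType} (m : nat) (y : R) : R :=
  if 0 < y then y^-1 ^+ m * expR (- y^-1) else 0.

Section Flat.
Context {R : realType}.
Implicit Types (m : nat) (y t p q : R).

Lemma isder_near (V : normedModType R) (D : set R) (f g : R -> V) t l d :
  D t -> 0 < d -> (forall s, D s -> `|s - t| < d -> f s = g s) ->
  isder D f t l -> isder D g t l.
Proof.
move=> Dt d0 fg /(isderP _ _ _ _ _ Dt) H; apply/isderP => // e /H[d' d'0 Hd'].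
exists (Num.min d d'); first by rewrite lt_min d0.
move=> s Ds; rewrite lt_min => /andP[sd sd']; rewrite -!fg ?subrr ?normr0 //.
exact: Hd'.
Qed.

Lemma flat_neg m y : y <= 0 -> flat m y = 0.
Proof. by move=> y0; rewrite /flat ltNge y0. Qed.

Lemma flat_ge0 m y : 0 <= flat m y.
Proof.
rewrite /flat; case: ifP => // y0.
by rewrite mulr_ge0 ?expR_ge0 // exprn_ge0 // invr_ge0 ltW.
Qed.

(** The exponential at [x = y^-1] dominates its Taylor term of degree [m.+2]. A quadratic bound is
    what gives derivative 0 at the origin. *)
Lemma flat_le m y : flat m y <= (m.+2)`!%:R * y ^+ 2.
Proof.
rewrite /flat; case: ifP => y0; last by rewrite mulr_ge0 // sqr_ge0.
rewrite expRN; have x0 : 0 < y^-1 by rewrite invr_gt0.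
rewrite -{3}(invrK y); move: y^-1 x0 => x x0.
have H : x ^+ m.+2 / m.+2`!%:R <= expR x.
  by apply: le_trans (@expR_ge1Dxn _ x m.+1 (ltW x0)); rewrite lerDr.
rewrite ler_pdivrMr ?expR_gt0 // exprVn mulrAC ler_pdivlMr ?exprn_gt0 //.
by rewrite -exprD addn2 mulrC -ler_pdivrMr // ltr0n fact_gt0.
Qed.

Lemma isder_flat m t : isder setT (flat m) t (flat m.+2 t - m%:R * flat m.+1 t).
Proof.
have [t0|t0|->] := ltrgtP t 0.
- rewrite !(flat_neg _ _ (ltW t0)) mulr0 subrr.
  apply: (isder_near _ _ (fun=> 0) _ _ _ (- t)) (isder_cst _ _ _ _) => //.
    by rewrite oppr_gt0.
  move=> s _; rewrite ltr_norml => /andP[_ st].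
  by rewrite flat_neg //; lra.
- rewrite /flat t0.
  apply: (isder_near _ _ (fun y => y^-1 ^+ m * expR (- y^-1)) _ _ _ t) => //.
    move=> s _; rewrite ltr_norml => /andP[st _].
    by rewrite ifT //; lra.
  apply: isder_is_derive.
  have tN : t != 0 by rewrite gt_eqF.
  have H1 : is_derive t 1 (fun y : R => y^-1) (- t ^- 2).
    have := @is_deriveV R (@idfun R) t 1 1 tN (is_derive_id _ _).
    by rewrite [_ *: _]mulr1.
  have H2 : is_derive t 1 (fun y : R => expR (- y^-1)) (expR (- t^-1) * t ^- 2).
    have := @is_derive1_comp R expR (fun y => - y^-1) t _ _ (is_derive_expR _) (is_deriveN H1).
    by rewrite opprK.
  have H3 := is_deriveM (is_deriveX m H1) H2.
  have -> : (fun y : R => y^-1 ^+ m * expR (- y^-1)) =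
      ((fun y : R => y^-1) ^+ m * (fun y : R => expR (- y^-1))).
    by apply/funext => y; rewrite mulrfctE exprfctE.
  apply: (@is_derive_eq _ _ _ _ _ _ _ _ H3); rewrite /GRing.scale /=.
  rewrite !exprfctE; clear H3.
  case: m => [|k]; first by rewrite !mul0r !mulr0 addr0 subr0 expr0 mul1r mulrC exprVn.
  rewrite /= !exprS expr0 !mulr1; move: (expR _) => e; rewrite exprVn.
  have tm : t ^+ k != 0 by rewrite expf_neq0.
  by field; rewrite tN tm.
- rewrite !flat_neg // mulr0 subrr; apply/isderP => // e e0.
  exists (e / (m.+2)`!%:R); first by rewrite divr_gt0 // ltr0n fact_gt0.
  move=> s _; rewrite (flat_neg m 0) // scaler0 !subr0 => sd.
  rewrite ger0_norm ?flat_ge0 //; apply: le_trans (flat_le _ _) _.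
  rewrite -[s ^+ 2]real_normK ?num_real // expr2 mulrA ler_wpM2r //.
  by rewrite mulrC -ler_pdivlMr ?ltW // ltr0n fact_gt0.
Qed.

Lemma CK_flat k m : CK setT k (flat m : R -> R).
Proof.
elim: k m => [|k IH] m; first by apply: derives_cont => t _; exact: isder_flat.
exists (fun y => flat m.+2 y - m%:R * flat m.+1 y); first by move=> t _; exact: isder_flat.
by apply: CKB => //; apply: CKM => //; exact: CK_cst.
Qed.

(** The standard bump exp(-1/(1 - x^2)), centred at the midpoint. The radius is a quarter of the
    length, so the support is the middle half of [[p, q]] and stays away from both ends. *)
Definition hump p q t : R := flat 0 (1 - ((t - (p + q) / 2) / ((q - p) / 4)) ^+ 2).

Definition dhump p q t : R :=
  (- (2 * ((t - (p + q) / 2) / ((q - p) / 4)) / ((q - p) / 4))) *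
  flat 2 (1 - ((t - (p + q) / 2) / ((q - p) / 4)) ^+ 2).

Lemma hump_derives p q : derives setT (hump p q) (dhump p q).
Proof.
move=> t _; rewrite /hump /dhump; set c := (p + q) / 2; set r := (q - p) / 4.
have H1 : isder setT (fun s : R => (s - c) / r) t (r^-1).
  have := isderM setT (fun s => s - c) (fun=> r^-1) t _ _ I
    (isderB _ _ _ _ _ _ _ (isder_id _ _) (isder_cst _ _ c _)) (isder_cst _ _ _ _).
  by rewrite subr0 mul1r mulr0 addr0.
have H2 := isderB _ _ _ _ _ _ _ (isder_cst _ setT (1 : R) t) (isderM setT _ _ _ _ _ I H1 H1).
have := isder_comp _ _ setT _ _ _ _ _ I (fun _ _ => I) H2 (isder_flat 0 _).
rewrite -expr2 mul0r subr0 sub0r; congr (isder _ _ _ _).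
by congr (_ *: _); rewrite /=; ring.
Qed.

Lemma hump_CK k p q : CK setT k (hump p q).
Proof.
apply: (CK_comp _ _ setT); [by []| |exact: CK_flat].
apply: CKB; first exact: CK_cst.
by apply: CKM; apply: CKM; try exact: CK_cst; apply: CKB; [exact: CK_id|exact: CK_cst|
  exact: CK_id|exact: CK_cst].
Qed.

Lemma isder_setT_unique (V : normedModType R) (g : R -> V) t (l m : V) :
  isder setT g t l -> isder setT g t m -> l = m.
Proof.
have N : \forall s \near t, [set: R] s by apply: filterS filterT.
move=> /(isder_derive _ _ _ _ _ N) H1 /(isder_derive _ _ _ _ _ N) H2.
by case: H1 H2 => _ <- [_ <-].
Qed.

(** [hump_CK] supplies some continuous derivative, and uniqueness identifies it with the explicit
    formula. *)
Lemma dhump_cont p q : cont setT (dhump p q).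
Proof.
have [g Hg] := hump_CK 1 p q; apply: cont_ext => t _.
exact: isder_setT_unique (Hg t I) (hump_derives p q t I).
Qed.

Lemma hump_arg_le0 p q t : p < q -> ~~ ((3 * p + q) / 4 <= t <= (p + 3 * q) / 4) ->
  1 - ((t - (p + q) / 2) / ((q - p) / 4)) ^+ 2 <= 0.
Proof.
move=> pq; rewrite negb_and -!ltNge => H.
rewrite exprMn exprVn subr_le0 ler_pdivlMr ?mul1r; last first.
  by rewrite exprn_gt0 // divr_gt0 // subr_gt0.
by case/orP: H => H; nra.
Qed.

Lemma hump_out p q t : p < q -> ~~ ((3 * p + q) / 4 <= t <= (p + 3 * q) / 4) ->
  hump p q t = 0.
Proof. by move=> pq H; rewrite /hump flat_neg // hump_arg_le0. Qed.

Lemma dhump_out p q t : p < q -> ~~ ((3 * p + q) / 4 <= t <= (p + 3 * q) / 4) ->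
  dhump p q t = 0.
Proof. by move=> pq H; rewrite /dhump flat_neg ?mulr0 // hump_arg_le0. Qed.

Lemma hump_ge0 p q t : 0 <= hump p q t.
Proof. exact: flat_ge0. Qed.

Lemma flat0_le1 y : flat 0 y <= 1.
Proof.
rewrite /flat; case: ifP => // y0; rewrite expr0 mul1r expR_le1 oppr_le0 invr_ge0.
exact: ltW.
Qed.

Lemma hump_le1 p q t : hump p q t <= 1.
Proof. exact: flat0_le1. Qed.

Lemma hump_mid p q : hump p q ((p + q) / 2) = expR (- 1).
Proof. by rewrite /hump subrr mul0r expr0n subr0 /flat ltr01 expr0 mul1r invr1. Qed.

(** On the middle quarter the rescaled variable has absolute value at most 1/2, so its square is
    certainly at most 1/2. *)
Lemma hump_middle p q t : p < q -> (5 * p + 3 * q) / 8 <= t <= (3 * p + 5 * q) / 8 ->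
  expR (- 2) <= hump p q t.
Proof.
move=> pq /andP[t1 t2]; rewrite /hump.
set x := (t - (p + q) / 2) / ((q - p) / 4); have qp : 0 < q - p by rewrite subr_gt0.
have : x ^+ 2 <= 1 / 2.
  rewrite /x exprMn exprVn ler_pdivrMr ?exprn_gt0 ?divr_gt0 //; nra.
move=> x2; have y2 : 1 / 2 <= 1 - x ^+ 2 by lra.
rewrite /flat ifT; last by apply: lt_le_trans y2; rewrite divr_gt0.
rewrite expr0 mul1r ler_expR lerN2 -[leRHS]invrK lef_pV2 ?posrE ?invr_gt0 //.
  by rewrite -div1r.
by apply: lt_le_trans y2; rewrite divr_gt0.
Qed.

(** On the support the rescaled variable is at most 1 in absolute value, the chain rule contributes
    [8 / (q - p)], and [flat 2] is at most 4! = 24; the product is [192 / (q - p)]. *)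
Lemma dhump_le p q t : p < q -> `|dhump p q t| <= 192 / (q - p).
Proof.
move=> pq; have qp : 0 < q - p by rewrite subr_gt0.
rewrite /dhump; set x := (t - (p + q) / 2) / ((q - p) / 4).
have [y0|y0] := leP (1 - x ^+ 2) 0; first by rewrite flat_neg // mulr0 normr0 divr_ge0 // ltW.
have x1 : `|x| <= 1.
  by rewrite -(@ler_pXn2r _ 2) ?nnegrE // real_normK ?num_real // expr1n; lra.
have F : flat 2 (1 - x ^+ 2) <= 24.
  apply: le_trans (flat_le _ _) _; rewrite -[leRHS]mulr1 ler_wpM2l //.
  by have := sqr_ge0 x; nra.
rewrite normrM (ger0_norm (flat_ge0 _ _)).
rewrite normrN normrM normfV (gtr0_norm (divr_gt0 _ _)) // normrM (@ger0_norm _ 2) //.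
have -> : 192 / (q - p) = (2 * 1 / ((q - p) / 4)) * 24.
  by field; rewrite gt_eqF.
apply: ler_pM => //; rewrite ?flat_ge0 //.
  by rewrite mulr_ge0 ?mulr_ge0 // invr_ge0 divr_ge0 // ltW.
by apply: ler_wpM2r; [rewrite invr_ge0 divr_ge0 // ltW|exact: ler_wpM2l].
Qed.

End Flat.

(** * Periodic extension of functions supported inside the interval *)

Section Periodize.
Context {R : realType}.
Implicit Types (t s a b c d : R).

Definition supp_in {T : zmodType} (c d : R) (g : R -> T) :=
  forall t, ~~ (c <= t <= d) -> g t = 0.

Lemma supp_in_derives (V : normedModType R) c d (g g' : R -> V) :
  supp_in c d g -> derives setT g g' -> supp_in c d g'.
Proof.
move=> gs Hg t tcd; apply: (isder_setT_unique _ g t _ _ (Hg t I)).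
have [e e0 He] : exists2 e, 0 < e & forall s, `|s - t| < e -> ~~ (c <= s <= d).
  move: tcd; rewrite negb_and -!ltNge => /orP[tc|td].
  - exists (c - t); first by rewrite subr_gt0.
    move=> s; rewrite ltr_norml => /andP[_ sc]; rewrite negb_and -!ltNge.
    by apply/orP; left; lra.
  - exists (t - d); first by rewrite subr_gt0.
    move=> s; rewrite ltr_norml => /andP[sc _]; rewrite negb_and -!ltNge.
    by apply/orP; right; lra.
apply: (isder_near _ _ (fun=> 0) _ _ _ e) (isder_cst _ _ _ _) => //.
by move=> s _ /He /gs ->.
Qed.

Section Circle.
Variables (a b : R).
Hypothesis ab : a < b.
Local Notation l := (b - a).

(** The representative of [t] modulo [b - a] in the half-open interval from [a] to [b]. *)
Definition per t := t - l * (Num.floor ((t - a) / l))%:~R.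

Lemma l_gt0 : 0 < l. Proof. by rewrite subr_gt0. Qed.

Lemma perE t (k : int) : a <= t - l * k%:~R < b -> per t = t - l * k%:~R.
Proof.
move=> /andP[t1 t2]; rewrite /per; congr (_ - _ * _%:~R).
apply: floor_def; rewrite intrD ler_pdivlMr ?l_gt0 // ltr_pdivrMr ?l_gt0 //.
by apply/andP; split; lra.
Qed.

Lemma per_itv t : a <= per t < b.
Proof.
rewrite /per; have := floor_itv ((t - a) / l).
rewrite intrD ler_pdivlMr ?l_gt0 // ltr_pdivrMr ?l_gt0 // => /andP[H1 H2].
by apply/andP; split; lra.
Qed.

Lemma per_shift t : per (t + l) = per t.
Proof.
have H := per_itv t; set k := Num.floor ((t - a) / l).
have E : t + l - l * (k + 1)%:~R = per t by rewrite intrD /per -/k; ring.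
by rewrite (perE _ (k + 1)) E.
Qed.

(** [per] jumps at the seam, but near [t] it may be replaced by one fixed translation: once a point
    has crossed the seam, both its representative and its translate lie outside [[c, d]], where [g]
    vanishes. *)
Lemma per_near (T : zmodType) c d t : a < c -> d < b ->
  exists (k : int) e, 0 < e /\ forall g : R -> T, supp_in c d g ->
    forall s, `|s - t| < e -> g (per s) = g (s - l * k%:~R).
Proof.
move=> ac db; have l0 := l_gt0.
pose e := Num.min (Num.min (c - a) (b - d)) l.
exists (Num.floor ((t - a) / l)), e; rewrite !lt_min !subr_gt0 ac db ab; split => // g gs s.
set k := Num.floor _.
have /andP[t1 t2] : a <= t - l * k%:~R < b := per_itv t.
rewrite !lt_min -andbA => /and3P[]; rewrite !ltr_norml => /andP[s1 s2] /andP[s3 s4] /andP[s5 s6].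
have [sa|sa] := ltP (s - l * k%:~R) a.
  have E : per s = s - l * (k - 1)%:~R.
    by apply: perE; rewrite intrB; apply/andP; split; lra.
  rewrite E intrB !gs // negb_and -!ltNge; apply/orP; [left|right]; lra.
have [sb|sb] := ltP (s - l * k%:~R) b; first by rewrite (perE _ k) // sa sb.
have E : per s = s - l * (k + 1)%:~R.
  by apply: perE; rewrite intrD; apply/andP; split; lra.
rewrite E intrD !gs // negb_and -!ltNge; apply/orP; [right|left]; lra.
Qed.

Lemma CK_per (V : normedModType R) c d k (g : R -> V) : a < c -> d < b ->
  supp_in c d g -> CK setT k g -> CK setT k (fun t => g (per t)).
Proof.
move=> ac db; elim: k g => [|k IH] g gs.
  move=> cg t _; have [k [e [e0 /(_ g gs) He]]] := per_near V c d t ac db.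
  apply/cvg_withinP => e' e'0.
  have /cvg_withinP/(_ _ e'0)[d' d'0 Hd] := cg (t - l * k%:~R) I.
  exists (Num.min e d'); first by rewrite lt_min e0.
  move=> s _; rewrite lt_min => /andP[se sd].
  rewrite !He ?subrr ?normr0 //; apply: Hd => //.
  by rewrite opprB addrA subrK.
case=> g' Hg Cg; exists (fun t => g' (per t)); last first.
  by apply: IH => //; apply: supp_in_derives Hg.
move=> t _; have [j [e [e0 He]]] := per_near V c d t ac db.
have gs' := supp_in_derives _ _ _ _ _ gs Hg.
apply: (isder_near _ _ (fun s => g (s - l * j%:~R)) _ _ _ e) => //.
  by move=> s _ /(He _ gs) ->.
rewrite (He _ gs') ?subrr ?normr0 //.
have := isder_comp _ _ setT _ _ t _ _ I (fun _ _ => I)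
  (isderB _ _ _ _ _ _ _ (isder_id _ _) (isder_cst _ _ (l * j%:~R) _)) (Hg (t - l * j%:~R) I).
by rewrite subr0 scale1r.
Qed.

End Circle.

Lemma periodize (G : domain R) c d (g : R -> R) : dom_a G < c -> d < dom_b G ->
  (forall k, CK setT k g) -> supp_in c d g ->
  exists g1 : R -> R, [/\ map_on G g1, forall k, CK (points G) k g1 &
    forall t, dom_a G <= t <= dom_b G -> g1 t = g t].
Proof.
move=> ac db Cg gs; case: G ac db => -[] a b ab /= ac db.
  exists g; split => // k; exact: CK_sub (Cg k).
exists (fun t => g (per a b t)); split.
- by move=> t; rewrite /= per_shift.
- by move=> k; apply: CK_per gs _.
- move=> t /andP[at_ tb]; have [tltb|tgeb] := ltP t b.
    by rewrite (perE _ _ ab _ 0) ?mulr0 ?subr0 // at_.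
  (* At the right end the representative is [a], and [g] vanishes at both ends. *)
  have -> : t = b by apply/le_anti; rewrite tb.
  rewrite (perE _ _ ab _ 1) ?mulr1; last by apply/andP; split; lra.
  rewrite !gs // negb_and -!ltNge; apply/orP; [right|left]; lra.
Qed.

End Periodize.

(** * Rotations and normalization *)

(** For orthonormal [a] and [e], [turnK] generates the rotations of their plane, [turnP] is the
    orthogonal projection onto it, and [turn] is the rotation by [th], which fixes the orthogonal
    complement. *)
Definition turnK {R : realType} {n : nat} (a e v : 'rV[R]_n) : 'rV[R]_n :=
  dot v a *: e - dot v e *: a.

Definition turnP {R : realType} {n : nat} (a e v : 'rV[R]_n) : 'rV[R]_n :=
  dot v a *: a + dot v e *: e.

Definition turn {R : realType} {n : nat} (a e : 'rV[R]_n) (th : R) (v : 'rV[R]_n) :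
    'rV[R]_n :=
  v + ((cos th - 1) *: turnP a e v + sin th *: turnK a e v).

Section Rotation.
Context {R : realType} {n : nat} (a e : 'rV[R]_n).
Hypotheses (aa : dot a a = 1) (ee : dot e e = 1) (ae : dot a e = 0).
Implicit Types (v w u : 'rV[R]_n) (th : R).

Let ea : dot e a = 0. Proof. by rewrite dotC. Qed.

Lemma dot_turn th v : dot (turn a e th v) (turn a e th v) = dot v v.
Proof.
rewrite /turn /turnP /turnK !dotE aa ee ae ea (dotC a v) (dotC e v).
have := cos2Dsin2 th; move: (cos th) (sin th) (dot v a) (dot v e) => c s x y cs.
rewrite -[RHS]addr0 -(mulr0 (x ^+ 2 + y ^+ 2)) -(subrr 1) -{1}cs; ring.
Qed.

Lemma enorm_turn th v : enorm (turn a e th v) = enorm v.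
Proof. by rewrite !enormE dot_turn. Qed.

Lemma turnB th v w : turn a e th (v - w) = turn a e th v - turn a e th w.
Proof.
rewrite /turn /turnP /turnK !dotE; apply/rowP => i; rewrite !mxE; ring.
Qed.

Lemma turnKB v w : turnK a e (v - w) = turnK a e v - turnK a e w.
Proof. by rewrite /turnK !dotE; apply/rowP => i; rewrite !mxE; ring. Qed.

Lemma bessel v : dot v a ^+ 2 + dot v e ^+ 2 <= dot v v.
Proof.
have := dot_ge0 (v - turnP a e v).
rewrite /turnP !dotE aa ee ae ea (dotC a v) (dotC e v); nra.
Qed.

Lemma enorm_turnP v : enorm (turnP a e v) <= enorm v.
Proof.
rewrite enorm_sqr_le ?enorm_ge0 // sqr_enorm; apply: le_trans (bessel v).
by rewrite /turnP !dotE aa ee ae ea le_eqVlt; apply/orP; left; apply/eqP; ring.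
Qed.

Lemma sqr_enorm_turnK v : enorm (turnK a e v) ^+ 2 = dot v a ^+ 2 + dot v e ^+ 2.
Proof. by rewrite sqr_enorm /turnK !dotE aa ee ae ea; ring. Qed.

Lemma enorm_turnK v : enorm (turnK a e v) <= enorm v.
Proof.
rewrite -(@ler_pXn2r _ 2) ?nnegrE ?enorm_ge0 // sqr_enorm_turnK sqr_enorm.
exact: bessel.
Qed.

(** Guarantees that the bumps are effective: a curve close to [a] is really moved by the
    infinitesimal rotation. *)
Lemma enorm_turnK_ge v : dot v a <= enorm (turnK a e v).
Proof.
have [H|H] := leP (dot v a) 0; first exact: le_trans H (enorm_ge0 _).
rewrite -(@ler_pXn2r _ 2) ?nnegrE ?enorm_ge0 ?(ltW H) // sqr_enorm_turnK.
by rewrite lerDl sqr_ge0.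
Qed.

Lemma dot_turnK u v : dot a u = 0 -> dot e u = 0 -> dot (turnK a e v) u = 0.
Proof. by move=> au eu; rewrite /turnK !dotE au eu; ring. Qed.

Lemma turn0 v : turn a e 0 v = v.
Proof. by rewrite /turn cos0 sin0 subrr !scale0r !addr0. Qed.

Lemma derives_lip1 (F f : R -> R) x y : derives setT F f -> (forall t, `|f t| <= 1) ->
  `|F x - F y| <= `|x - y|.
Proof.
move=> HF f1; wlog : x y / y < x.
  move=> H; have [/H//|/H|->] := ltgtP y x; last by rewrite !subrr !normr0.
  by rewrite (distrC x) (distrC (F x)).
move=> yx; have [c _ ->] := derives_MVT _ _ _ _ yx (derives_sub _ _ _ _ _ (@subsetT _ _) HF).
by rewrite normrM -[leRHS]mul1r ler_wpM2r.
Qed.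

Lemma lip_cos (x y : R) : `|cos x - cos y| <= `|x - y|.
Proof.
apply: (derives_lip1 cos (fun t => - sin t)) => t; first by move=> _; exact: isder_cos.
by rewrite normrN ler_norml sin_le1 sin_geN1.
Qed.

Lemma lip_sin (x y : R) : `|sin x - sin y| <= `|x - y|.
Proof.
apply: (derives_lip1 sin cos) => t; first by move=> _; exact: isder_sin.
by rewrite ler_norml cos_le1 cos_geN1.
Qed.

(** The factor 2 adds the contributions of the cosine on [turnP] and of the sine on [turnK], both
    maps being contractions. *)
Lemma turn_lip th th' v :
  enorm (turn a e th v - turn a e th' v) <= 2 * `|th - th'| * enorm v.
Proof.
have -> : turn a e th v - turn a e th' v =
  (cos th - cos th') *: turnP a e v + (sin th - sin th') *: turnK a e v.
  by rewrite /turn; apply/rowP => i; rewrite !mxE; ring.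
apply: le_trans (enormD _ _) _; rewrite !enormZ.
have -> : 2 * `|th - th'| * enorm v = `|th - th'| * enorm v + `|th - th'| * enorm v.
  by ring.
apply: lerD; apply: ler_pM => //; rewrite ?enorm_ge0 ?lip_cos ?lip_sin //.
- exact: enorm_turnP.
- exact: enorm_turnK.
Qed.

Variable D : set R.

Lemma isder_turnK (g : R -> 'rV[R]_n) t l : isder D g t l ->
  isder D (fun s => turnK a e (g s)) t (turnK a e l).
Proof. by move=> Hg; apply: isderB; apply: isderZr; exact: isder_dotr. Qed.

Lemma isder_turnP (g : R -> 'rV[R]_n) t l : isder D g t l ->
  isder D (fun s => turnP a e (g s)) t (turnP a e l).
Proof. by move=> Hg; apply: isderD; apply: isderZr; exact: isder_dotr. Qed.

(** Rotations of the plane commute with their generator, so the rotation factors out of the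
    derivative. As it is an isometry, the speed involves [h] only through [h']. *)
Lemma isder_turn (h : R -> R) (g : R -> 'rV[R]_n) t (h' : R) (l : 'rV[R]_n) : D t ->
  isder D h t h' -> isder D g t l ->
  isder D (fun s => turn a e (h s) (g s)) t (turn a e (h t) (l + h' *: turnK a e (g t))).
Proof.
move=> Dt Hh Hg.
have Hc := isder_comp _ _ setT _ _ _ _ _ Dt (fun _ _ => I) Hh (isder_cos setT (h t)).
have Hs := isder_comp _ _ setT _ _ _ _ _ Dt (fun _ _ => I) Hh (isder_sin setT (h t)).
have HP := isder_turnP _ _ _ Hg; have HK := isder_turnK _ _ _ Hg.
have := isderD _ _ _ _ _ _ _ Hg (isderD _ _ _ _ _ _ _
  (isderZ _ _ _ _ _ _ _ Dt (isderB _ _ _ _ _ _ _ Hc (isder_cst R _ (1 : R) _)) HP)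
  (isderZ _ _ _ _ _ _ _ Dt Hs HK)).
congr (isder _ _ _ _).
have D1 : dot (l + h' *: turnK a e (g t)) a = dot l a - h' * dot (g t) e.
  by rewrite /turnK !dotE aa ea; ring.
have D2 : dot (l + h' *: turnK a e (g t)) e = dot l e + h' * dot (g t) a.
  by rewrite /turnK !dotE ee ae; ring.
rewrite /turn /turnP /turnK D1 D2.
by apply/rowP => i; rewrite !mxE /GRing.scale /=; ring.
Qed.

Lemma CK_dotZ k (g : R -> 'rV[R]_n) (z w : 'rV[R]_n) : CK D k g ->
  CK D k (fun s => dot (g s) z *: w).
Proof. by move=> Cg; apply: CKZ; [apply: CK_dot => //; exact: CK_cst|exact: CK_cst]. Qed.

Lemma CK_turnK k (g : R -> 'rV[R]_n) : CK D k g -> CK D k (fun s => turnK a e (g s)).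
Proof. by move=> Cg; apply: CKB; exact: CK_dotZ. Qed.

Lemma CK_turn k (h : R -> R) (g : R -> 'rV[R]_n) : CK D k h -> CK D k g ->
  CK D k (fun s => turn a e (h s) (g s)).
Proof.
move=> Ch Cg; have [Cs Cc] := @CK_sin_cos R setT k.
apply: CKD => //; apply: CKD; apply: CKZ.
- by apply: CKB; [exact: (CK_comp _ _ setT _ h cos)|exact: CK_cst].
- by apply: CKD; exact: CK_dotZ.
- exact: (CK_comp _ _ setT _ h sin).
- exact: CK_turnK.
Qed.

End Rotation.

Definition nrm {R : realType} {n : nat} (v : 'rV[R]_n) : 'rV[R]_n := (enorm v)^-1 *: v.

(* The derivative of [nrm] at [v] in the direction [w]. *)
Definition dnrm {R : realType} {n : nat} (v w : 'rV[R]_n) : 'rV[R]_n :=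
  (enorm v)^-1 *: (w - dot (nrm v) w *: nrm v).

(** * Lipschitz estimates for normalization and its derivative *)

Section Normalize.
Context {R : realType} {n : nat}.
Implicit Types (v w : 'rV[R]_n).

Lemma enorm_nrm v : v != 0 -> enorm (nrm v) = 1.
Proof.
move=> /enorm_gt0 v0; rewrite /nrm enormZ ger0_norm ?invr_ge0 ?enorm_ge0 //.
by rewrite mulVf // gt_eqF.
Qed.

Lemma isder_nrm (D : set R) (g : R -> 'rV[R]_n) t l : g t != 0 ->
  D t -> isder D g t l -> isder D (fun s => nrm (g s)) t (dnrm (g t) l).
Proof.
move=> g0 Dt Hg; have Hn := isder_enorm _ _ _ _ g0 Dt Hg.
have en0 : enorm (g t) != 0 by rewrite gt_eqF // enorm_gt0.
have := isderZ _ _ _ _ _ _ _ Dt (isderV D (fun s => enorm (g s)) t _ Dt en0 Hn) Hg.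
congr (isder _ _ _ _); rewrite /dnrm /nrm dotZl.
apply/rowP => i; rewrite !mxE; ring.
Qed.

Lemma CK_nrm (D : set R) k (g : R -> 'rV[R]_n) : (forall s, D s -> g s != 0) ->
  CK D k g -> CK D k (fun s => nrm (g s)).
Proof.
move=> g0 Cg; apply: CKZ => //; apply: CKV; last exact: CK_enorm.
by move=> s /g0/enorm_gt0/gt_eqF ->.
Qed.

Lemma CK_dnrm (D : set R) k (g h : R -> 'rV[R]_n) : (forall s, D s -> g s != 0) ->
  CK D k g -> CK D k h -> CK D k (fun s => dnrm (g s) (h s)).
Proof.
move=> g0 Cg Ch; have Cn := CK_nrm _ _ _ g0 Cg.
apply: CKZ.
  apply: CKV; last exact: CK_enorm.
  by move=> s /g0/enorm_gt0/gt_eqF ->.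
by apply: CKB => //; apply: CKZ => //; exact: CK_dot.
Qed.

Lemma half_neq0 v : 1 / 2 <= enorm v -> v != 0.
Proof. by apply: contraTneq => ->; rewrite enorm0 -ltNge. Qed.

Lemma sqr_dist v w : dot (v - w) (v - w) =
  (enorm v - enorm w) ^+ 2 + 2 * (enorm v * enorm w - dot v w).
Proof. by rewrite !dotE -!sqr_enorm (dotC w v); ring. Qed.

Lemma dot_nrm v w : v != 0 -> w != 0 ->
  dot v w = enorm v * enorm w * dot (nrm v) (nrm w).
Proof.
move=> /enorm_gt0 v0 /enorm_gt0 w0; rewrite /nrm dotZl dotZr.
by field; rewrite !gt_eqF.
Qed.

(** With [d] the cosine of the angle, [sqr_dist] gives [2 * (1 - d)] for the normalized vectors and
    at least [2 * enorm v * enorm w * (1 - d)] for the original ones; the product of the norms is at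
    least 1/4. *)
Lemma nrm_lip v w : 1 / 2 <= enorm v -> 1 / 2 <= enorm w ->
  enorm (nrm v - nrm w) <= 2 * enorm (v - w).
Proof.
move=> v2 w2; have v0 := half_neq0 _ v2; have w0 := half_neq0 _ w2.
rewrite enorm_sqr_le ?mulr_ge0 ?enorm_ge0 // exprMn sqr_enorm !sqr_dist.
rewrite !enorm_nrm // (dot_nrm v w) //.
have := cauchy_schwarz (nrm v) (nrm w); rewrite !enorm_nrm //.
move: (dot _ _) (enorm v) (enorm w) v2 w2 => d x y x2 y2 d1.
have : 0 <= (x * y - 1 / 4) * (1 - d).
  by rewrite mulr_ge0 ?subr_ge0 //; [nra|lra].
have := sqr_ge0 (x - y); nra.
Qed.

(** The components [pv], [pw] of [v'], [w'] orthogonal to [v], [w] have norm at most [2 * B] and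
    differ by at most [2 * d' + 4 * B * d]; the inverse norms are at most 2 and differ by at most
    [4 * d]. The product rule gives the constants 16 and 4. *)
Lemma dnrm_lip v w v' w' B : 1 / 2 <= enorm v -> 1 / 2 <= enorm w ->
  enorm v' <= B -> enorm w' <= B ->
  enorm (dnrm v v' - dnrm w w') <= 16 * B * enorm (v - w) + 4 * enorm (v' - w').
Proof.
move=> v2 w2 vB wB; have v0 := half_neq0 _ v2; have w0 := half_neq0 _ w2.
have B0 : 0 <= B := le_trans (enorm_ge0 _) vB.
have NL := nrm_lip _ _ v2 w2.
have nv := enorm_nrm _ v0; have nw := enorm_nrm _ w0.
set d := enorm (v - w) in NL *; set d' := enorm (v' - w').
have d0 : 0 <= d by exact: enorm_ge0.
have d'0 : 0 <= d' by exact: enorm_ge0.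
pose pv := v' - dot (nrm v) v' *: nrm v; pose pw := w' - dot (nrm w) w' *: nrm w.
have Hpv : enorm pv <= 2 * B.
  apply: le_trans (enormB _ _) _; rewrite enormZ nv mulr1.
  by have := norm_dot_le (nrm v) v'; rewrite nv; lra.
have Hd : enorm (pv - pw) <= 2 * d' + 4 * B * d.
  have -> : pv - pw = (v' - w') - ((dot (nrm v - nrm w) v' + dot (nrm w) (v' - w')) *: nrm v
      + dot (nrm w) w' *: (nrm v - nrm w)).
    by rewrite /pv /pw !dotE; apply/rowP => i; rewrite !mxE; ring.
  apply: le_trans (enormB _ _) _; rewrite -/d'.
  have H1 := enormD ((dot (nrm v - nrm w) v' + dot (nrm w) (v' - w')) *: nrm v)
    (dot (nrm w) w' *: (nrm v - nrm w)).
  rewrite (enormZ _ (nrm v)) (enormZ _ (nrm v - nrm w)) nv mulr1 in H1.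
  have H2 := ler_normD (dot (nrm v - nrm w) v') (dot (nrm w) (v' - w')).
  have H3 := norm_dot_le (nrm v - nrm w) v'.
  have H4 := norm_dot_le (nrm w) (v' - w').
  have H5 := norm_dot_le (nrm w) w'.
  rewrite nw -/d' mul1r in H4; rewrite nw mul1r in H5.
  have H6 : enorm (nrm v - nrm w) * enorm v' <= 2 * d * B by apply: ler_pM; rewrite ?enorm_ge0.
  have H7 : `|dot (nrm w) w'| * enorm (nrm v - nrm w) <= B * (2 * d).
    by apply: ler_pM; rewrite ?enorm_ge0 //; lra.
  lra.
have iv : (enorm v)^-1 <= 2.
  by rewrite -div1r ler_pdivrMr ?(enorm_gt0 _ v0) //; lra.
have iw : (enorm w)^-1 <= 2.
  by rewrite -div1r ler_pdivrMr ?(enorm_gt0 _ w0) //; lra.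
have iv0 : 0 <= (enorm v)^-1 by rewrite invr_ge0 enorm_ge0.
have iw0 : 0 <= (enorm w)^-1 by rewrite invr_ge0 enorm_ge0.
have Hi : `|(enorm v)^-1 - (enorm w)^-1| <= 4 * d.
  have -> : (enorm v)^-1 - (enorm w)^-1 =
      (enorm w - enorm v) * ((enorm v)^-1 * (enorm w)^-1).
    by field; rewrite !gt_eqF ?enorm_gt0.
  rewrite normrM mulrC; apply: ler_pM => //.
    rewrite ger0_norm ?mulr_ge0 //.
    by have -> : 4 = 2 * 2 :> R by [ring]; apply: ler_pM.
  by rewrite /d enormBC; exact: ler_enorm_dist.
have -> : dnrm v v' - dnrm w w' =
    ((enorm v)^-1 - (enorm w)^-1) *: pv + (enorm w)^-1 *: (pv - pw).
  have E (i j : R) (x y : 'rV[R]_n) : i *: x - j *: y = (i - j) *: x + j *: (x - y).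
    by apply/rowP => k; rewrite !mxE; ring.
  exact: E.
apply: le_trans (enormD _ _) _; rewrite !enormZ (ger0_norm iw0).
have H8 : `|(enorm v)^-1 - (enorm w)^-1| * enorm pv <= 4 * d * (2 * B).
  by apply: ler_pM; rewrite ?enorm_ge0.
have H9 : (enorm w)^-1 * enorm (pv - pw) <= 2 * (2 * d' + 4 * B * d).
  by apply: ler_pM; rewrite ?enorm_ge0.
lra.
Qed.

End Normalize.

Lemma chain_patch {R : realType} (x : nat -> R) N t : (0 < N)%N -> x 0 <= t <= x N ->
  exists2 k, (k < N)%N & x k <= t <= x k.+1.
Proof.
case: N => // N _ /andP[t0 tN].
have : exists k, t <= x k.+1 by exists N.
move=> /ex_minnP[k tk km]; exists k; first by rewrite ltnS; exact: km.
rewrite tk andbT; case: k km {tk} => [//|k km].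
by rewrite leNgt; apply/negP => /ltW/km; rewrite ltnn.
Qed.

(** * Equal subdivision of a segment, with one scaled bump per patch *)

Section Nodes.
Context {R : realType} (p q : R) (M : nat).
Hypothesis pq : p < q.

Definition step : R := (q - p) / M.+1%:R.
Definition node (k : nat) : R := p + k%:R * step.
(** The factor [step] makes the bump of size [step] while its derivative stays bounded by 192
    whatever the number of patches. *)
Definition phump (k : nat) (t : R) : R := step * hump (node k) (node k.+1) t.
Definition dphump (k : nat) (t : R) : R := step * dhump (node k) (node k.+1) t.

Lemma step_gt0 : 0 < step.
Proof. by rewrite divr_gt0 ?subr_gt0 // ltr0n. Qed.

Lemma nodeS k : node k.+1 = node k + step.
Proof. by rewrite /node -natr1 mulrDl mul1r addrA. Qed.

Lemma node_lt k : node k < node k.+1.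
Proof. by rewrite nodeS ltrDl step_gt0. Qed.

Lemma node0 : node 0 = p. Proof. by rewrite /node mul0r addr0. Qed.

Lemma nodeN : node M.+1 = q.
Proof. by rewrite /node /step mulrC divfK ?pnatr_eq0 // addrC subrK. Qed.

Lemma node_le j k : (j <= k)%N -> node j <= node k.
Proof.
by move=> jk; rewrite /node lerD2l ler_wpM2r ?ler_nat // ltW ?step_gt0.
Qed.

Lemma node_ge_p k : p <= node k.
Proof. by rewrite -[leLHS]node0; exact: node_le. Qed.

Lemma node_le_q k : (k <= M.+1)%N -> node k <= q.
Proof. by rewrite -[leRHS]nodeN; exact: node_le. Qed.

Lemma node_patch t : p <= t <= q ->
  exists2 k, (k < M.+1)%N & node k <= t <= node k.+1.
Proof. by move=> tpq; apply: chain_patch; rewrite // node0 nodeN. Qed.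

Lemma phump_derives k : derives setT (phump k) (dphump k).
Proof.
by move=> t _; apply: (isderZl R); exact: hump_derives.
Qed.

Lemma phump_CK k j : CK setT j (phump k).
Proof. by apply: CKM; [exact: CK_cst|exact: hump_CK]. Qed.

Lemma dphump_cont k : cont setT (dphump k).
Proof. by apply: (CKM _ 0); [exact: (CK_cst _ _ 0)|exact: dhump_cont]. Qed.

Lemma hump_window k : ((3 * node k + node k.+1) / 4 = node k + step / 4) *
  ((node k + 3 * node k.+1) / 4 = node k.+1 - step / 4).
Proof. by rewrite !nodeS; split; field. Qed.

Lemma phump_out k t : ~~ (node k + step / 4 <= t <= node k.+1 - step / 4) ->
  phump k t = 0 /\ dphump k t = 0.
Proof.
rewrite -!hump_window => H; rewrite /phump /dphump.
by rewrite hump_out ?dhump_out ?mulr0 ?node_lt.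
Qed.

Lemma phump_other j k t : j != k -> node k <= t <= node k.+1 ->
  phump j t = 0 /\ dphump j t = 0.
Proof.
have s0 := step_gt0; move=> jk /andP[kt tk]; apply: phump_out.
rewrite negb_and -!ltNge; apply/orP; move: jk; rewrite neq_ltn => /orP[jk|kj].
- by right; have := node_le _ _ jk; lra.
- by left; have := node_le _ _ kj; lra.
Qed.

Lemma phump_le k t : `|phump k t| <= step.
Proof.
have s0 := step_gt0; rewrite /phump normrM gtr0_norm // ger0_norm ?hump_ge0 //.
by rewrite -[leRHS]mulr1 ler_wpM2l ?hump_le1 // ltW.
Qed.

Lemma dphump_le k t : `|dphump k t| <= 192.
Proof.
have s0 := step_gt0; rewrite /dphump normrM gtr0_norm //.
have := dhump_le _ _ t (node_lt k); rewrite nodeS (addrC (node k)) addrK.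
by rewrite ler_pdivlMr // mulrC.
Qed.

(** On the left half of the patch the bump climbs from 0 to [step * expR (-1)], and its total
    variation is at least that. *)
Lemma rint_dphump k : step * expR (-1) <= rint (node k) (node k.+1) (fun t => `|dphump k t|).
Proof.
have s0 := step_gt0; set mid := (node k + node k.+1) / 2.
have nm : node k <= mid by rewrite /mid nodeS; lra.
have mn : mid <= node k.+1 by rewrite /mid nodeS; lra.
have ca : cont setT (fun t => `|dphump k t|).
  by move=> t _; apply: cvg_norm; exact: dphump_cont.
have cs s t : cont `[s, t] (fun t => `|dphump k t|) by exact: cont_sub ca.
have cd s t : cont `[s, t] (dphump k) by exact: cont_sub (dphump_cont k).
rewrite (rint_chasles _ _ mid) //.
have H1 : rint (node k) mid (dphump k) <= rint (node k) mid (fun t => `|dphump k t|).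
  apply: rint_le; [by []|exact: cd|exact: cs|].
  by move=> t _; exact: ler_norm.
have H2 : 0 <= rint mid (node k.+1) (fun t => `|dphump k t|).
  by apply: rint_ge0; [by []|exact: cs|].
suff : rint (node k) mid (dphump k) = step * expR (-1) by lra.
rewrite (rint_eq _ _ (phump k)) //; last exact: derives_sub (@subsetT _ _) (phump_derives k).
have [E _] : phump k (node k) = 0 /\ dphump k (node k) = 0.
  apply: phump_out; rewrite negb_and -!ltNge; apply/orP; left; lra.
by rewrite E subr0 /phump hump_mid.
Qed.

End Nodes.

#[local] Opaque rint prim.

(** * Corrugation *)

Lemma convex_gap {R : realType} (th s x0 xA : R) :
  xA <= (1 - th) * x0 + th * s -> (1 - th) * (s - x0) <= s - xA.
Proof. lra. Qed.

(** * Integrals of functions bounded below, and equations between lengths *)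

Section Increasing.
Context {R : realType}.
Variables (p q mu : R) (f : R -> R).
Hypotheses (cf : cont `[p, q] f) (fmu : forall t, p <= t <= q -> mu <= f t).

Lemma rint_incr s t : p <= s -> s <= t -> t <= q ->
  mu * (t - s) <= rint p t f - rint p s f.
Proof.
move=> ps st tq; have pt := le_trans ps st; have sq := le_trans st tq.
have ct : cont `[p, t] f by apply: cont_sub_itv cf.
have cs : cont `[s, t] f by apply: cont_sub_itv cf.
rewrite (rint_chasles p t s) // addrAC subrr add0r; apply: rint_ge_cst => //.
by move=> x /andP[sx xt]; apply: fmu; rewrite (le_trans ps sx) (le_trans xt tq).
Qed.

Lemma rint_inj_le s t : 0 < mu -> p <= s <= q -> p <= t <= q ->
  rint p s f <= rint p t f -> s <= t.
Proof.
move=> mu0 /andP[ps sq] /andP[pt tq] H; rewrite leNgt; apply/negP => ts.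
have := rint_incr t s pt (ltW ts) sq.
have : 0 < mu * (s - t) by rewrite mulr_gt0 // subr_gt0.
lra.
Qed.

End Increasing.

(** For [s <= s'], the integral of [g] from [s] to [s'] is at least [mu * (s' - s)]. By the equation
    it equals the integral of [f - g] from [c] to [s], which is at most [e * (d - c)]. *)
Lemma rint_solve_lip {R : realType} (c d mu e s s' : R) (f g : R -> R) :
  0 < mu -> cont `[c, d] f -> cont `[c, d] g ->
  (forall t, c <= t <= d -> mu <= f t) -> (forall t, c <= t <= d -> mu <= g t) ->
  (forall t, c <= t <= d -> `|f t - g t| <= e) ->
  c <= s <= d -> c <= s' <= d -> rint c s f = rint c s' g ->
  `|s - s'| <= e * (d - c) / mu.
Proof.
move=> mu0; wlog ss' : f g s s' / s <= s'.
  move=> H cf cg fmu gmu fg sI s'I E; have [le|/ltW le] := leP s s'; first exact: (H f g).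
  by rewrite distrC; apply: (H g f) => // t tI; rewrite distrC fg.
move=> cf cg fmu gmu fg /andP[cs sd] /andP[cs' s'd] E.
rewrite distrC ger0_norm ?subr_ge0 // ler_pdivlMr // mulrC.
apply: le_trans (rint_incr c d mu g cg gmu s s' cs ss' s'd) _.
rewrite -E; apply: le_trans (ler_norm _) _.
apply: (@le_trans _ _ (e * (s - c))).
  apply: rint_dist => //; try exact: cont_sub_itv (lexx c) sd _.
  by move=> t /andP[ct ts]; apply: fg; rewrite ct (le_trans ts).
rewrite ler_wpM2l ?lerB //; apply: le_trans (fg c _); first exact: normr_ge0.
by rewrite lexx (le_trans cs sd).
Qed.

(** Here [g] is the present speed and [f] the wanted one. The condition is stated through lengths,
    so nothing about the regularity of [phi] is part of it. *)
Definition reparam {R : realType} (p q : R) (g f phi : R -> R) :=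
  forall t, p <= t <= q -> p <= phi t <= q /\ rint p (phi t) g = rint p t f.

(** Length increases strictly along [f], so agreement of the lengths at [s] and [t] confines [phi]
    on [[s, t]] to [[s, t]]; subtracting the common length up to [s] leaves the same equation
    there. *)
Lemma reparam_restrict {R : realType} (p q mu s t : R) (f g phi : R -> R) :
  0 < mu -> cont `[p, q] f -> cont `[p, q] g ->
  (forall x, p <= x <= q -> mu <= f x) -> (forall x, p <= x <= q -> 0 <= g x) ->
  reparam p q f g phi ->
  p <= s -> s <= t -> t <= q -> rint p s f = rint p s g -> rint p t f = rint p t g ->
  reparam s t f g phi.
Proof.
move=> mu0 cf cg fmu g0 Hphi ps st tq Es Et x /andP[sx xt].
have px := le_trans ps sx; have xq := le_trans xt tq.
have xI : p <= x <= q by rewrite px.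
have [/[dup] pI /andP[p1 p2] E] := Hphi x xI.
have mono y z : p <= y -> y <= z -> z <= q -> rint p y g <= rint p z g.
  move=> h1 h2 h3; rewrite -subr_ge0 -(mul0r (z - y)).
  exact: (rint_incr p q 0 g cg g0 y z h1 h2 h3).
have s1 : s <= phi x.
  apply: (rint_inj_le p q mu f cf fmu s (phi x) mu0 _ pI); first by rewrite ps (le_trans st).
  by rewrite E Es; exact: mono.
have s2 : phi x <= t.
  apply: (rint_inj_le p q mu f cf fmu (phi x) t mu0 pI); first by rewrite tq (le_trans ps).
  by rewrite E Et; exact: mono.
split; first by rewrite s1.
have E1 := rint_chasles p (phi x) s f ps s1 (cont_sub_itv _ _ _ _ _ _ (lexx p) p2 cf).
have E2 := rint_chasles p x s g ps sx (cont_sub_itv _ _ _ _ _ _ (lexx p) xq cg).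
by rewrite E E2 Es in E1; move/addrI: E1.
Qed.

(* A convex function that rises by at least [m d] over [0, y] has slope at
   least [m d / y] at the right of any point where it is close to its value
   at [y]. *)
Lemma convex_root_gap {R : realType} (x y amax s p0 px m d c D : R) :
  0 <= x -> x <= y -> y <= amax -> 0 < m -> 0 < d -> 0 <= c -> 0 <= D ->
  (forall th, 0 <= th <= 1 -> th * y = x -> px <= (1 - th) * p0 + th * s) ->
  p0 + m * d <= s -> s - px <= c * D * d -> y - x <= amax * c / m * D.
Proof.
move=> x0 xy ya m0 d0 c0 D0 H H0 Hx.
have a0 : 0 <= amax by lra.
have [yz|yz] := leP y 0.
  have : 0 <= amax * c / m * D by rewrite mulr_ge0 // divr_ge0 ?mulr_ge0 // ltW.
  lra.
have E : x / y * y = x by rewrite divfK // gt_eqF.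
have th0 : 0 <= x / y by rewrite divr_ge0 // ltW.
have th1 : x / y <= 1 by rewrite ler_pdivrMr // mul1r.
have := H (x / y); rewrite th0 th1 => /(_ isT E)/convex_gap.
move: (x / y) E th0 th1 => th <- th0 th1 Hg.
have H2 : (1 - th) * (m * d) <= c * D * d.
  apply: le_trans Hx; apply: le_trans Hg; apply: ler_wpM2l; first by rewrite subr_ge0.
  by rewrite lerBrDl.
have H3 : (1 - th) * m <= c * D by rewrite -(ler_pM2r d0) -mulrA.
have -> : y - th * y = y * (1 - th) by ring.
rewrite mulrAC ler_pdivlMr // -!mulrA; apply: ler_pM => //; first exact: ltW.
by rewrite mulr_ge0 ?subr_ge0 // ltW.
Qed.

Lemma affine_diff {R : realType} {n : nat} (v v' w w' : 'rV[R]_n) (c c' : R) :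
  v + c *: w - (v' + c' *: w') = (v - v') + (c - c') *: w + c' *: (w - w').
Proof. by apply/rowP => i; rewrite !mxE; ring. Qed.

Lemma diff_split {R : realType} {n : nat} (A B E F P Q s s' : 'rV[R]_n) :
  A - s - (F - s') = (A - B) + ((B - E) - (P - Q)) + (E - F) + ((P - Q) - (s - s')).
Proof. by apply/rowP => i; rewrite !mxE; ring. Qed.

Lemma cfin_aux {R : realType} (A c C mu : R) : 0 <= A -> 0 <= c -> 0 < C -> 0 < mu ->
  0 <= 2 * c + 2 * A * C + (C + A * 192) * (C + c * 192 + A * 192 * C) / mu + C.
Proof.
move=> A0 c0 /ltW C0 /ltW m0; have AC := mulr_ge0 A0 C0.
have S0 : 0 <= C + c * 192 + A * 192 * C by lra.
have S1 : 0 <= C + A * 192 by lra.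
have := divr_ge0 (mulr_ge0 S1 S0) m0; lra.
Qed.

(** * Corrugation of a family of unit curves, uniformly in its parameter *)

Section Corrugation.
Context {R : realType} {n : nat}.
Variables (p q : R) (a e u : 'rV[R]_n).
Hypotheses (pq : p < q).
Hypotheses (aa : dot a a = 1) (ee : dot e e = 1) (ae : dot a e = 0).
Hypotheses (au : dot a u = 0) (eu : dot e u = 0) (uu : enorm u = 1).
Variables (tau tau' : 'rV[R]_n -> R -> 'rV[R]_n) (ok : 'rV[R]_n -> Prop).
Variables (sig : R -> R) (C m mu : R).
Hypotheses (C0 : 0 < C) (m0 : 0 < m) (mu0 : 0 < mu).
Hypotheses
  (Hd : forall x, ok x -> derives `[p, q] (tau x) (tau' x))
  (Hc : forall x, ok x -> cont `[p, q] (tau' x))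
  (H1 : forall x t, ok x -> p <= t <= q -> enorm (tau x t) = 1)
  (HL : forall x y t, ok x -> ok y -> p <= t <= q ->
     enorm (tau x t - tau y t) <= C * enorm (x - y))
  (HL' : forall x y t, ok x -> ok y -> p <= t <= q ->
     enorm (tau' x t - tau' y t) <= C * enorm (x - y))
  (HC : forall x t, ok x -> p <= t <= q -> enorm (tau' x t) <= C)
  (Hgap : forall x t, ok x -> p <= t <= q -> enorm (tau' x t) <= sig t - m)
  (Hsig : cont `[p, q] sig)
  (HsC : forall t, p <= t <= q -> sig t <= C)
  (Hmu : forall x t, ok x -> p <= t <= q -> mu <= dot (tau' x t) u)
  (Ha : forall x t, ok x -> p <= t <= q -> 1 / 4 <= dot (tau x t) a).

Let K := turnK a e.

Lemma cont_Ktau x : ok x -> cont `[p, q] (fun t => K (tau x t)).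
Proof.
by move=> xo; apply: (CK_turnK _ _ _ 0); exact: derives_cont (Hd _ xo).
Qed.

Lemma enorm_Ktau x t : ok x -> p <= t <= q -> enorm (K (tau x t)) <= 1.
Proof. by move=> xo tpq; rewrite -(H1 x t) //; exact: enorm_turnK. Qed.

Section Patches.
Variable M : nat.
Let nd := node p q M.
Let de := step p q M.
Let b := phump p q M.
Let b' := dphump p q M.
Let de0 : 0 < de := step_gt0 p q M pq.

Let nd_in k t : (k < M.+1)%N -> nd k <= t <= nd k.+1 -> p <= t <= q.
Proof.
move=> kM /andP[t1 t2].
by rewrite (le_trans (node_ge_p p q M pq k) t1) (le_trans t2) // node_le_q.
Qed.

Let ndS k : nd k.+1 - nd k = de.
Proof. by rewrite /nd nodeS addrC addKr. Qed.

Let ndle k : nd k <= nd k.+1 := ltW (node_lt p q M pq k).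

Let cpatch (V : normedModType R) k (g : R -> V) : (k < M.+1)%N ->
  cont `[p, q] g -> cont `[nd k, nd k.+1] g.
Proof. by move=> kM; apply: cont_sub_itv; [exact: node_ge_p|exact: node_le_q]. Qed.

(** The speed when only the bump of patch [k] is present, with amplitude [A]. *)
Definition pspd k A x t := enorm (tau' x t + (A * b' k t) *: K (tau x t)).

Definition plen k A x := rint (nd k) (nd k.+1) (pspd k A x).

Let target k := rint (nd k) (nd k.+1) sig.

Lemma pspd_cont k A x : ok x -> cont `[p, q] (pspd k A x).
Proof.
move=> xo; apply: cont_enorm; apply: (CKD _ _ 0); first exact: Hc.
apply: (CKZ _ _ 0); last exact: cont_Ktau.
apply: (CKM _ 0); first exact: (CK_cst _ _ 0).
exact: cont_sub (@subsetT _ _) (dphump_cont p q M k).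
Qed.

Lemma plen_lipA k A A' x : (k < M.+1)%N -> ok x ->
  `|plen k A x - plen k A' x| <= 192 * de * `|A - A'|.
Proof.
move=> kM xo; rewrite -(ndS k) mulrAC; apply: rint_dist => //;
  try (apply: cpatch => //; exact: pspd_cont).
move=> t /(nd_in _ _ kM) tpq; apply: le_trans (ler_enorm_dist _ _) _.
have -> : tau' x t + A * b' k t *: K (tau x t) - (tau' x t + A' * b' k t *: K (tau x t)) =
   ((A - A') * b' k t) *: K (tau x t).
  by apply/rowP => i; rewrite !mxE; ring.
rewrite enormZ normrM -mulrA mulrC.
apply: ler_pM => //; first by rewrite mulr_ge0 // enorm_ge0.
rewrite -[leRHS]mulr1; apply: ler_pM; rewrite ?enorm_ge0 //; first exact: dphump_le.
exact: enorm_Ktau.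
Qed.

Lemma plen_lipx k A x y : (k < M.+1)%N -> 0 <= A -> ok x -> ok y ->
  `|plen k A x - plen k A y| <= (C + A * 192 * C) * enorm (x - y) * de.
Proof.
move=> kM A0 xo yo; rewrite -(ndS k); apply: rint_dist => //;
  try (apply: cpatch => //; exact: pspd_cont).
move=> t /(nd_in _ _ kM) tpq; apply: le_trans (ler_enorm_dist _ _) _.
have -> : tau' x t + A * b' k t *: K (tau x t) - (tau' y t + A * b' k t *: K (tau y t)) =
   (tau' x t - tau' y t) + (A * b' k t) *: K (tau x t - tau y t).
  by rewrite /K turnKB; apply/rowP => i; rewrite !mxE; ring.
apply: le_trans (enormD _ _) _; rewrite mulrDl; apply: lerD; first exact: HL'.
rewrite enormZ normrM (ger0_norm A0) -!mulrA ler_wpM2l //.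
apply: ler_pM; rewrite ?enorm_ge0 //; first exact: dphump_le.
exact: le_trans (enorm_turnK _ _ aa ee ae _) (HL _ _ _ _ _ _).
Qed.

(** The velocity is affine in the amplitude and the norm is convex; integration preserves the
    inequality. *)
Lemma plen_convex k A th x : (k < M.+1)%N -> ok x -> 0 <= th <= 1 ->
  plen k (th * A) x <= (1 - th) * plen k 0 x + th * plen k A x.
Proof.
move=> kM xo /andP[th0 th1].
have c B : cont `[nd k, nd k.+1] (pspd k B x) by apply: cpatch => //; exact: pspd_cont.
have cZ B z : cont `[nd k, nd k.+1] (fun t => z * pspd k B x t).
  by apply: (CKM _ 0); [exact: (CK_cst _ _ 0)|exact: c].
rewrite /plen -!rintZ -?rintD //; apply: rint_le;
  [exact: ndle|exact: c|by apply: (CKD _ _ 0); exact: cZ|].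
move=> t _; rewrite /pspd.
have -> : tau' x t + th * A * b' k t *: K (tau x t) =
    (1 - th) *: (tau' x t + 0 * b' k t *: K (tau x t)) +
    th *: (tau' x t + A * b' k t *: K (tau x t)).
  by apply/rowP => i; rewrite !mxE; ring.
apply: le_trans (enormD _ _) _.
by rewrite !enormZ (ger0_norm th0) ger0_norm ?subr_ge0.
Qed.

Lemma plen0_le k x : (k < M.+1)%N -> ok x -> plen k 0 x + m * de <= target k.
Proof.
move=> kM xo; have cs := cpatch _ _ _ kM Hsig.
rewrite -lerBrDr -(ndS k) -rint_cst // -rintB //; last exact: (CK_cst _ _ 0).
apply: rint_le => //.
- by apply: cpatch => //; exact: pspd_cont.
- by apply: (CKB _ _ 0) => //; exact: (CK_cst _ _ 0).
- move=> t /(nd_in _ _ kM) tpq; rewrite /pspd mul0r scale0r addr0; exact: Hgap.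
Qed.

(** At this amplitude the bump term has norm at least [ampmax / 4] times the absolute derivative of
    the bump, by the lower bound 1/4 on the infinitesimal rotation. Its integral is at least
    [2 * C * de]; removing [C * de] for [tau'] still leaves the largest possible target. *)
Definition ampmax := 8 * C / expR (-1).

Lemma ampmax_ge0 : 0 <= ampmax.
Proof. by rewrite divr_ge0 ?expR_ge0 // mulr_ge0 // ltW. Qed.

Lemma plen_max k x : (k < M.+1)%N -> ok x -> target k <= plen k ampmax x.
Proof.
move=> kM xo; have cs := cpatch _ _ _ kM Hsig.
have T1 : target k <= C * de.
  rewrite -(ndS k); apply: rint_le_cst => // t /(nd_in _ _ kM); exact: HsC.
have A0 := ampmax_ge0.
have cb : cont `[nd k, nd k.+1] (fun t => `|b' k t|).
  have cb' := cont_sub _ _ _ _ (@subsetT _ `[nd k, nd k.+1]%classic) (dphump_cont p q M k).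
  by move=> t Dt; apply: cvg_norm; exact: cb'.
have cA z : cont `[nd k, nd k.+1] (fun t => z * `|b' k t|).
  by apply: (CKM _ 0) => //; exact: (CK_cst _ _ 0).
have H2 : rint (nd k) (nd k.+1) (fun t => ampmax / 4 * `|b' k t| - C) <= plen k ampmax x.
  apply: rint_le => //.
  - by apply: (CKB _ _ 0); [exact: cA|exact: (CK_cst _ _ 0)].
  - by apply: cpatch => //; exact: pspd_cont.
  - move=> t /(nd_in _ _ kM) tpq.
    have := enorm_le_dist (ampmax * b' k t *: K (tau x t)) (- tau' x t).
    rewrite opprK enormN (addrC _ (tau' x t)) -/(pspd k ampmax x t).
    rewrite enormZ normrM (ger0_norm A0).
    have E1 := HC _ _ xo tpq.
    have E2 := le_trans (Ha _ _ xo tpq) (enorm_turnK_ge _ _ aa ee ae _).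
    have E3 : ampmax * `|b' k t| * (1 / 4) <= ampmax * `|b' k t| * enorm (K (tau x t)).
      by rewrite ler_wpM2l // mulr_ge0.
    lra.
apply: le_trans T1 _; apply: le_trans H2.
rewrite rintB //; last exact: (CK_cst _ _ 0).
rewrite rintZ // rint_cst // ndS.
have := rint_dphump p q M pq k; rewrite -/(nd k) -/(nd k.+1) -/de -/b' => H3.
have A40 : 0 <= ampmax / 4 by rewrite divr_ge0.
have := ler_wpM2l A40 H3.
have -> : ampmax / 4 * (de * expR (-1)) = 2 * (C * de).
  by rewrite /ampmax; field; rewrite gt_eqF // expR_gt0.
lra.
Qed.

(** Intermediate values: the length is Lipschitz in the amplitude, below the target at 0 and not
    below it at [ampmax]. *)
Lemma amp_exists k x : (k < M.+1)%N -> ok x ->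
  exists2 A, 0 <= A <= ampmax & plen k A x = target k.
Proof.
move=> kM xo; apply: (cont_ivt 0 ampmax (fun A => plen k A x)).
- exact: ampmax_ge0.
- apply: (@lip_cont _ _ _ _ (192 * de)) => s t _ _; exact: plen_lipA.
- rewrite plen_max // andbT; apply: le_trans (plen0_le _ _ kM xo).
  by rewrite lerDl mulr_ge0 // ltW.
Qed.

Definition amp k x := xget 0 [set A | 0 <= A <= ampmax /\ plen k A x = target k].

Lemma ampP k x : (k < M.+1)%N -> ok x ->
  0 <= amp k x <= ampmax /\ plen k (amp k x) x = target k.
Proof.
move=> kM xo; have [A A1 A2] := amp_exists k x kM xo.
by have /(xgetPex 0) :
  exists B, [set B | 0 <= B <= ampmax /\ plen k B x = target k] B by exists A.
Qed.

(** [clen] bounds the variation of the length with [x], per unit of patch length and for all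
    amplitudes up to [ampmax]; [camp] is the constant that [convex_root_gap] then gives for the
    amplitude. *)
Definition clen := C + ampmax * 192 * C.
Definition camp := ampmax * clen / m.

Lemma clen_ge0 : 0 <= clen.
Proof.
apply: addr_ge0; first exact: ltW.
by apply: mulr_ge0; [apply: mulr_ge0; [exact: ampmax_ge0|]|exact: ltW].
Qed.

Lemma camp_ge0 : 0 <= camp.
Proof.
apply: divr_ge0; last exact: ltW.
by apply: mulr_ge0; [exact: ampmax_ge0|exact: clen_ge0].
Qed.

(** The smaller amplitude, used on the curve of [y] instead of that of [x], misses the target by at
    most [clen * enorm (x - y) * de]. Convexity together with the initial deficit [m * de] turns
    this into a bound on the gap to the amplitude of [y]; the factor [de] cancels, so the bound is
    uniform in [M]. *)
Lemma amp_lip k x y : (k < M.+1)%N -> ok x -> ok y ->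
  `|amp k x - amp k y| <= camp * enorm (x - y).
Proof.
wlog xy : x y / amp k x <= amp k y.
  move=> H kM xo yo; have [le|/ltW le] := leP (amp k x) (amp k y); first exact: H.
  by rewrite distrC enormBC; exact: H.
move=> kM xo yo; have [/andP[x0 xA] Lx] := ampP k x kM xo.
have [/andP[y0 yA] Ly] := ampP k y kM yo.
move: (amp k x) (amp k y) xy x0 xA Lx y0 yA Ly => ax ay xy x0 xA Lx y0 yA Ly.
rewrite distrC ger0_norm; last by rewrite subr_ge0.
have Hx := plen_lipx k ax x y kM x0 xo yo; rewrite Lx in Hx.
apply: (convex_root_gap ax ay ampmax (target k) (plen k 0 y) (plen k ax y) m de clen).
- exact: x0.
- exact: xy.
- exact: yA.
- exact: m0.
- exact: de0.
- exact: clen_ge0.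
- exact: enorm_ge0.
- move=> th th01 E; rewrite -Ly -E; exact: plen_convex.
- exact: plen0_le.
- apply: le_trans (ler_norm _) _; apply: le_trans Hx _.
  apply: ler_wpM2r; first exact: ltW.
  apply: ler_wpM2r; first exact: enorm_ge0.
  rewrite lerD2l; apply: ler_wpM2r; first exact: ltW.
  by apply: ler_wpM2r.
Qed.

#[local] Opaque amp plen.

Definition wig x t := \sum_(k < M.+1) amp k x * b k t.
Definition wig' x t := \sum_(k < M.+1) amp k x * b' k t.

Lemma wig_patch k x t : (k < M.+1)%N -> nd k <= t <= nd k.+1 ->
  wig x t = amp k x * b k t /\ wig' x t = amp k x * b' k t.
Proof.
move=> kM tk; split; rewrite /wig /wig' (bigD1 (Ordinal kM)) //= big1 ?addr0 // => j jk.
- by have [E _] := phump_other p q M pq j k t jk tk; rewrite /b E mulr0.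
- by have [_ E] := phump_other p q M pq j k t jk tk; rewrite /b' E mulr0.
Qed.

Lemma wig_derives x : derives setT (wig x) (wig' x).
Proof.
by move=> t _; apply: isder_sum => k; apply: (isderZl R); exact: phump_derives.
Qed.

Lemma wig_CK j x : CK setT j (wig x).
Proof. by apply: CK_sum => k; apply: CKM; [exact: CK_cst|exact: phump_CK]. Qed.

Lemma wig'_cont x : cont setT (wig' x).
Proof.
apply: (CK_sum _ _ 0) => k; apply: (CKM _ 0); first exact: (CK_cst _ _ 0).
exact: dphump_cont.
Qed.

Lemma wig_supp x : supp_in (p + de / 4) (q - de / 4) (wig x).
Proof.
move=> t H; rewrite /wig big1 // => k _.
have [|E _] := phump_out p q M pq k t; last by rewrite /b E mulr0.
apply: contra H => /andP[t1 t2]; apply/andP; split.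
- by apply: le_trans t1; rewrite lerD2r node_ge_p.
- by apply: le_trans t2 _; rewrite lerD2r node_le_q.
Qed.

Lemma wig_le k x t : (k < M.+1)%N -> ok x -> nd k <= t <= nd k.+1 ->
  `|wig x t| <= ampmax * de.
Proof.
move=> kM xo tk; have [-> _] := wig_patch k x t kM tk.
have [/andP[A0 A1] _] := ampP k x kM xo.
by rewrite normrM (ger0_norm A0); apply: ler_pM => //; exact: phump_le.
Qed.

Lemma wig_lip k x y t : (k < M.+1)%N -> ok x -> ok y -> nd k <= t <= nd k.+1 ->
  `|wig x t - wig y t| <= camp * enorm (x - y) * de.
Proof.
move=> kM xo yo tk; have [-> _] := wig_patch k x t kM tk.
have [-> _] := wig_patch k y t kM tk.
rewrite -mulrBl normrM; apply: ler_pM; rewrite ?normr_ge0 //; last exact: phump_le.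
exact: amp_lip.
Qed.

Lemma wig'_le k x t : (k < M.+1)%N -> ok x -> nd k <= t <= nd k.+1 ->
  `|wig' x t| <= ampmax * 192.
Proof.
move=> kM xo tk; have [_ ->] := wig_patch k x t kM tk.
have [/andP[A0 A1] _] := ampP k x kM xo.
by rewrite normrM (ger0_norm A0); apply: ler_pM => //; exact: dphump_le.
Qed.

Lemma wig'_lip k x y t : (k < M.+1)%N -> ok x -> ok y -> nd k <= t <= nd k.+1 ->
  `|wig' x t - wig' y t| <= camp * enorm (x - y) * 192.
Proof.
move=> kM xo yo tk; have [_ ->] := wig_patch k x t kM tk.
have [_ ->] := wig_patch k y t kM tk.
rewrite -mulrBl normrM; apply: ler_pM; rewrite ?normr_ge0 //; last exact: dphump_le.
exact: amp_lip.
Qed.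

#[local] Opaque wig wig'.

Definition spd x t := enorm (tau' x t + wig' x t *: K (tau x t)).
Definition curve x t := turn a e (wig x t) (tau x t).
Definition curve' x t := turn a e (wig x t) (tau' x t + wig' x t *: K (tau x t)).

Lemma curve_derives x : ok x -> derives `[p, q] (curve x) (curve' x).
Proof.
move=> xo t tpq; apply: isder_turn => //; last exact: Hd.
exact: isder_sub (@subsetT _ _) (wig_derives x t I).
Qed.

Lemma spdE x t : enorm (curve' x t) = spd x t.
Proof. exact: enorm_turn. Qed.

Lemma spd_cont x : ok x -> cont `[p, q] (spd x).
Proof.
move=> xo; apply: cont_enorm; apply: (CKD _ _ 0); first exact: Hc.
apply: (CKZ _ _ 0); last exact: cont_Ktau.
exact: cont_sub (@subsetT _ _) (wig'_cont x).
Qed.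

(** The corrugation term is orthogonal to [u], so pairing the velocity with [u] does not see it,
    however large the amplitude. *)
Lemma spd_ge x t : ok x -> p <= t <= q -> mu <= spd x t.
Proof.
move=> xo tpq; apply: le_trans (Hmu x t xo tpq) _.
have := cauchy_schwarz (tau' x t + wig' x t *: K (tau x t)) u.
by rewrite uu mulr1 dotDl dotZl dot_turnK // mulr0 addr0.
Qed.

Lemma spd_le x t : ok x -> p <= t <= q -> spd x t <= C + ampmax * 192.
Proof.
move=> xo tpq; have [k kM tk] := node_patch p q M t tpq.
apply: le_trans (enormD _ _) _; apply: lerD; first exact: HC.
rewrite enormZ -[leRHS]mulr1; apply: ler_pM; rewrite ?normr_ge0 ?enorm_ge0 //.
  exact: wig'_le xo tk.
exact: enorm_Ktau.
Qed.

Definition cspd := C + camp * 192 + ampmax * 192 * C.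

Lemma spd_lip x y t : ok x -> ok y -> p <= t <= q ->
  `|spd x t - spd y t| <= cspd * enorm (x - y).
Proof.
move=> xo yo tpq; have [k kM tk] := node_patch p q M t tpq.
apply: le_trans (ler_enorm_dist _ _) _.
rewrite affine_diff -(turnKB a e).
have -> : cspd * enorm (x - y) = C * enorm (x - y) + camp * enorm (x - y) * 192 +
    ampmax * 192 * (C * enorm (x - y)) by rewrite /cspd; ring.
apply: le_trans (enormD _ _) _; apply: lerD.
  apply: le_trans (enormD _ _) _; apply: lerD; first exact: HL'.
  rewrite enormZ -[leRHS]mulr1; apply: ler_pM; rewrite ?normr_ge0 ?enorm_ge0 //.
    exact: wig'_lip xo yo tk.
  exact: enorm_Ktau.
rewrite enormZ; apply: ler_pM; rewrite ?normr_ge0 ?enorm_ge0 //.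
  exact: wig'_le yo tk.
apply: le_trans (enorm_turnK _ _ aa ee ae _) _; exact: HL.
Qed.

Lemma len_patch k x : (k < M.+1)%N -> ok x -> rint (nd k) (nd k.+1) (spd x) = target k.
Proof.
move=> kM xo; have [_ <-] := ampP k x kM xo.
by apply: rint_congr => t tk; rewrite /spd /pspd; have [_ ->] := wig_patch k x t kM tk.
Qed.

Lemma len_node k x : (k <= M.+1)%N -> ok x -> rint p (nd k) (spd x) = rint p (nd k) sig.
Proof.
move=> + xo; elim: k => [_|k IH kM].
  by rewrite /nd node0 !rint_point.
have pk : p <= nd k by exact: node_ge_p.
have kq : nd k.+1 <= q by exact: node_le_q.
have cx := cont_sub_itv _ _ _ _ _ _ (lexx p) kq (spd_cont x xo).
have cs := cont_sub_itv _ _ _ _ _ _ (lexx p) kq Hsig.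
rewrite (rint_chasles p (nd k.+1) (nd k) _ pk (ndle k) cx).
rewrite (rint_chasles p (nd k.+1) (nd k) _ pk (ndle k) cs).
by rewrite (len_patch k x kM xo) (IH (ltnW kM)).
Qed.

Lemma len_total x : ok x -> rint p q (spd x) = rint p q sig.
Proof. by move=> xo; have := len_node M.+1 x (leqnn _) xo; rewrite /nd nodeN. Qed.

Lemma sig_ge x t : ok x -> p <= t <= q -> m <= sig t.
Proof.
move=> xo tpq; have := le_trans (enorm_ge0 _) (Hgap x t xo tpq).
by rewrite subr_ge0.
Qed.

(** Lengths agree at every node, so a reparametrization maps each patch to itself. It therefore
    moves points by at most [de]. *)
Lemma reparam_patch k x phi : (k < M.+1)%N -> ok x -> reparam p q (spd x) sig phi ->
  reparam (nd k) (nd k.+1) (spd x) sig phi.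
Proof.
move=> kM xo Hphi.
have sg s : p <= s <= q -> 0 <= sig s by move=> sI; exact: le_trans (ltW m0) (sig_ge x s xo sI).
exact: (reparam_restrict p q mu (nd k) (nd k.+1) (spd x) sig phi mu0 (spd_cont x xo) Hsig
  (fun s => spd_ge x s xo) sg Hphi (node_ge_p p q M pq k) (ndle k) (node_le_q p q M pq _ kM)
  (len_node k x (ltnW kM) xo) (len_node k.+1 x kM xo)).
Qed.

Lemma sol_lip k x y phi psi t : (k < M.+1)%N -> ok x -> ok y -> reparam p q (spd x) sig phi ->
  reparam p q (spd y) sig psi -> nd k <= t <= nd k.+1 ->
  `|phi t - psi t| <= cspd * enorm (x - y) * de / mu.
Proof.
move=> kM xo yo Hphi Hpsi tk; rewrite -(ndS k).
have [px Ex] := reparam_patch k x phi kM xo Hphi t tk.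
have [py Ey] := reparam_patch k y psi kM yo Hpsi t tk.
apply: (rint_solve_lip (nd k) (nd k.+1) mu _ (phi t) (psi t) (spd x) (spd y)).
- exact: mu0.
- by apply: cpatch kM _; exact: spd_cont.
- by apply: cpatch kM _; exact: spd_cont.
- by move=> s /(nd_in _ _ kM); exact: spd_ge.
- by move=> s /(nd_in _ _ kM); exact: spd_ge.
- by move=> s /(nd_in _ _ kM); exact: spd_lip.
- exact: px.
- exact: py.
- by rewrite Ex Ey.
Qed.

Lemma patch_dist k s t : nd k <= s <= nd k.+1 -> nd k <= t <= nd k.+1 -> `|s - t| <= de.
Proof.
rewrite -(ndS k) => /andP[s1 s2] /andP[t1 t2]; rewrite ler_norml opprB.
by apply/andP; split; apply: lerB.
Qed.

(** The angle is at most [ampmax * de], and [tau x] moves at speed at most [C] over a distance at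
    most [de]. *)
Lemma curve_close k x phi t : (k < M.+1)%N -> ok x -> reparam p q (spd x) sig phi ->
  nd k <= t <= nd k.+1 -> enorm (curve x (phi t) - tau x t) <= (2 * ampmax + C) * de.
Proof.
move=> kM xo Hphi tk; have [fk _] := reparam_patch k x phi kM xo Hphi t tk.
have fI := nd_in _ _ kM fk; have tI := nd_in _ _ kM tk.
rewrite mulrDl; apply: le_trans (enorm_dist _ (tau x (phi t)) _) _; apply: lerD.
  rewrite -[X in enorm (_ - X)](turn0 a e) /curve.
  apply: le_trans (turn_lip _ _ aa ee ae _ _ _) _.
  rewrite subr0 H1 // mulr1 -mulrA ler_pM2l //; exact: wig_le kM xo fk.
apply: le_trans (enorm_mvt p q _ _ C (Hd x xo) _ t (phi t) tI fI) _.
  by move=> s; exact: HC.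
by rewrite ler_pM2l //; exact: patch_dist fk tk.
Qed.

Definition cfin := 2 * camp + 2 * ampmax * C + (C + ampmax * 192) * cspd / mu + C.

(** [diff_split] isolates four effects, in the order of the terms of [cfin]: the change of the
    angle; the action of a small rotation on [tau x - tau y]; the change of the reparametrization,
    at bounded speed; and the increment of [tau x - tau y] from [t] to [phi t]. Each is of order
    [de * enorm (x - y)]. *)
Lemma curve_close_lip k x y phi psi t : (k < M.+1)%N -> ok x -> ok y ->
  reparam p q (spd x) sig phi -> reparam p q (spd y) sig psi -> nd k <= t <= nd k.+1 ->
  enorm (curve x (phi t) - tau x t - (curve y (psi t) - tau y t)) <=
  cfin * de * enorm (x - y).
Proof.
move=> kM xo yo Hphi Hpsi tk; have [fk _] := reparam_patch k x phi kM xo Hphi t tk.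
have [gk _] := reparam_patch k y psi kM yo Hpsi t tk.
have fI := nd_in _ _ kM fk; have tI := nd_in _ _ kM tk; have gI := nd_in _ _ kM gk.
rewrite (diff_split _ (turn a e (wig y (phi t)) (tau x (phi t))) (curve y (phi t)) _
  (tau x (phi t)) (tau y (phi t))).
have -> : cfin * de * enorm (x - y) = 2 * (camp * enorm (x - y) * de) +
    2 * (ampmax * de) * (C * enorm (x - y)) +
    (C + ampmax * 192) * (cspd * enorm (x - y) * de / mu) + C * enorm (x - y) * de.
  by rewrite /cfin; ring.
have D0 := enorm_ge0 (x - y).
apply: le_trans (enormD _ _) _; apply: lerD; last first.
  apply: (@le_trans _ _ (C * enorm (x - y) * `|phi t - t|)).
    apply: (enorm_mvt p q (fun s => tau x s - tau y s) (fun s => tau' x s - tau' y s)) => //.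
      by move=> s sI; apply: isderB; [exact: Hd|exact: Hd].
    by move=> s sI; exact: HL'.
  apply: ler_wpM2l; last exact: patch_dist fk tk.
  by apply: mulr_ge0 => //; exact: ltW.
apply: le_trans (enormD _ _) _; apply: lerD; last first.
  apply: (@le_trans _ _ ((C + ampmax * 192) * `|phi t - psi t|)).
    apply: (enorm_mvt p q _ _ _ (curve_derives y yo)) => //.
    by move=> s sI; rewrite spdE; exact: spd_le.
  apply: ler_wpM2l; last exact: sol_lip kM xo yo Hphi Hpsi tk.
  apply: addr_ge0; first exact: ltW.
  by apply: mulr_ge0; first exact: ampmax_ge0.
apply: le_trans (enormD _ _) _; apply: lerD.
  apply: le_trans (turn_lip _ _ aa ee ae _ _ _) _.
  rewrite (H1 x _ xo fI) mulr1 ler_pM2l //; exact: wig_lip kM xo yo fk.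
rewrite /curve -turnB -[X in enorm (_ - X)](turn0 a e).
apply: le_trans (turn_lip _ _ aa ee ae _ _ _) _.
apply: ler_pM; [by apply: mulr_ge0|exact: enorm_ge0| |].
  rewrite subr0 ler_pM2l //; exact: wig_le kM yo fk.
exact: HL.
Qed.

End Patches.

(** [C7] is fixed before [M], so size and Lipschitz constant of the perturbation both tend to 0. The
    case [x = y] of the last clause also shows that the curve does not depend on which solution
    [phi] is taken. *)
Theorem corrugation : exists2 C7, 0 < C7 & forall M : nat, exists h h' : 'rV[R]_n -> R -> R,
  let g x t := enorm (tau' x t + h' x t *: turnK a e (tau x t)) in
  [/\ forall x k, CK setT k (h x),
      forall x, exists c d, [/\ p < c, d < q & supp_in c d (h x)],
      forall x, derives setT (h x) (h' x) /\ cont setT (h' x),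
      forall x, ok x -> [/\ cont `[p, q] (g x), forall t, p <= t <= q -> mu <= g x t &
        rint p q (g x) = rint p q sig] &
      forall x y phi psi t, ok x -> ok y -> reparam p q (g x) sig phi ->
        reparam p q (g y) sig psi -> p <= t <= q ->
        enorm (turn a e (h x (phi t)) (tau x (phi t)) - tau x t) <= C7 / M.+1%:R /\
        enorm (turn a e (h x (phi t)) (tau x (phi t)) - tau x t -
               (turn a e (h y (psi t)) (tau y (psi t)) - tau y t))
          <= C7 / M.+1%:R * enorm (x - y)].
Proof.
have A0 := ampmax_ge0; have qp : 0 < q - p by rewrite subr_gt0.
have C1 : 0 < 2 * ampmax + C by apply: ltr_wpDl => //; exact: mulr_ge0.
have C2 : 0 <= cfin := cfin_aux _ _ _ _ A0 camp_ge0 C0 mu0.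
exists ((2 * ampmax + C + cfin) * (q - p)).
  by apply: mulr_gt0 => //; apply: ltr_wpDr.
move=> M; exists (wig M), (wig' M) => /=.
have step0 := step_gt0 p q M pq.
split.
- by move=> x k; exact: wig_CK.
- move=> x; exists (p + step p q M / 4), (q - step p q M / 4); split.
  + by rewrite ltrDl divr_gt0.
  + by rewrite ltrBlDr ltrDl divr_gt0.
  + exact: wig_supp.
- by move=> x; split; [exact: wig_derives|exact: wig'_cont].
- move=> x xo; split; [exact: spd_cont|by move=> t; exact: spd_ge|exact: len_total].
- move=> x y phi psi t xo yo Hphi Hpsi tpq.
  have [k kM tk] := node_patch p q M t tpq.
  have -> : (2 * ampmax + C + cfin) * (q - p) / M.+1%:R =
    (2 * ampmax + C) * step p q M + cfin * step p q M by rewrite -mulrA mulrDl.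
  split.
  + apply: le_trans (curve_close M k x phi t kM xo Hphi tk) _.
    by rewrite lerDl mulr_ge0 // ltW.
  + apply: le_trans (curve_close_lip M k x y phi psi t kM xo yo Hphi Hpsi tk) _.
    apply: ler_wpM2r; first exact: enorm_ge0.
    by rewrite lerDr mulr_ge0 // ltW.
Qed.

End Corrugation.

(* [Phi (phi t) = S t] makes [phi] differentiable, with no smoothness of
   [phi] assumed. *)
Lemma isder_inverse {R : realType} (D : set R) (mu : R) (Phi g S sig phi : R -> R) :
  (forall s t x, D s -> D t -> s <= x <= t -> D x) -> 0 < mu ->
  derives D Phi g -> (forall t, D t -> mu <= g t) -> derives D S sig ->
  (forall t, D t -> D (phi t)) ->
  (forall s t, D s -> D t -> Phi (phi s) - Phi (phi t) = S s - S t) ->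
  derives D phi (fun t => sig t / g (phi t)).
Proof.
move=> cD mu0 HPhi gmu HS Dphi E.
have key s t : D s -> D t -> s <= t -> mu * (t - s) <= Phi t - Phi s.
  move=> Ds Dt st.
  have sub : `[s, t] `<=` D by move=> x /=; rewrite in_itv /=; exact: cD.
  have H := derives_sub _ _ _ _ _ sub HPhi.
  have Hl : derives `[s, t] (fun x => mu * x) (fun=> mu).
    by move=> x xI; rewrite -[mu in X in isder _ _ _ X]mulr1; apply: (isderZl R); exact: isder_id.
  rewrite mulrBr; apply: derives_le st Hl H _ => x xI; apply: gmu.
  exact: cD xI.
have key2 s t : D s -> D t -> mu * `|t - s| <= `|Phi t - Phi s|.
  move=> Ds Dt; have [st|/ltW ts] := leP s t.
    by rewrite ger0_norm ?subr_ge0 //; apply: le_trans (ler_norm _); exact: key.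
  rewrite distrC ger0_norm ?subr_ge0 // distrC; apply: le_trans (ler_norm _); exact: key.
have cphi : cont D phi.
  have cS := derives_cont _ _ _ _ HS.
  move=> t Dt; apply/cvg_withinP => e e0; have me : 0 < mu * e by rewrite mulr_gt0.
  have /cvg_withinP/(_ _ me)[d d0 Hd] := cS t Dt.
  exists d => // s Ds /(Hd s Ds) H; rewrite -(ler_pM2l mu0); apply: le_trans H.
  by rewrite -E //; apply: key2; exact: Dphi.
move=> t Dt; have Dpt := Dphi t Dt.
have [psi PE psil] := HPhi (phi t) Dpt; have [chi SE chil] := HS t Dt.
have psit : psi (phi t) = g (phi t) by exact: cvg_within_at Dpt psil.
(* If the slope of [Phi] vanished at some [y] other than [phi t], then [Phi] would take the same
   value at both points, against [key2]. *)
have psi0 y : D y -> psi y != 0.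
  move=> Dy; have [->|yt] := eqVneq y (phi t).
    by rewrite psit gt_eqF // (lt_le_trans mu0) // gmu.
  apply: contraNneq yt => py; have := PE y Dy; rewrite py scaler0 addr0 => H.
  have := key2 (phi t) y Dpt Dy; rewrite H subrr normr0 pmulr_rle0 // normr_le0.
  by rewrite subr_eq0.
exists (fun s => chi s / psi (phi s)).
  move=> s Ds; have := E s t Ds Dt; rewrite (PE _ (Dphi s Ds)) (SE s Ds).
  rewrite (addrC (Phi _)) (addrC (S t)) !addrK => H.
  have p0 := psi0 _ (Dphi s Ds).
  have -> : (s - t) *: (chi s / psi (phi s)) = phi s - phi t.
    have {}H : (phi s - phi t) * psi (phi s) = (s - t) * chi s := H.
    by apply: (mulIf p0); rewrite H [_ *: _]mulrA divfK.
  by rewrite addrC subrK.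
apply: cvgM => //; apply: cvgV; first by rewrite gt_eqF // (lt_le_trans mu0) // gmu.
apply/cvg_withinP => e e0; have /cvg_withinP/(_ _ e0)[d d0 Hd] := psil.
have d20 : 0 < d / 2 by rewrite divr_gt0.
have /cvg_withinP/(_ _ d20)[d' d'0 Hd'] := cphi t Dt.
exists d' => // s Ds sd; apply: Hd; first exact: Dphi.
by apply: le_lt_trans (Hd' _ Ds sd) _; rewrite ltr_pdivrMr // ltr_pMr // ltr1n.
Qed.

Lemma subr_sub2 {V : zmodType} (x x' y y' z w : V) :
  x - z = y - w -> x' - z = y' - w -> x - x' = y - y'.
Proof. by move=> E E'; have := congr2 (fun a b => a - b) E E'; rewrite !opprB !subrKA. Qed.

(** * Existence and continuity of reparametrizations *)

Section Reparametrize.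
Context {R : realType}.
Implicit Types (p q : R) (f g : R -> R).

Lemma rint_prim p q f t : cont `[p, q] f -> p <= t <= q ->
  rint p t f = prim p q f t - prim p q f p.
Proof.
move=> cf /andP[pt tq]; have pq := le_trans pt tq.
exact: (rint_sub p q p t _ f (lexx p) pt tq (primP p q f pq cf)).
Qed.

Lemma reparam_exists p q mu f g : p <= q -> 0 < mu -> cont `[p, q] f -> cont `[p, q] g ->
  (forall t, p <= t <= q -> mu <= f t) -> (forall t, p <= t <= q -> 0 <= g t) ->
  rint p q f = rint p q g ->
  exists phi, reparam p q f g phi.
Proof.
move=> pq mu0 cf cg fmu g0 E.
have H t : exists s, p <= t <= q -> p <= s <= q /\ rint p s f = rint p t g.
  have [tpq|tpq] := boolP (p <= t <= q); last by exists 0.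
  have HP := primP p q f pq cf.
  have cP : cont `[p, q] (fun s => prim p q f s - prim p q f p).
    by apply: (CKB _ _ 0); [exact: derives_cont HP|exact: (CK_cst _ _ 0)].
  have [|s spq Es] := cont_ivt p q _ (rint p t g) pq cP.
    have /andP[pt tq] := tpq.
    have qI : p <= q <= q by rewrite pq lexx.
    have c1 : cont `[p, t] g by exact: cont_sub_itv (lexx p) tq cg.
    have c2 : cont `[t, q] g by exact: cont_sub_itv pt (lexx q) cg.
    rewrite subrr -(rint_prim p q f q cf qI) E (rint_chasles p q t g pt tq cg) lerDl.
    apply/andP; split; apply: rint_ge0.
    - exact: pt.
    - exact: c1.
    - by move=> x /andP[x1 x2]; apply: g0; rewrite x1 (le_trans x2 tq).
    - exact: tq.
    - exact: c2.
    - by move=> x /andP[x1 x2]; apply: g0; rewrite x2 (le_trans pt x1).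
  by exists s => _; rewrite spq (rint_prim p q f s cf spq).
by have [phi Hphi] := choice H; exists phi.
Qed.

Lemma reparam_cont p q mu f g phi : p <= q -> 0 < mu -> cont `[p, q] f -> cont `[p, q] g ->
  (forall t, p <= t <= q -> mu <= f t) -> reparam p q f g phi -> cont `[p, q] phi.
Proof.
move=> pq mu0 cf cg fmu Hphi.
have itvE t : `[p, q]%classic t = (p <= t <= q) by rewrite /= in_itv.
have HE t : p <= t <= q -> prim p q f (phi t) - prim p q f p = prim p q g t - prim p q g p.
  by move=> tI; have [pI E] := Hphi t tI; rewrite -!(rint_prim p q) // E.
apply: derives_cont (isder_inverse _ mu _ _ _ _ phi _ mu0 (primP p q f pq cf) _
  (primP p q g pq cg) _ _).
- move=> s t x; rewrite !itvE => /andP[ps _] /andP[_ tq] /andP[sx xt].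
  by rewrite (le_trans ps sx) (le_trans xt tq).
- by move=> t; rewrite itvE; exact: fmu.
- by move=> t; rewrite !itvE => /Hphi[].
- move=> s t; rewrite !itvE => /HE Es /HE Et.
  exact: subr_sub2 Es Et.
Qed.

End Reparametrize.

(** * The integral constraint *)

Section MonotoneZero.
Context {R : realType} {n : nat}.

Lemma enorm_ball_compact (rho : R) : compact [set x : 'rV[R]_n | enorm x <= rho].
Proof.
apply: bounded_closed_compact.
  exists rho; split; first exact: num_real.
  move=> M rM x /= xr; apply: le_trans (norm_le_enorm _) _.
  exact: le_trans xr (ltW rM).
have ce : continuous (@enorm R n).
  move=> x; apply/(@cvgrPdist_le _ _ _ (nbhs x) (nbhs_filter x)) => e e0.
  have d0 : 0 < e / (n%:R + 1) by rewrite divr_gt0 // ltr_wpDl.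
  apply: filterS (nbhsx_ballx x _ d0) => y; rewrite -ball_normE /=.
  rewrite ltr_pdivlMr ?ltr_wpDl // => xy.
  apply: le_trans (ler_enorm_dist _ _) _; apply: le_trans (enorm_le_norm _) _.
  apply: le_trans (ltW xy); rewrite mulrC ler_wpM2l // lerDl //.
have := @preimage_closed _ _ (@enorm R n) [set x | x <= rho].
by apply => // x _; exact: ce.
Qed.

(* At a minimiser of [|G|] the step [x - k G x] would decrease [|G|]. *)
Lemma monotone_zero (G : 'rV[R]_n -> 'rV[R]_n) (rho c M : R) :
  0 < rho -> 0 < c -> 0 < M ->
  (forall x y, enorm x <= rho -> enorm y <= rho ->
    c * enorm (x - y) ^+ 2 <= dot (G x - G y) (x - y)) ->
  (forall x y, enorm x <= rho -> enorm y <= rho ->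
    enorm (G x - G y) <= M * enorm (x - y)) ->
  enorm (G 0) <= c * rho / 4 ->
  exists2 x, enorm x <= rho & G x = 0.
Proof.
move=> rho0 c0 M0 Hm HL HG0.
pose A := [set x : 'rV[R]_n | enorm x <= rho].
have A0 : A 0 by rewrite /A /= enorm0 ltW.
have cF : {within A, continuous (fun x => enorm (G x))}.
  apply/subspace_continuousP => x Ax; apply/cvgrPdist_le => e e0.
  have K0 : 0 < M * n%:R + 1 by rewrite ltr_wpDl // mulr_ge0 // ltW.
  have d0 : 0 < e / (M * n%:R + 1) by rewrite divr_gt0.
  apply: filterS (nbhsx_ballx x _ d0) => y; rewrite -ball_normE /=.
  rewrite ltr_pdivlMr // => xy Ay.
  apply: le_trans (ler_enorm_dist _ _) _; apply: le_trans (HL _ _ Ax Ay) _.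
  apply: le_trans (ltW xy); apply: (@le_trans _ _ (M * (n%:R * `|x - y|))).
    by rewrite ler_pM2l //; exact: enorm_le_norm.
  by rewrite mulrA mulrC ler_wpM2l // lerDl.
have [x Ax Hmin] := EVT_min_rV (ex_intro _ 0 A0) (enorm_ball_compact rho) cF.
have {}Ax : enorm x <= rho by rewrite inE in Ax.
exists x => //; apply: contrapT => /eqP Gx0.
have g0 : 0 < enorm (G x) by exact: enorm_gt0.
have gle : enorm (G x) <= enorm (G 0) by apply: Hmin; rewrite inE.
set g := enorm (G x) in g0 gle.
(* Monotonicity between [x] and 0 gives [c * enorm x <= enorm (G x) + enorm (G 0)], at most
   [2 * enorm (G 0)]. The minimiser thus lies in the half ball, and a short step stays inside the
   ball. *)
have xle : enorm x <= rho / 2.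
  have := Hm _ _ Ax A0; rewrite subr0 => H.
  have := cauchy_schwarz (G x - G 0) x; have := enormB (G x) (G 0).
  have := enorm_ge0 x; move: H HG0 gle; rewrite /g.
  move: (enorm x) (enorm (G x - G 0)) (enorm (G 0)) (enorm (G x)) (dot _ x).
  move=> X Y Z W D H HZ WZ X0 YW DXY.
  rewrite leNgt; apply/negP => Xr.
  have : c * X ^+ 2 <= c * rho / 2 * X.
    by apply: le_trans H _; apply: le_trans DXY _; apply: ler_wpM2r => //; lra.
  have : 0 < c * X * (X - rho / 2) by rewrite !mulr_gt0 ?subr_gt0 //; lra.
  nra.
(* The step size satisfies [k * c <= 1], which keeps [y] in the ball, and [k * M ^+ 2 <= c], so that
   the gain [2 * c * k * g ^+ 2] from monotonicity outweighs the quadratic error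
   [(M * k * g) ^+ 2]. *)
pose k := c / (M + c) ^+ 2.
have Mc0 : 0 < (M + c) ^+ 2 by rewrite exprn_gt0 // addr_gt0.
have k0 : 0 < k by rewrite divr_gt0.
have kc : k * c <= 1 by rewrite /k mulrAC ler_pdivrMr // mul1r; nra.
have kM : k * M ^+ 2 <= c.
  by rewrite /k mulrAC ler_pdivrMr // ler_pM2l //; nra.
pose y := x - k *: G x.
have yE : y - x = - k *: G x by rewrite /y addrC addKr scaleNr.
have Ay : enorm y <= rho.
  apply: le_trans (enormB _ _) _; rewrite enormZ gtr0_norm // -/g.
  have : k * g <= k * (c * rho / 4) by rewrite ler_pM2l // (le_trans gle).
  have : k * c * rho <= 1 * rho by rewrite ler_pM2r.
  lra.
have Hy := Hmin y; rewrite inE in Hy; have {}Hy := Hy Ay.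
have m1 := Hm _ _ Ay Ax; have l1 := HL _ _ Ay Ax.
have E : enorm (G y) ^+ 2 = g ^+ 2 + 2 * dot (G y - G x) (G x) + enorm (G y - G x) ^+ 2.
  by rewrite /g !sqr_enorm !dotE (dotC (G x) (G y)); ring.
rewrite yE enormZ dotZr normrN gtr0_norm // -/g in m1 l1.
have : g ^+ 2 <= enorm (G y) ^+ 2 by rewrite ler_sqr ?nnegrE ?enorm_ge0 // /g enorm_ge0.
rewrite E.
have l2 : enorm (G y - G x) ^+ 2 <= (M * (k * g)) ^+ 2.
  have P0 : 0 <= M * (k * g) by apply: mulr_ge0; [exact: ltW|apply: mulr_ge0; exact: ltW].
  by rewrite ler_sqr ?nnegrE ?enorm_ge0.
have m2 : dot (G y - G x) (G x) <= - (c * k * g ^+ 2).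
  rewrite -(ler_pM2l k0); have -> : k * - (c * k * g ^+ 2) = - (c * (k * g) ^+ 2) by ring.
  lra.
have m3 : (M * (k * g)) ^+ 2 <= c * k * g ^+ 2.
  have -> : (M * (k * g)) ^+ 2 = (k * M ^+ 2) * (k * g ^+ 2) by ring.
  rewrite -[leRHS]mulrA; apply: ler_wpM2r => //.
  by apply: mulr_ge0; [exact: ltW|exact: sqr_ge0].
have : 0 < c * k * g ^+ 2 by apply: mulr_gt0; [exact: mulr_gt0|exact: exprn_gt0].
lra.
Qed.

End MonotoneZero.

(* The squared area of the parallelogram spanned by [v] and [w]. *)
Definition gram {R : realType} {n : nat} (v w : 'rV[R]_n) : R :=
  dot v v * dot w w - dot v w ^+ 2.

(** * Monotonicity of normalization, measured by Gram determinants *)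

Section Gram.
Context {R : realType} {n : nat}.
Implicit Types (v w x y z : 'rV[R]_n).

Lemma gram_ge0 v w : 0 <= gram v w.
Proof.
rewrite /gram -!sqr_enorm -exprMn subr_ge0 -[leLHS]real_normK ?num_real //.
by rewrite ler_sqr ?nnegrE ?mulr_ge0 ?enorm_ge0 // norm_dot_le.
Qed.

Lemma gram_shear v z c : gram v (v + c *: z) = c ^+ 2 * gram v z.
Proof. by rewrite /gram !dotE (dotC z v); ring. Qed.

(* Both unit vectors cannot be almost parallel to [z]. *)
Lemma gram_pair v w z eta : enorm v = 1 -> enorm w = 1 -> `|dot v w| <= 1 - eta ->
  eta * dot z z <= gram v z + gram w z.
Proof.
move=> v1 w1; rewrite ler_norml => /andP[h1 h2].
rewrite /gram -!(sqr_enorm v) -!(sqr_enorm w) v1 w1 expr1n !mul1r.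
have zz := dot_ge0 z.
have [e1|e1] := ltP 1 eta; first lra.
(* [2 - eta] bounds the largest eigenvalue of the Gram matrix of [v] and [w]; positivity of this
   square yields [a ^+ 2 + b ^+ 2 <= (2 - eta) * Z]. *)
have D := dot_ge0 (z - (2 - eta)^-1 *: (dot v z *: v + dot w z *: w)).
move: D; rewrite !dotE -!(sqr_enorm v) -!(sqr_enorm w) v1 w1 expr1n.
rewrite (dotC z v) (dotC z w) (dotC w v).
move: (dot v z) (dot w z) (dot v w) (dot z z) h1 h2 zz => a b c Z h1 h2 Z0.
have k0 : 0 < 2 - eta by lra.
have ki : (2 - eta)^-1 * (2 - eta) = 1 by rewrite mulVf // gt_eqF.
have i0 : 0 < (2 - eta)^-1 by rewrite invr_gt0.
move: (2 - eta)^-1 ki i0 => i ki i0 D.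
have ab : a ^+ 2 + b ^+ 2 + 2 * a * b * c <= (2 - eta) * (a ^+ 2 + b ^+ 2).
  have : 0 <= (1 - eta - c) * (a + b) ^+ 2 by rewrite mulr_ge0 ?sqr_ge0 // subr_ge0.
  have : 0 <= (1 - eta + c) * (a - b) ^+ 2 by rewrite mulr_ge0 ?sqr_ge0 //; lra.
  lra.
have D2 : 0 <= Z - 2 * i * (a ^+ 2 + b ^+ 2) + i ^+ 2 * (a ^+ 2 + b ^+ 2 + 2 * a * b * c) by lra.
have D3 : i ^+ 2 * (a ^+ 2 + b ^+ 2 + 2 * a * b * c) <= i * (a ^+ 2 + b ^+ 2).
  apply: (@le_trans _ _ (i ^+ 2 * ((2 - eta) * (a ^+ 2 + b ^+ 2)))).
    by apply: ler_wpM2l => //; exact: sqr_ge0.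
  have -> : i ^+ 2 * ((2 - eta) * (a ^+ 2 + b ^+ 2)) =
     i * (i * (2 - eta)) * (a ^+ 2 + b ^+ 2) by ring.
  by rewrite ki mulr1.
have D4 : i * (a ^+ 2 + b ^+ 2) <= Z by lra.
have : (2 - eta) * (i * (a ^+ 2 + b ^+ 2)) <= (2 - eta) * Z by rewrite ler_pM2l.
have -> : (2 - eta) * (i * (a ^+ 2 + b ^+ 2)) = i * (2 - eta) * (a ^+ 2 + b ^+ 2) by ring.
rewrite ki; lra.
Qed.

(** With norms [x], [y] and cosine [d], the right side is [(x + y) * (1 - d)], at least [1 - d],
    while the Gram determinant is [(x * y) ^+ 2 * (1 - d) * (1 + d)], at most
    [81 / 16 * 2 * (1 - d)]. *)
Lemma nrm_monotone v w : 1 / 2 <= enorm v <= 3 / 2 -> 1 / 2 <= enorm w <= 3 / 2 ->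
  8 / 81 * gram v w <= dot (nrm v - nrm w) (v - w).
Proof.
move=> /andP[v2 v3] /andP[w2 w3].
have v0 := half_neq0 _ v2; have w0 := half_neq0 _ w2.
have E : dot (nrm v - nrm w) (v - w) = (enorm v + enorm w) * (1 - dot (nrm v) (nrm w)).
  have vE : v = enorm v *: nrm v.
    by rewrite /nrm scalerA mulfV ?scale1r // gt_eqF // enorm_gt0.
  have wE : w = enorm w *: nrm w.
    by rewrite /nrm scalerA mulfV ?scale1r // gt_eqF // enorm_gt0.
  rewrite {2}vE {2}wE; have := enorm_nrm _ v0; have := enorm_nrm _ w0.
  move: (nrm v) (nrm w) (enorm v) (enorm w) => a b x y b1 a1.
  by rewrite !dotE -!sqr_enorm a1 b1 (dotC b a) expr1n; ring.
have D : `|dot (nrm v) (nrm w)| <= 1.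
  by apply: le_trans (norm_dot_le _ _) _; rewrite !enorm_nrm // mulr1.
rewrite E /gram (dot_nrm v w) // -!sqr_enorm; move: D; rewrite ler_norml => /andP[].
move: (dot _ _) (enorm v) (enorm w) v2 v3 w2 w3 => d x y x2 x3 y2 y3 d1 d2.
have xy : x * y <= 9 / 4 by have := ler_pM _ _ x3 y3; lra.
have xy0 : 0 <= x * y by nra.
have X2 : (x * y) ^+ 2 <= 81 / 16 by nra.
have : x ^+ 2 * y ^+ 2 - (x * y * d) ^+ 2 = (x * y) ^+ 2 * ((1 - d) * (1 + d)) by ring.
move=> ->.
have k0 : 0 <= (1 - d) * (1 + d) by rewrite mulr_ge0 //; lra.
have : (x * y) ^+ 2 * ((1 - d) * (1 + d)) <= 81 / 16 * ((1 - d) * (1 + d)) by apply: ler_wpM2r.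
nra.
Qed.

End Gram.

(** * The family of unit curves obtained by pushing and normalizing *)

Section Family.
Context {R : realType} {n : nat}.
Variables (p q : R) (T T1 : R -> 'rV[R]_n).
Hypotheses (pq : p < q) (HT : derives `[p, q] T T1) (cT1 : cont `[p, q] T1).
Hypothesis (T1u : forall t, p <= t <= q -> enorm (T t) = 1).
Implicit Types (x y z : 'rV[R]_n).

(** The segment is itself a domain, so the uniqueness proved for domains applies. *)
Lemma isder_itv_unique (V : normedModType R) (g : R -> V) t (l m : V) : p <= t <= q ->
  isder `[p, q] g t l -> isder `[p, q] g t m -> l = m.
Proof.
move=> tI Hl Hm; pose G := Domain Defs.Interval pq.
have Gt : points G t by rewrite /points /= in_itv.
by rewrite -(deriv_onE G V g t l Gt Hl) -(deriv_onE G V g t m Gt Hm).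
Qed.

Lemma unit_tangent_orth t : p <= t <= q -> dot (T t) (T1 t) = 0.
Proof.
move=> tI; have tD : `[p, q]%classic t by rewrite /= in_itv.
have H := isder_dot _ _ _ _ _ _ tD (HT t tD) (HT t tD).
have H0 : isder `[p, q] (fun s => dot (T s) (T s)) t 0.
  apply: (isder_ext _ _ _ _ _ _ tD _ (isder_cst _ _ (1 : R) _)) => s /=.
  by rewrite in_itv /= => sI; rewrite -sqr_enorm T1u // expr1n.
by have := isder_itv_unique _ _ _ _ _ tI H H0; rewrite (dotC (T1 t)); lra.
Qed.

Definition pushed x t := T t + hump p q t *: x.
Definition pushed' x t := T1 t + dhump p q t *: x.
Definition fam x t := nrm (pushed x t).
Definition fam' x t := dnrm (pushed x t) (pushed' x t).

Lemma hump_x_le x t : enorm (hump p q t *: x) <= enorm x.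
Proof.
rewrite enormZ ger0_norm ?hump_ge0 // -[leRHS]mul1r.
by apply: ler_wpM2r; rewrite ?enorm_ge0 ?hump_le1.
Qed.

Lemma pushed_range x t : enorm x <= 1 / 2 -> p <= t <= q ->
  1 / 2 <= enorm (pushed x t) <= 3 / 2.
Proof.
move=> x2 tI; have Hx := hump_x_le x t; have H1 := T1u t tI.
have := enormD (T t) (hump p q t *: x); rewrite -/(pushed x t).
have := enorm_le_dist (T t) (pushed x t).
rewrite enormBC /pushed (addrC (T t)) addrK; lra.
Qed.

Lemma pushed_neq0 x t : enorm x <= 1 / 2 -> p <= t <= q -> pushed x t != 0.
Proof. by move=> x2 tI; have /andP[/half_neq0] := pushed_range x t x2 tI. Qed.

Lemma pushed_derives x : derives `[p, q] (pushed x) (pushed' x).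
Proof.
move=> t tI; apply: isderD; first exact: HT.
apply: isderZr; exact: isder_sub (@subsetT _ _) (hump_derives p q t I).
Qed.

Lemma pushed'_cont x : cont `[p, q] (pushed' x).
Proof.
apply: (CKD _ _ 0) => //; apply: (CKZ _ _ 0); last exact: (CK_cst _ _ 0).
exact: cont_sub (@subsetT _ _) (dhump_cont p q).
Qed.

Lemma fam_derives x : enorm x <= 1 / 2 -> derives `[p, q] (fam x) (fam' x).
Proof.
move=> x2 t tI; apply: isder_nrm => //; last exact: pushed_derives.
by apply: pushed_neq0 => //; rewrite /= in_itv in tI.
Qed.

Lemma fam'_cont x : enorm x <= 1 / 2 -> cont `[p, q] (fam' x).
Proof.
move=> x2; apply: (CK_dnrm _ 0); last exact: pushed'_cont.
- by move=> s /=; rewrite in_itv /=; exact: pushed_neq0.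
- exact: derives_cont (pushed_derives x).
Qed.

Lemma enorm_fam x t : enorm x <= 1 / 2 -> p <= t <= q -> enorm (fam x t) = 1.
Proof. by move=> x2 tI; apply: enorm_nrm; exact: pushed_neq0. Qed.

Lemma pushed_lip x y t : enorm (pushed x t - pushed y t) <= enorm (x - y).
Proof.
have -> : pushed x t - pushed y t = hump p q t *: (x - y).
  by rewrite /pushed; apply/rowP => i; rewrite !mxE; ring.
exact: hump_x_le.
Qed.

Lemma pushed'_lip x y t : enorm (pushed' x t - pushed' y t) <= 192 / (q - p) * enorm (x - y).
Proof.
have -> : pushed' x t - pushed' y t = dhump p q t *: (x - y).
  by rewrite /pushed'; apply/rowP => i; rewrite !mxE; ring.
by rewrite enormZ; apply: ler_wpM2r; [exact: enorm_ge0|exact: dhump_le].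
Qed.

Lemma fam_lip x y t : enorm x <= 1 / 2 -> enorm y <= 1 / 2 -> p <= t <= q ->
  enorm (fam x t - fam y t) <= 2 * enorm (x - y).
Proof.
move=> x2 y2 tI; have /andP[X _] := pushed_range x t x2 tI.
have /andP[Y _] := pushed_range y t y2 tI.
apply: le_trans (nrm_lip _ _ X Y) _; rewrite ler_pM2l //; exact: pushed_lip.
Qed.

Lemma fam'_lip : exists2 C, 2 <= C & forall x y t, enorm x <= 1 / 2 -> enorm y <= 1 / 2 ->
  p <= t <= q -> enorm (fam' x t - fam' y t) <= C * enorm (x - y).
Proof.
have [B0 B00 HB0] := cont_bounded p q _ (ltW pq) (cont_enorm _ _ cT1).
have l0 : 0 <= 192 / (q - p) by rewrite divr_ge0 // subr_ge0 ltW.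
set l := 192 / (q - p) in l0.
(* The constant of [dnrm_lip], with velocities bounded by [B0 + l] and depending on [x] with
   Lipschitz constant [l]; the final 2 makes it dominate the constant of [fam_lip] as well. *)
exists (16 * (B0 + l) + 4 * l + 2); first lra.
move=> x y t x2 y2 tI; have /andP[X _] := pushed_range x t x2 tI.
have /andP[Y _] := pushed_range y t y2 tI.
have HP z : enorm z <= 1 / 2 -> enorm (pushed' z t) <= B0 + l.
  move=> z2; apply: le_trans (enormD _ _) _; apply: lerD; first exact: HB0.
  rewrite enormZ -[leRHS]mulr1; apply: ler_pM; rewrite ?enorm_ge0 //; last lra.
  exact: dhump_le.
apply: le_trans (dnrm_lip _ _ _ _ _ X Y (HP x x2) (HP y y2)) _.
have := pushed_lip x y t; have := pushed'_lip x y t; rewrite -/l.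
have D0 := enorm_ge0 (x - y).
have B0l : 0 <= 16 * (B0 + l) by lra.
move=> H1 /(ler_wpM2l B0l); lra.
Qed.

Lemma pushed0 t : pushed 0 t = T t.
Proof. by rewrite /pushed scaler0 addr0. Qed.

Lemma fam0 t : p <= t <= q -> fam 0 t = T t.
Proof. by move=> tI; rewrite /fam pushed0 /nrm T1u // invr1 scale1r. Qed.

Lemma fam'0 t : p <= t <= q -> fam' 0 t = T1 t.
Proof.
move=> tI; have := fam0 t tI; rewrite /fam' /dnrm /fam pushed0 => ->.
by rewrite /pushed' scaler0 addr0 T1u // unit_tangent_orth // invr1 scale1r scale0r subr0.
Qed.

(** Expanding around [T t], the linear terms cost [2 * rho] from the squared norm and [2 * rho] from
    the squared inner product, and the quadratic one at most [rho ^+ 2], which is below [rho]. *)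
Lemma gram_pushed rho x z t : 0 <= rho -> rho <= 1 / 2 -> enorm x <= rho -> p <= t <= q ->
  gram (T t) z - 5 * rho * dot z z <= gram (pushed x t) z.
Proof.
move=> r0 r2 xr tI; have Hx := le_trans (hump_x_le x t) xr.
rewrite /pushed; move: (hump p q t *: x) Hx => w wr; have T11 := T1u t tI.
move: (T t) T11 => S S1; rewrite /gram !dotE -!(sqr_enorm S) S1 expr1n.
have c1 := norm_dot_le S w; rewrite S1 mul1r in c1.
have c2 := norm_dot_le S z; rewrite S1 mul1r in c2.
have c3 := norm_dot_le w z; rewrite (dotC w S) -(sqr_enorm z).
have w0 := dot_ge0 w; have Z0 := enorm_ge0 z.
have a1 : - rho <= dot S w by move: c1; rewrite ler_norml => /andP[]; lra.
have c4 : `|dot w z| <= rho * enorm z by apply: le_trans c3 _; apply: ler_wpM2r.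
have c5 : `|dot S z * dot w z| <= rho * enorm z ^+ 2.
  rewrite normrM expr2 mulrA (mulrC (rho * _)); exact: ler_pM.
have c6 : dot w z ^+ 2 <= rho ^+ 2 * enorm z ^+ 2.
  rewrite -exprMn -[leLHS]real_normK ?num_real // ler_sqr ?nnegrE //.
  exact: mulr_ge0.
have := ler_norm (dot S z * dot w z).
have zz : 0 <= enorm z ^+ 2 by exact: sqr_ge0.
have r3 : rho ^+ 2 * enorm z ^+ 2 <= rho * enorm z ^+ 2.
  by apply: ler_wpM2r => //; rewrite expr2 ler_piMr //; lra.
have a2 : - rho * enorm z ^+ 2 <= dot S w * enorm z ^+ 2 by exact: ler_wpM2r.
have a3 : 0 <= dot w w * enorm z ^+ 2 by exact: mulr_ge0.
lra.
Qed.

(** [nrm_monotone] at two pushed points, which differ by [hump p q t *: (x - y)]. The Gram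
    determinant carries the hump squared and the inner product carries it once, so one factor
    cancels. *)
Lemma fam_monotone rho x y t : 0 <= rho -> rho <= 1 / 2 -> enorm x <= rho ->
  enorm y <= rho -> p <= t <= q ->
  8 / 81 * (hump p q t * (gram (T t) (x - y) - 5 * rho * dot (x - y) (x - y))) <=
  dot (fam x t - fam y t) (x - y).
Proof.
move=> r0 r2 xr yr tI; have x2 := le_trans xr r2; have y2 := le_trans yr r2.
have := nrm_monotone _ _ (pushed_range x t x2 tI) (pushed_range y t y2 tI).
have pE : pushed y t = pushed x t + (- hump p q t) *: (x - y).
  by rewrite /pushed; apply/rowP => i; rewrite !mxE; ring.
have dE : pushed x t - pushed y t = hump p q t *: (x - y).
  by rewrite /pushed; apply/rowP => i; rewrite !mxE; ring.
rewrite dE dotZr {1}pE gram_shear sqrrN -/(fam x t) -/(fam y t).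
have Hg := gram_pushed rho x (x - y) t r0 r2 xr tI.
have b0 := hump_ge0 p q t.
have [bz|bz] := eqVneq (hump p q t) 0.
  have -> : fam x t = fam y t by rewrite /fam /pushed bz !scale0r.
  by rewrite bz !(mul0r, mulr0) subrr dot0l.
have b1 : 0 < hump p q t by rewrite lt_neqAle eq_sym bz.
move: (gram (pushed x t) (x - y)) (gram (T t) (x - y)) Hg => P S Hg.
move: (dot (fam x t - fam y t) (x - y)) (dot (x - y) (x - y)) Hg => D Z Hg H.
apply: (@le_trans _ _ (8 / 81 * (hump p q t * P))).
  by rewrite ler_pM2l ?divr_gt0 // ler_pM2l.
by rewrite -(ler_pM2l b1); lra.
Qed.

End Family.

(** * Positivity of the integrated Gram determinant *)

Section GramIntegral.
Context {R : realType} {n : nat}.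

Lemma rint_ge_sub (p q s t k : R) (f : R -> R) : p <= s -> s <= t -> t <= q ->
  cont `[p, q] f -> (forall x, p <= x <= q -> 0 <= f x) ->
  (forall x, s <= x <= t -> k <= f x) -> k * (t - s) <= rint p q f.
Proof.
move=> ps st tq cf f0 fk; have sq := le_trans st tq; have pt := le_trans ps st.
have c1 := cont_sub_itv _ _ _ _ _ _ ps (lexx q) cf.
have c2 := cont_sub_itv _ _ _ _ _ _ (lexx s) tq c1.
have c3 := cont_sub_itv _ _ _ _ _ _ (lexx p) sq cf.
have c4 := cont_sub_itv _ _ _ _ _ _ pt (lexx q) cf.
rewrite (rint_chasles p q s) // (rint_chasles s q t) //.
have H1 : 0 <= rint p s f.
  by apply: rint_ge0 => // x /andP[x1 x2]; apply: f0; rewrite x1 (le_trans x2).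
have H2 : 0 <= rint t q f.
  by apply: rint_ge0 => // x /andP[x1 x2]; apply: f0; rewrite x2 (le_trans _ x1).
have H3 : k * (t - s) <= rint s t f by exact: rint_ge_cst.
lra.
Qed.

(** A fixed unit vector can be parallel to [z], but [T] turns at a definite rate: its values on two
    separated windows are neither almost equal nor almost opposite. By [gram_pair], every [z] is
    transverse to [T] throughout one of the two windows. *)
Lemma gram_integral (p q mu : R) (T T1 : R -> 'rV[R]_n) (a u : 'rV[R]_n) (v : R -> R) :
  p < q -> derives `[p, q] T T1 -> cont `[p, q] T1 ->
  (forall t, p <= t <= q -> enorm (T t) = 1) ->
  enorm u = 1 -> enorm a = 1 -> 0 < mu ->
  (forall t, p <= t <= q -> 2 * mu <= dot (T1 t) u) ->
  (forall t, p <= t <= q -> 1 / 2 <= dot (T t) a) ->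
  cont `[p, q] v -> (forall t, p <= t <= q -> 0 < v t) ->
  exists2 c, 0 < c & forall z,
    c * dot z z <= rint p q (fun t => v t * (hump p q t * gram (T t) z)).
Proof.
move=> pq HT cT1 T1u uu aa mu0 Hmu Ha cv vpos.
have [v0 v00 Hv] := cont_lower p q v (ltW pq) cv vpos.
have cT := derives_cont _ _ _ _ HT.
(* [s0] and [s1] are the ends of the middle quarter, where [hump_middle] applies, and [r] is a third
   of its length: windows of length [r] at its two ends are [r] apart. *)
pose r := (q - p) / 12; have r0 : 0 < r by rewrite divr_gt0 // subr_gt0.
pose s0 := (5 * p + 3 * q) / 8; pose s1 := (3 * p + 5 * q) / 8.
pose d := 2 * mu * r; have d0 : 0 < d by apply: mulr_gt0 => //; exact: mulr_gt0.
(* Unit vectors at distance at least [d] have inner product at most [1 - d ^+ 2 / 2]; those whose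
   sum has norm at least 1 have inner product at least [- 1 / 2]. *)
pose eta := Num.min (d ^+ 2 / 2) (1 / 2).
have eta0 : 0 < eta by rewrite lt_min !divr_gt0 // exprn_gt0.
have eta1 : eta <= d ^+ 2 / 2 by rewrite ge_min lexx.
have eta2 : eta <= 1 / 2 by rewrite ge_min lexx orbT.
have pair s s' z : s0 <= s <= s0 + r -> s1 - r <= s' <= s1 ->
    eta * dot z z <= gram (T s) z + gram (T s') z.
  move=> /andP[sa sb] /andP[s'a s'b].
  have ps : p <= s by move: sa; rewrite /s0; lra.
  have s'q : s' <= q by move: s'b; rewrite /s1; lra.
  have rs : s + r <= s' by move: sb s'a; rewrite /s0 /s1 /r; lra.
  have ss' : s <= s' by lra.
  have sI : p <= s <= q by rewrite ps (le_trans ss').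
  have s'I : p <= s' <= q by rewrite s'q (le_trans ps).
  have Hd : derives `[p, q] (fun t => dot (T t) u) (fun t => dot (T1 t) u).
    by move=> t tI; apply: isder_dotr; exact: HT.
  have cd : cont `[s, s'] (fun t => dot (T1 t) u).
    by apply: cont_sub_itv ps s'q _; exact: cont_dotr.
  have I1 := rint_sub p q s s' _ _ ps ss' s'q Hd.
  have I2 : 2 * mu * (s' - s) <= rint s s' (fun t => dot (T1 t) u).
    apply: rint_ge_cst => // t /andP[t1 t2]; apply: Hmu.
    by rewrite (le_trans ps t1) (le_trans t2).
  have I3 : d <= dot (T s' - T s) u.
    rewrite dotDl dotNl -I1; apply: le_trans I2; rewrite /d ler_pM2l ?mulr_gt0 //; lra.
  have I4 : d <= enorm (T s' - T s).
    by apply: le_trans I3 _; apply: le_trans (cauchy_schwarz _ _) _; rewrite uu mulr1.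
  have I5 : d ^+ 2 <= dot (T s' - T s) (T s' - T s).
    by rewrite -sqr_enorm ler_sqr ?nnegrE ?enorm_ge0 // ltW.
  have I6 : 1 <= enorm (T s' + T s).
    apply: (@le_trans _ _ (dot (T s' + T s) a)).
      by rewrite dotDl; have := Ha s sI; have := Ha s' s'I; lra.
    by apply: le_trans (cauchy_schwarz _ _) _; rewrite aa mulr1.
  have I7 : 1 <= dot (T s' + T s) (T s' + T s).
    by rewrite -sqr_enorm -[X in X <= _](expr1n _ 2) ler_sqr ?nnegrE ?enorm_ge0.
  apply: gram_pair; rewrite ?T1u //.
  move: I5 I7; rewrite !dotE -!sqr_enorm !T1u // expr1n (dotC (T s') (T s)) ler_norml.
  by move=> I5 I7; apply/andP; split; lra.
have k0 : 0 < v0 * (expR (-2) * (eta / 2)).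
  by apply: mulr_gt0 => //; apply: mulr_gt0; [exact: expR_gt0|exact: divr_gt0].
exists (v0 * (expR (-2) * (eta / 2)) * r); first by rewrite mulr_gt0.
move=> z; set f := (fun t => _).
have cf : cont `[p, q] f.
  apply: (CKM _ 0) => //; apply: (CKM _ 0).
    exact: CK_sub (@subsetT _ _) (hump_CK 0 p q).
  apply: (CKB _ _ 0); apply: (CKM _ 0);
    by do ?[exact: (CK_cst _ _ 0)|exact: (CK_dot _ 0)|exact: cont_dotr].
have f0 t : p <= t <= q -> 0 <= f t.
  move=> tI; rewrite mulr_ge0 ?mulr_ge0 ?hump_ge0 ?gram_ge0 //.
  by rewrite ltW // vpos.
have fk t : s0 <= t <= s1 -> eta / 2 * dot z z <= gram (T t) z ->
    v0 * (expR (-2) * (eta / 2)) * dot z z <= f t.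
  move=> tI Hg; have tpq : p <= t <= q.
    by case/andP: tI; rewrite /s0 /s1 => t1 t2; apply/andP; split; lra.
  have e20 : 0 <= eta / 2 * dot z z.
    by apply: mulr_ge0; [apply: divr_ge0 => //; exact: ltW|exact: dot_ge0].
  have -> : v0 * (expR (-2) * (eta / 2)) * dot z z = v0 * (expR (-2) * (eta / 2 * dot z z)).
    by rewrite !mulrA.
  apply: ler_pM; [exact: ltW| |exact: Hv|].
    by apply: mulr_ge0 e20; exact: expR_ge0.
  apply: ler_pM e20 _ Hg; [exact: expR_ge0|exact: hump_middle].
(* Either the whole left window is good for [z], or some point [s] of it is bad, and then [pair]
   makes every point of the right window good. *)
have [H|] := pselect (forall t, s0 <= t <= s0 + r -> eta / 2 * dot z z <= gram (T t) z).
  rewrite mulrAC -[X in _ * X <= _](addKr s0) addrC (addrC s0).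
  apply: rint_ge_sub => //.
  - by rewrite /s0; lra.
  - by rewrite lerDr ltW.
  - by rewrite /s0 /r; lra.
  - move=> t tI; apply: fk; last by apply: H; rewrite (addrC s0).
    by move: tI; rewrite /s0 /s1 /r => /andP[t1 t2]; apply/andP; split; lra.
move=> /existsNP[s /not_implyP[sI /negP]]; rewrite -ltNge => Hs.
rewrite mulrAC -[X in _ * X <= _](subKr s1).
apply: rint_ge_sub => //.
- by rewrite /s1 /r; lra.
- by rewrite gerBl ltW.
- by rewrite /s1; lra.
- move=> t tI; apply: fk; last by have := pair s t z sI tI; lra.
  by move: tI; rewrite /s0 /s1 /r => /andP[t1 t2]; apply/andP; split; lra.
Qed.

End GramIntegral.

Lemma exists_div_le {R : realType} (C d : R) : 0 < C -> 0 < d ->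
  exists M : nat, C / M.+1%:R <= d.
Proof.
move=> C0 d0; exists (Num.truncn (C / d)).
rewrite ler_pdivrMr ?ltr0n // mulrC -ler_pdivrMr // ltW //.
by have /andP[] := truncn_itv (divr_ge0 (ltW C0) (ltW d0)).
Qed.

(** Half of [cJ] is spent on the error [5 * rho] of [gram_pushed], and half of what remains on the
    perturbation by the corrugation. *)
Lemma monotone_arith {R : realType} (cJ rho V l d zz I J : R) : 0 <= zz ->
  5 * rho * V * l <= cJ / 2 -> V * d * l <= 4 * cJ / 81 / 2 -> cJ * zz <= I ->
  8 / 81 * I - (8 / 81 * (5 * rho * V) + V * d) * zz * l <= J ->
  4 * cJ / 81 / 2 * zz <= J.
Proof.
move=> z0 H1 H2 HI HJ.
have := ler_wpM2r z0 H1; have := ler_wpM2r z0 H2; lra.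
Qed.

(** The same budget under the integral sign: [w] is the weight [v t], [b] the hump, [g] the Gram
    determinant, [A] the contribution of [fam] and [B] that of the corrugation. *)
Lemma pointwise_arith {R : realType} (rho d V w b g Z A B : R) :
  0 <= rho -> 0 <= d -> 0 <= b -> b <= 1 -> 0 < w -> w <= V -> 0 <= Z ->
  8 / 81 * (b * (g - 5 * rho * Z)) <= A -> - (d * Z) <= B ->
  8 / 81 * (w * (b * g)) - (8 / 81 * (5 * rho * V) + V * d) * Z <= w * (A + B).
Proof.
move=> r0 d0 b0 b1 w0 wV Z0 HA HB.
have wb : w * b <= V by rewrite -[leRHS]mulr1; apply: ler_pM => //; exact: ltW.
have rZ : 0 <= 5 * rho * Z by rewrite !mulr_ge0.
have := ler_wpM2r rZ wb; have := ler_wpM2r (mulr_ge0 d0 Z0) wV.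
have := ler_wpM2l (ltW w0) HA; have := ler_wpM2l (ltW w0) HB; lra.
Qed.

Lemma enorm_sub_eq0 {R : realType} {n : nat} (A B F : 'rV[R]_n) :
  enorm (A - F - (B - F)) <= 0 -> A = B.
Proof.
rewrite opprB addrA subrK => H; apply/eqP; rewrite -subr_eq0; apply/eqP/enorm_eq0.
by apply/le_anti; rewrite H enorm_ge0.
Qed.

(* [S] has the length of [sig] over [p, q], and turned into a curve of speed
   [sig] it stays close to [T] and has the same integral against [v]. *)
Definition corrects {R : realType} {n : nat} (p q eps : R) (T : R -> 'rV[R]_n)
    (sig v : R -> R) (S S' : R -> 'rV[R]_n) :=
  [/\ derives `[p, q] S S',
      forall t, p <= t <= q -> 0 < enorm (S' t),
      rint p q (fun t => enorm (S' t)) = rint p q sig &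
      forall phi, reparam p q (fun t => enorm (S' t)) sig phi ->
        (forall t, p <= t <= q -> enorm (S (phi t) - T t) <= eps) /\
        vint p q (fun t => v t *: S (phi t)) = vint p q (fun t => v t *: T t)].

Lemma corrects_ext {R : realType} {n : nat} (p q eps : R) (T : R -> 'rV[R]_n)
    (sig v : R -> R) (S1 S2 S' : R -> 'rV[R]_n) :
  (forall t, p <= t <= q -> S1 t = S2 t) ->
  corrects p q eps T sig v S1 S' -> corrects p q eps T sig v S2 S'.
Proof.
move=> E [H1 H2 H3 H4]; split; [|exact: H2|exact: H3|].
  by apply: derives_ext H1 => // t /=; rewrite in_itv /=; exact: E.
move=> phi Hphi; have [K1 K2] := H4 phi Hphi; split => [t tI|].
  by rewrite -E; [exact: K1|have [] := Hphi t tI].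
by rewrite -K2; apply: vint_congr => t tI; rewrite E //; have [] := Hphi t tI.
Qed.

(** * Correction over one short segment *)

Section Segment.
Context {R : realType} {n : nat}.
Variables (p q mu eps : R) (T T1 : R -> 'rV[R]_n) (a e u : 'rV[R]_n) (sig v : R -> R).
Hypotheses (pq : p < q) (HT : derives `[p, q] T T1) (cT1 : cont `[p, q] T1).
Hypothesis (T1u : forall t, p <= t <= q -> enorm (T t) = 1).
Hypotheses (aa : dot a a = 1) (ee : dot e e = 1) (ae : dot a e = 0).
Hypotheses (au : dot a u = 0) (eu : dot e u = 0) (uu : enorm u = 1).
Hypotheses (mu0 : 0 < mu) (eps0 : 0 < eps).
Hypothesis (Hmu : forall t, p <= t <= q -> 2 * mu <= dot (T1 t) u).
Hypothesis (Ha : forall t, p <= t <= q -> 1 / 2 <= dot (T t) a).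
Hypotheses (cs : cont `[p, q] sig) (Hs : forall t, p <= t <= q -> enorm (T1 t) < sig t).
Hypotheses (cv : cont `[p, q] v) (Hv : forall t, p <= t <= q -> 0 < v t).

(** At [x = 0] the family is [T], and the bounds hold with margins [m2], [2 * mu] and [1 / 2]; the
    radius is chosen so small that half of each margin survives. *)
Lemma family_bounds : exists C m rho0 : R, [/\ 0 < C, 0 < m, 0 < rho0, rho0 <= 1 / 8 &
  [/\ forall x y t, enorm x <= rho0 -> enorm y <= rho0 -> p <= t <= q ->
        enorm (fam p q T x t - fam p q T y t) <= C * enorm (x - y),
      forall x y t, enorm x <= rho0 -> enorm y <= rho0 -> p <= t <= q ->
        enorm (fam' p q T T1 x t - fam' p q T T1 y t) <= C * enorm (x - y),
      forall x t, enorm x <= rho0 -> p <= t <= q ->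
        enorm (fam' p q T T1 x t) <= sig t - m &
      [/\ forall t, p <= t <= q -> sig t <= C,
          forall x t, enorm x <= rho0 -> p <= t <= q -> mu <= dot (fam' p q T T1 x t) u &
          forall x t, enorm x <= rho0 -> p <= t <= q -> 1 / 4 <= dot (fam p q T x t) a]]].
Proof.
have [m2 m20 Hm2] : exists2 m, 0 < m & forall t, p <= t <= q -> m <= sig t - enorm (T1 t).
  apply: cont_lower; first exact: ltW.
    by apply: (CKB _ _ 0) => //; exact: cont_enorm.
  by move=> t /Hs; rewrite subr_gt0.
have [Cs Cs0 HCs] := cont_bounded p q sig (ltW pq) cs.
have [CF CF2 HCF] := fam'_lip p q T T1 pq cT1 T1u.
have CF0 : 0 < CF by lra.
pose rho := Num.min (1 / 8) (Num.min (m2 / 2 / CF) (mu / CF)).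
have rho0 : 0 < rho by rewrite !lt_min !divr_gt0.
have r1 : rho <= 1 / 8 by rewrite /rho ge_min lexx.
have r2 : CF * rho <= m2 / 2.
  by rewrite mulrC -ler_pdivlMr // /rho !ge_min lexx orbT.
have r3 : CF * rho <= mu.
  by rewrite mulrC -ler_pdivlMr // /rho !ge_min lexx !orbT.
have half (x : 'rV[R]_n) : enorm x <= rho -> enorm x <= 1 / 2 by move=> H; lra.
have zero : enorm (0 : 'rV[R]_n) <= 1 / 2 by rewrite enorm0.
have close' x t : enorm x <= rho -> p <= t <= q ->
    enorm (fam' p q T T1 x t - T1 t) <= CF * rho.
  move=> xr tI; have := HCF x 0 t (half _ xr) zero tI.
  rewrite (fam'0 p q T T1 pq HT T1u t tI) subr0 => /le_trans; apply.
  by rewrite ler_pM2l.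
exists (CF + Cs), (m2 / 2), rho; split => //; first exact: addr_gt0.
  by rewrite divr_gt0.
split.
- move=> x y t xr yr tI.
  apply: le_trans (fam_lip p q T T1u x y t (half _ xr) (half _ yr) tI) _.
  by apply: ler_wpM2r; [exact: enorm_ge0|lra].
- move=> x y t xr yr tI; apply: le_trans (HCF x y t (half _ xr) (half _ yr) tI) _.
  by apply: ler_wpM2r; [exact: enorm_ge0|lra].
- move=> x t xr tI; have := enorm_le_dist (fam' p q T T1 x t) (T1 t).
  by have := close' x t xr tI; have := Hm2 t tI; lra.
- split.
  + by move=> t /HCs; lra.
  + move=> x t xr tI; have := norm_dot_le (fam' p q T T1 x t - T1 t) u.
    rewrite uu mulr1 ler_norml dotDl dotNl => /andP[H _].
    by have := close' x t xr tI; have := Hmu t tI; lra.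
  + move=> x t xr tI; have := norm_dot_le (fam p q T x t - T t) a.
    have -> : enorm a = 1 by rewrite enormE aa sqrtr1.
    rewrite mulr1 ler_norml dotDl dotNl => /andP[H _].
    have := fam_lip p q T T1u x 0 t (half _ xr) zero tI.
    by rewrite (fam0 p q T T1u t tI) subr0; have := Ha t tI; lra.
Qed.

Theorem corrugate_segment : exists (x : 'rV[R]_n) (h : R -> R) (Ts' : R -> 'rV[R]_n),
  [/\ enorm x <= 1 / 2, forall k, CK setT k h,
      exists c d, [/\ p < c, d < q & supp_in c d h] &
      corrects p q eps T sig v (fun t => turn a e (h t) (nrm (T t + hump p q t *: x))) Ts'].
Proof.
have [C [m [rho1 [C0 m0 rho10 rho18 [HL HL' Hgap [HsC Hmu' Ha']]]]]] := family_bounds.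
have [V V0 HV] := cont_bounded p q v (ltW pq) cv.
have ea : enorm a = 1 by rewrite enormE aa sqrtr1.
have [cJ cJ0 HcJ] := gram_integral p q mu T T1 a u v pq HT cT1 T1u uu ea mu0 Hmu Ha cv Hv.
pose l := q - p; have l0 : 0 < l by rewrite subr_gt0.
have Vl0 : 0 < V * l by rewrite mulr_gt0.
pose c0 := 4 * cJ / 81; have c00 : 0 < c0 by rewrite divr_gt0 // mulr_gt0.
(* In turn: the bounds of the family, a distance at most [eps / 2] between [fam x] and [T], and the
   first half of the budget of [monotone_arith]. *)
pose rho := Num.min rho1 (Num.min (eps / 4) (cJ / 2 / (5 * (V * l)))).
have rho0 : 0 < rho by rewrite !lt_min rho10 !divr_gt0 // mulr_gt0.
have r1 : rho <= rho1 by rewrite /rho ge_min lexx.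
have r2 : rho <= eps / 4 by rewrite /rho !ge_min lexx orbT.
have r3 : 5 * rho * V * l <= cJ / 2.
  have -> : 5 * rho * V * l = rho * (5 * (V * l)) by ring.
  by rewrite -ler_pdivlMr ?mulr_gt0 // /rho !ge_min lexx !orbT.
pose ok (x : 'rV[R]_n) := enorm x <= rho.
have ok1 x : ok x -> enorm x <= rho1 by move=> H; exact: le_trans r1.
have ok2 x : ok x -> enorm x <= 1 / 2 by move=> /ok1; lra.
have Hsub t : p <= t <= q -> sig t - m <= C by move=> /HsC; lra.
have [C7 C70 HM] := corrugation p q a e u pq aa ee ae au eu uu
  (fam p q T) (fam' p q T T1) ok sig C m mu C0 m0 mu0
  (fun x xo => fam_derives p q T T1 HT T1u x (ok2 x xo))
  (fun x xo => fam'_cont p q T T1 HT cT1 T1u x (ok2 x xo))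
  (fun x t xo tI => enorm_fam p q T T1u x t (ok2 x xo) tI)
  (fun x y t xo yo tI => HL x y t (ok1 x xo) (ok1 y yo) tI)
  (fun x y t xo yo tI => HL' x y t (ok1 x xo) (ok1 y yo) tI)
  (fun x t xo tI => le_trans (Hgap x t (ok1 x xo) tI) (Hsub t tI))
  (fun x t xo tI => Hgap x t (ok1 x xo) tI) cs HsC
  (fun x t xo tI => Hmu' x t (ok1 x xo) tI)
  (fun x t xo tI => Ha' x t (ok1 x xo) tI).
(* The four bounds on the corrugation error serve the remaining half of [eps], the Lipschitz
   constant of [G], its strong monotonicity with constant [c0 / 2], and the smallness of [G 0]
   required by [monotone_zero]. *)
pose d0 := Num.min (eps / 2) (Num.min 1 (Num.min (c0 / 2 / (V * l)) (c0 / 2 * rho / 4 / (V * l)))).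
have d00 : 0 < d0 by rewrite !lt_min ltr01 !divr_gt0 // mulr_gt0 // divr_gt0.
have d1 : d0 <= eps / 2 by rewrite /d0 !ge_min lexx.
have d2 : d0 <= 1 by rewrite /d0 !ge_min lexx orbT.
have d3 : V * d0 * l <= c0 / 2.
  have -> : V * d0 * l = d0 * (V * l) by ring.
  by rewrite -ler_pdivlMr // /d0 !ge_min lexx !orbT.
have d4 : V * d0 * l <= c0 / 2 * rho / 4.
  have -> : V * d0 * l = d0 * (V * l) by ring.
  by rewrite -ler_pdivlMr // /d0 !ge_min lexx !orbT.
have [M HMd] := exists_div_le C7 d0 C70 d00.
have [h [h' /= [Ch Sh Hh Hlen Hclose]]] := HM M.
clear HM HL HL' Hmu' Ha'.
pose g x t := enorm (fam' p q T T1 x t + h' x t *: turnK a e (fam p q T x t)).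
have sg t : p <= t <= q -> 0 <= sig t by move=> /Hs /ltW; apply: le_trans; exact: enorm_ge0.
have /choice[phi Hphi] : forall x, exists f : R -> R, ok x -> reparam p q (g x) sig f.
  move=> x; have [xo|xo] := pselect (ok x); last by exists id.
  have [cg gmu gl] := Hlen x xo.
  have [f Hf] := reparam_exists p q mu (g x) sig (ltW pq) mu0 cg cs gmu sg gl.
  by exists f.
pose Ts x t := turn a e (h x t) (fam p q T x t).
have cfam x : ok x -> cont `[p, q] (fam p q T x).
  by move=> xo; exact: derives_cont (fam_derives p q T T1 HT T1u x (ok2 x xo)).
have cTs x : ok x -> cont `[p, q] (Ts x).
  move=> xo; apply: (CK_turn _ _ _ 0); last exact: cfam.
  exact: CK_sub (@subsetT _ _) (Ch x 0%N).
have cTp x : ok x -> cont `[p, q] (fun t => Ts x (phi x t)).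
  move=> xo; have [cg gmu gl] := Hlen x xo.
  apply: (cont_comp _ _ `[p, q]) (cTs x xo).
    by move=> s /=; rewrite !in_itv /= => /(Hphi x xo)[].
  exact: (reparam_cont p q mu (g x) sig (phi x) (ltW pq) mu0 cg cs gmu (Hphi x xo)).
have cT := derives_cont _ _ _ _ HT.
pose W x t := v t *: (Ts x (phi x t) - T t).
have cW x : ok x -> cont `[p, q] (W x).
  by move=> xo; apply: (CKZ _ _ 0) => //; apply: (CKB _ _ 0) => //; exact: cTp.
pose G x := vint p q (W x).
have ok0 : ok 0 by rewrite /ok enorm0 ltW.
have E1 x t : ok x -> p <= t <= q -> enorm (Ts x (phi x t) - fam p q T x t) <= d0.
  move=> xo tI; have [H _] := Hclose x x (phi x) (phi x) t xo xo (Hphi x xo) (Hphi x xo) tI.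
  exact: le_trans HMd.
have E2 x y t : ok x -> ok y -> p <= t <= q ->
    enorm (Ts x (phi x t) - fam p q T x t - (Ts y (phi y t) - fam p q T y t)) <=
    d0 * enorm (x - y).
  move=> xo yo tI; have [_ H] := Hclose x y (phi x) (phi y) t xo yo (Hphi x xo) (Hphi y yo) tI.
  by apply: le_trans H _; apply: ler_wpM2r => //; exact: enorm_ge0.
have GB x y : ok x -> ok y -> G x - G y = vint p q (fun t => W x t - W y t).
  by move=> xo yo; rewrite vintB //; [exact: ltW|exact: cW|exact: cW].
have cWB x y : ok x -> ok y -> cont `[p, q] (fun t => W x t - W y t).
  by move=> xo yo; apply: (CKB _ _ 0); exact: cW.
have WB x y t : W x t - W y t = v t *: ((fam p q T x t - fam p q T y t) +
    (Ts x (phi x t) - fam p q T x t - (Ts y (phi y t) - fam p q T y t))).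
  rewrite /W; move: (Ts x _) (Ts y _) (fam p q T x t) (fam p q T y t) => A B E F.
  by apply/rowP => i; rewrite !mxE; ring.
have [x xr Gx] : exists2 x, enorm x <= rho & G x = 0.
  apply: (monotone_zero G rho (c0 / 2) (V * 3 * l)) => //.
  - by rewrite divr_gt0.
  - by rewrite mulr_gt0 // mulr_gt0.
  - move=> x y xo yo; rewrite GB // dot_vint; [|exact: ltW|exact: cWB].
    set z := x - y; rewrite sqr_enorm.
    apply: (monotone_arith cJ rho V l d0 (dot z z) _ _ (dot_ge0 z) r3 d3 (HcJ z)).
    set K := (_ + V * d0) * dot z z.
    have chg : cont `[p, q] (fun t => v t * (hump p q t * gram (T t) z)).
      apply: (CKM _ 0) => //; apply: (CKM _ 0).
        exact: CK_sub (@subsetT _ _) (hump_CK 0 p q).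
      apply: (CKB _ _ 0); apply: (CKM _ 0);
        by do ?[exact: (CK_cst _ _ 0)|exact: (CK_dot _ 0)|exact: cont_dotr].
    have chg' : cont `[p, q] (fun t => 8 / 81 * (v t * (hump p q t * gram (T t) z))).
      by apply: (CKM _ 0) => //; exact: (CK_cst _ _ 0).
    rewrite -rintZ ?(ltW pq) // -rint_cst ?(ltW pq) // -rintB ?(ltW pq) //;
      last exact: (CK_cst _ _ 0).
    apply: rint_le; [exact: ltW|apply: (CKB _ _ 0) => //; exact: (CK_cst _ _ 0)| |].
      by apply: cont_dotr; exact: cWB.
    move=> t tI; rewrite WB dotZl dotDl.
    have x2 : rho <= 1 / 2 by lra.
    have F1 := fam_monotone p q T T1u rho x y t (ltW rho0) x2 xo yo tI.
    have F2 := norm_dot_le (Ts x (phi x t) - fam p q T x t - (Ts y (phi y t) - fam p q T y t)) z.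
    have F3 := E2 x y t xo yo tI.
    rewrite -/z in F1 F3.
    apply: pointwise_arith (F1) _ => //; rewrite ?(ltW rho0) ?(ltW d00) ?hump_ge0
      ?hump_le1 ?Hv ?HV ?dot_ge0 //.
    move: F2; rewrite ler_norml => /andP[F2 _].
    apply: le_trans F2; rewrite lerN2 -(sqr_enorm z) expr2 mulrA.
    by apply: ler_wpM2r => //; exact: enorm_ge0.
  - move=> x y xo yo; rewrite GB //.
    have -> : V * 3 * l * enorm (x - y) = V * (3 * enorm (x - y)) * l by ring.
    apply: enorm_vint_le; [exact: ltW|exact: cWB|].
    move=> t tI; rewrite WB enormZ gtr0_norm ?Hv //.
    apply: ler_pM; [by rewrite ltW ?Hv|exact: enorm_ge0|exact: HV|].
    apply: le_trans (enormD _ _) _.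
    have := fam_lip p q T T1u x y t (ok2 x xo) (ok2 y yo) tI.
    have := E2 x y t xo yo tI.
    have := ler_wpM2r (enorm_ge0 (x - y)) d2; lra.
  - apply: le_trans d4; apply: enorm_vint_le; [exact: ltW|exact: cW|].
    move=> t tI; rewrite /W enormZ gtr0_norm ?Hv //.
    apply: ler_pM; [by rewrite ltW ?Hv|exact: enorm_ge0|exact: HV|].
    by rewrite -(fam0 p q T T1u t tI); exact: E1.
exists x, (h x), (fun t => turn a e (h x t)
  (fam' p q T T1 x t + h' x t *: turnK a e (fam p q T x t))) => /=.
have sE : (fun t => enorm (turn a e (h x t)
    (fam' p q T T1 x t + h' x t *: turnK a e (fam p q T x t)))) = g x.
  by apply/funext => t; rewrite enorm_turn.
have [cg gmu gl] := Hlen x xr.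
split; [exact: ok2|exact: Ch|exact: Sh|]; rewrite /corrects sE; split.
- move=> t tI; apply: isder_turn => //.
    exact: isder_sub (@subsetT _ _) ((Hh x).1 t I).
  exact: (fam_derives p q T T1 HT T1u x (ok2 x xr)).
- by move=> t tI; rewrite enorm_turn //; exact: lt_le_trans (gmu t tI).
- exact: gl.
- move=> f Hf.
  (* The Lipschitz clause of the corrugation at [x = y] identifies the curves given by [f] and by
     the chosen [phi x]. *)
  have fE t : p <= t <= q -> Ts x (f t) = Ts x (phi x t).
    move=> tI; have [_ H] := Hclose x x f (phi x) t xr xr Hf (Hphi x xr) tI.
    rewrite (subrr x) enorm0 mulr0 in H; exact: enorm_sub_eq0 H.
  split.
    move=> t tI; rewrite -/(Ts x (f t)) fE //.
    have := E1 x t xr tI; have := enorm_dist (Ts x (phi x t)) (fam p q T x t) (T t).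
    have := fam_lip p q T T1u x 0 t (ok2 x xr) (ok2 0 ok0) tI.
    rewrite (fam0 p q T T1u t tI) subr0; lra.
  have cvT : cont `[p, q] (fun t => v t *: T t) by apply: (CKZ _ _ 0).
  have cvTs : cont `[p, q] (fun t => v t *: Ts x (phi x t)).
    by apply: (CKZ _ _ 0); [exact: cv|exact: cTp].
  have pq' := ltW pq.
  have e1 : vint p q (fun t => v t *: Ts x (phi x t)) = vint p q (fun t => v t *: Ts x (f t)).
    by apply: vint_congr => t tI; rewrite (fE t tI).
  have e2 : vint p q (fun t => v t *: Ts x (phi x t)) - vint p q (fun t => v t *: T t) = 0.
    rewrite -(vintB p q _ _ pq' cvTs cvT) -Gx; congr vint; apply/funext => t.
    by rewrite /W scalerBr.
  apply: etrans (esym e1) _; exact: subr0_eq e2.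
Qed.

End Segment.

(** * From segments to the whole domain *)

Section Partition.
Context {R : realType}.
Variable Ok : R -> R -> Prop.

Definition finer (s t : R) : bool := `[< s < t /\ Ok s t >].

(** Compactness by a supremum: the ends reachable from [p] by admissible steps have a supremum [c].
    A reachable point just below [c] can step beyond [c], unless [c = q], which is then reached. *)
Lemma fine_path p q : p < q ->
  (forall t, p <= t <= q -> exists2 d, 0 < d &
    forall s s', p <= s -> s' <= q -> t - d < s -> s' < t + d -> Ok s s') ->
  exists2 l, path finer p l & last p l = q.
Proof.
move=> pq Hloc.
pose A := [set t | p <= t <= q /\ exists2 l, path finer p l & last p l = t].
have Ap : A p by split; [rewrite lexx ltW|exists [::]].
have hsA : has_sup A by split; [exists p|exists q => t [/andP[]]].
pose c := sup A.
have pc : p <= c by apply: ub_le_sup Ap; case: hsA.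
have cq : c <= q by apply: ge_sup; [exists p|move=> t [/andP[]]].
have [|d d0 Hd] := Hloc c; first by rewrite pc.
have [t [/andP[pt tq] [l Hl Hlast]] ct] := sup_adherent d0 hsA.
have tc : t <= c by apply: ub_le_sup; [case: hsA|split; [rewrite pt|exists l]].
have ext s : t < s -> s <= q -> s < c + d -> A s.
  move=> ts sq sc; split; first by rewrite sq andbT (le_trans pt) // ltW.
  exists (rcons l s); last by rewrite last_rcons.
  rewrite rcons_path Hl Hlast /=; apply/asboolP; split => //; exact: Hd.
have [cltq|qlec] := ltP c q.
  pose s := Num.min q (c + d / 2).
  have cs : c < s by rewrite lt_min cltq ltrDl divr_gt0.
  have /(ub_le_sup (proj2 hsA)) : A s.
    apply: ext; first exact: le_lt_trans cs.
      by rewrite ge_min lexx.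
    by rewrite gt_min ltrD2l ltr_pdivrMr // ltr_pMr // ltr1n orbT.
  by rewrite leNgt cs.
have cE : c = q by apply/le_anti; rewrite cq.
have [tltq|qlet] := ltP t q; last first.
  by exists l => //; rewrite Hlast; apply/le_anti; rewrite tq.
by have [|_ [l' ? ?]] := ext q tltq (lexx q); [rewrite cE ltrDl|exists l'].
Qed.

(** Induction on the prescribed points: an interior one splits the segment, and the two paths are
    concatenated. *)
Lemma fine_path_through p q (ps : seq R) : p < q ->
  (forall t, p <= t <= q -> exists2 d, 0 < d &
    forall s s', p <= s -> s' <= q -> t - d < s -> s' < t + d -> Ok s s') ->
  exists l, [/\ path finer p l, last p l = q &
    forall r, r \in ps -> p <= r <= q -> r \in p :: l].
Proof.
elim: ps p q => [|r ps IH] p q pq Hloc.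
  by have [l ? ?] := fine_path p q pq Hloc; exists l.
have [/andP[pr rq]|out] := boolP (p < r < q); last first.
  have [l [H1 H2 H3]] := IH p q pq Hloc; exists l; split => // r'.
  rewrite inE => /predU1P[->|]; last exact: H3.
  move=> /andP[pr rq]; move: out; rewrite negb_and -!leNgt => /orP[rp|qr].
    by have -> : r = p by [apply/le_anti; rewrite rp]; rewrite mem_head.
  have -> : r = q by apply/le_anti; rewrite rq.
  by rewrite -H2 mem_last.
have [t tI|l1 [P1 L1 Q1]] := IH p r pr.
  have [|d d0 Hd] := Hloc t; first by case/andP: tI => -> /= /le_trans; apply; exact: ltW.
  by exists d => // s s' ps_ s'r; apply: Hd => //; apply: le_trans s'r (ltW rq).
have [t tI|l2 [P2 L2 Q2]] := IH r q rq.
  have [|d d0 Hd] := Hloc t.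
    by case/andP: tI => rt ->; rewrite andbT (le_trans (ltW pr)).
  by exists d => // s s' rs; apply: Hd => //; apply: le_trans (ltW pr) rs.
exists (l1 ++ l2); split.
- by rewrite cat_path P1 L1.
- by rewrite last_cat L1.
- move=> r'; rewrite inE => /predU1P[-> _|r'ps /andP[pr' r'q]].
    by rewrite -cat_cons mem_cat -L1 mem_last.
  rewrite -cat_cons mem_cat; have [r'r|rr'] := leP r' r.
    by rewrite Q1 // pr' r'r.
  have := Q2 r' r'ps; rewrite (ltW rr') r'q inE => /(_ isT) /predU1P[E|->]; last by rewrite orbT.
  by rewrite E ltxx in rr'.
Qed.

End Partition.

(** The matrix with columns [a] and [u] has rank at most 2, less than [n], so its left kernel
    contains a nonzero vector, which is then normalized. *)
Lemma orthonormal_complement {R : realType} {n : nat} (a u : 'rV[R]_n) : (3 <= n)%N ->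
  exists e, [/\ dot e e = 1, dot a e = 0 & dot e u = 0].
Proof.
move=> n3; pose A : 'M[R]_(n, 1 + 1) := row_mx a^T u^T.
have /rowV0Pn[w wA w0] : kermx A != 0.
  rewrite kermx_eq0; apply/negP => /eqP rA.
  by have := rank_leq_col A; rewrite rA leqNgt n3.
have wz : w *m A = 0 by apply/eqP; rewrite -sub_kermx.
have dE (z : 'rV[R]_n) : (w *m z^T) 0 0 = dot w z.
  by rewrite mxE; apply: eq_bigr => i _; rewrite mxE.
have [wa wu] : dot w a = 0 /\ dot w u = 0.
  move: wz; rewrite mul_mx_row -(row_mx0 _ 1 1) => /eq_row_mx[Ha Hu].
  by rewrite -!dE Ha Hu mxE.
exists (nrm w); split.
- by rewrite -sqr_enorm enorm_nrm // expr1n.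
- by rewrite /nrm dotZr dotC wa mulr0.
- by rewrite /nrm dotZl wu mulr0.
Qed.

Lemma map_on_op2 {R : realType} {G : domain R} {A B C : Type} (op : A -> B -> C) {g h} :
  map_on G g -> map_on G h -> map_on G (fun t => op (g t) (h t)).
Proof. by rewrite /map_on; case: (dom_kind G) => // H1 H2 t; rewrite H1 H2. Qed.

(** * Periodic maps, their representatives and their primitives *)

Section PeriodicFunctions.
Context {R : realType}.
Variable G : domain R.
Local Notation a := (dom_a G).
Local Notation b := (dom_b G).

Lemma periodicz (T : Type) (g : R -> T) l (k : int) t :
  (forall s, g (s + l) = g s) -> g (t - l * k%:~R) = g t.
Proof.
move=> H; have Hn (m : nat) s : g (s + l * m%:R) = g s.
  by elim: m s => [|m IH] s; [rewrite mulr0 addr0|rewrite -natr1 mulrDr mulr1 addrA H].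
case: k => m; first by rewrite -(Hn m (t - _)) -pmulrn subrK.
by rewrite NegzE mulrNz mulrN opprK Hn.
Qed.

(* The representative in [a, b] of a point of the domain. *)
Definition frep (t : R) : R := if dom_kind G is Circle then per a b t else t.

Lemma frepP t : points G t -> a <= frep t <= b.
Proof.
rewrite /points /frep; case: (dom_kind G); first by rewrite /= in_itv.
by move=> _; have /andP[-> /ltW ->] := per_itv a b (dom_lt G) t.
Qed.

Lemma map_on_frep (T : Type) (g : R -> T) t : map_on G g -> g (frep t) = g t.
Proof. by rewrite /map_on /frep; case: (dom_kind G) => // H; exact: periodicz. Qed.

Lemma points_in t : a <= t <= b -> points G t.
Proof. by move=> tI; apply: points_segment; rewrite /= in_itv. Qed.

Lemma points_convex s t x : points G s -> points G t -> s <= x <= t -> points G x.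
Proof.
rewrite /points; case: (dom_kind G) => //=; rewrite !in_itv /=.
by move=> /andP[sa _] /andP[_ tb] /andP[sx xt]; rewrite (le_trans sa) //= (le_trans xt).
Qed.

Lemma map_on_deriv (V : normedModType R) (g : R -> V) : map_on G g ->
  map_on G (deriv_on G g).
Proof.
rewrite /map_on; case E : (dom_kind G) => // H t.
rewrite /deriv_on; congr (lim _).
have -> : diff_quot g (t + (b - a)) = diff_quot g t.
  by apply/funext => h; rewrite /diff_quot addrA !H.
by rewrite /increments /points E.
Qed.

Lemma primitive_on (n : nat) (g : R -> 'rV[R]_n) : cont (points G) g ->
  exists F, derives (points G) F g.
Proof.
rewrite /points; case: (dom_kind G) => cg; last exact: vprimitive_setT.
by apply: vprimitive => //; rewrite ltW // dom_lt.
Qed.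

Lemma primitive_on1 (g : R -> R) : cont (points G) g ->
  exists F, derives (points G) F g.
Proof.
rewrite /points; case: (dom_kind G) => cg; last exact: primitive_setT.
by apply: primitive_seg => //; rewrite ltW // dom_lt.
Qed.

Lemma CK_deriv (V : normedModType R) k (g : R -> V) : CK (points G) k.+1 g ->
  derives (points G) g (deriv_on G g) /\ CK (points G) k (deriv_on G g).
Proof.
case=> g' Hg Cg.
have E s : points G s -> g' s = deriv_on G g s.
  by move=> Gs; rewrite (deriv_onE _ _ _ _ _ Gs (Hg s Gs)).
by split; [exact: derives_ext E Hg|exact: CK_ext E Cg].
Qed.

(** The translate of [F] by a period is another primitive of [g]. *)
Lemma derives_shift (F g : R -> R) s t : dom_kind G = Circle ->
  map_on G g -> derives (points G) F g ->
  F (t + (b - a)) - F (s + (b - a)) = F t - F s.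
Proof.
rewrite /points /map_on => -> Hg HF.
suff H x y : x <= y -> F (y + (b - a)) - F (x + (b - a)) = F y - F x.
  have [st|/ltW ts] := leP s t; first exact: H.
  by apply: oppr_inj; rewrite !opprB H.
move=> xy; rewrite -(rint_eq x y _ _ xy (derives_sub _ _ _ _ _ (@subsetT _ _) HF)).
rewrite -(rint_eq x y (fun z => F (z + (b - a))) g) // => z _.
apply: (isder_sub _ _ setT) => //.
have := isder_comp _ _ setT _ _ z _ _ I (fun _ _ => I)
  (isderD _ _ _ _ _ _ _ (isder_id _ _) (isder_cst _ _ (b - a) _)) (HF (z + (b - a)) I).
by rewrite Hg addr0 scale1r.
Qed.

Lemma vderives_shift (n : nat) (F g : R -> 'rV[R]_n) s t : dom_kind G = Circle ->
  map_on G g -> derives (points G) F g ->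
  F (t + (b - a)) - F (s + (b - a)) = F t - F s.
Proof.
move=> GC Hg HF; apply/rowP => i; rewrite !mxE.
apply: (derives_shift (fun z => F z 0 i) (fun z => g z 0 i)) => //.
  by move: Hg; rewrite /map_on GC => Hg z; rewrite Hg.
by move=> z Gz; apply: isder_coord; exact: HF.
Qed.

End PeriodicFunctions.

(** * A correction supported in one short segment of the domain *)

Section Local.
Context {R : realType} {n : nat}.

Variables (G : domain R) (T T1 : R -> 'rV[R]_n) (sig v : R -> R) (mu0 eps : R).
Local Notation D := (points G).
Hypothesis (n3 : (3 <= n)%N).
Hypotheses (mT : map_on G T) (HT : derives D T T1) (cT1 : cont D T1).
Hypothesis (T1u : forall t, D t -> enorm (T t) = 1).
Hypotheses (cs : cont D sig) (Hs : forall t, D t -> enorm (T1 t) < sig t).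
Hypotheses (cv : cont D v) (Hv : forall t, D t -> 0 < v t).
Hypotheses (mu00 : 0 < mu0) (eps0 : 0 < eps).
Hypothesis (Hmu0 : forall t, D t -> mu0 <= enorm (T1 t)).

(** With [a = T p] and [u] the direction of [T1 p], these thresholds give [dot (T1 t) u] at least
    [mu0 / 2] and [dot (T t) a] at least 1/2. *)
Definition small_variation p q := forall r r', p <= r <= q -> p <= r' <= q ->
  enorm (T1 r - T1 r') <= mu0 / 2 /\ enorm (T r - T r') <= 1.

(** The change is recorded as an additive term [dT] vanishing in [[a, b]] off the open segment, so
    that corrections over the pieces of a partition can simply be summed. *)
Lemma local_correction p q : dom_a G <= p -> p < q -> q <= dom_b G ->
  small_variation p q ->
  exists (dT S' : R -> 'rV[R]_n), [/\ map_on G dT,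
    forall k, CK D k T -> CK D k dT,
    forall t, dom_a G <= t <= dom_b G -> ~~ (p < t < q) -> dT t = 0,
    forall t, D t -> enorm (T t + dT t) = 1 &
    corrects p q eps T sig v (fun t => T t + dT t) S'].
Proof.
move=> ap pq qb Hsm; have Dsub t : p <= t <= q -> D t.
  by move=> /andP[pt tq]; apply: points_in; rewrite (le_trans ap pt) (le_trans tq qb).
have Dsub' : `[p, q] `<=` D by move=> t /=; rewrite in_itv /=; exact: Dsub.
have pI : p <= p <= q by rewrite lexx ltW.
have Dp := Dsub p pI.
have T1p : T1 p != 0.
  by apply: contraTneq (lt_le_trans mu00 (Hmu0 p Dp)) => ->; rewrite enorm0 ltxx.
pose a := T p; pose u := nrm (T1 p).
have aa : dot a a = 1 by rewrite -sqr_enorm T1u // expr1n.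
have uu : enorm u = 1 by exact: enorm_nrm.
have HTJ := derives_sub _ _ _ _ _ Dsub' HT.
have T1uJ t : p <= t <= q -> enorm (T t) = 1 by move=> /Dsub/T1u.
have au : dot a u = 0.
  by rewrite /u /nrm dotZr (unit_tangent_orth p q T T1 pq HTJ T1uJ p pI) mulr0.
have [e [ee ae eu]] := orthonormal_complement a u n3.
have mu40 : 0 < mu0 / 4 by rewrite divr_gt0.
have Hmu t : p <= t <= q -> 2 * (mu0 / 4) <= dot (T1 t) u.
  move=> tI; have [h1 _] := Hsm t p tI pI.
  have -> : dot (T1 t) u = dot (T1 p) u + dot (T1 t - T1 p) u by rewrite dotDl dotNl; ring.
  have -> : dot (T1 p) u = enorm (T1 p).
    rewrite /u /nrm dotZr -sqr_enorm expr2 mulrA mulVf ?mul1r //.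
    by rewrite gt_eqF // enorm_gt0.
  have := norm_dot_le (T1 t - T1 p) u; rewrite uu mulr1 ler_norml => /andP[h2 _].
  by have := Hmu0 p Dp; lra.
have Ha t : p <= t <= q -> 1 / 2 <= dot (T t) a.
  move=> tI; have [_ h1] := Hsm t p tI pI.
  have := dot_ge0 (T t - T p).
  have : dot (T t - T p) (T t - T p) <= 1.
    by rewrite -sqr_enorm -(expr1n _ 2) ler_sqr ?nnegrE ?enorm_ge0.
  rewrite /a !dotE -!sqr_enorm !T1uJ // expr1n (dotC (T p)); lra.
have csJ := cont_sub _ _ _ _ Dsub' cs.
have cvJ := cont_sub _ _ _ _ Dsub' cv.
have [x [h [S' [x2 Ch [c [d [pc dq hs]]] Hcor]]]] :=
  corrugate_segment p q (mu0 / 4) eps T T1 a e u sig v pq HTJ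
    (cont_sub _ _ _ _ Dsub' cT1) T1uJ aa ee ae au eu uu mu40 eps0 Hmu Ha csJ
    (fun t tI => Hs t (Dsub t tI)) cvJ (fun t tI => Hv t (Dsub t tI)).
(* Angle and hump are supported strictly inside the domain's fundamental interval, so both have
   periodic versions; with [T] periodic, the corrected curve then makes sense on the circle. *)
have [h1 [mh Ch1 h1E]] := periodize G c d h (le_lt_trans ap pc) (lt_le_trans dq qb) Ch hs.
have hs2 : supp_in ((3 * p + q) / 4) ((p + 3 * q) / 4) (hump p q).
  by move=> t; exact: hump_out.
have w1 : dom_a G < (3 * p + q) / 4 by lra.
have w2 : (p + 3 * q) / 4 < dom_b G by lra.
have [b1 [mb Cb1 b1E]] := periodize G _ _ (hump p q) w1 w2 (fun k => hump_CK k p q) hs2.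
have half t : D t -> 1 / 2 <= enorm (T t + b1 t *: x).
  move=> Dt; have := enorm_le_dist (T t) (T t + b1 t *: x).
  rewrite enormBC (addrC (T t)) addrK T1u //.
  have := hump_x_le p q x (frep G t).
  by rewrite -b1E ?frepP // (map_on_frep G R b1 t mb); lra.
have nz t : D t -> T t + b1 t *: x != 0 by move=> /half/half_neq0.
exists (fun t => turn a e (h1 t) (nrm (T t + b1 t *: x)) - T t), S'.
have E t : T t + (turn a e (h1 t) (nrm (T t + b1 t *: x)) - T t) =
    turn a e (h1 t) (nrm (T t + b1 t *: x)) by rewrite addrC subrK.
have EJ t : p <= t <= q -> turn a e (h1 t) (nrm (T t + b1 t *: x)) =
    turn a e (h t) (nrm (T t + hump p q t *: x)).
  move=> /andP[pt tq].
  have tI : dom_a G <= t <= dom_b G by rewrite (le_trans ap pt) (le_trans tq qb).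
  by rewrite (h1E t tI) (b1E t tI).
split.
- by move: mT mh mb; rewrite /map_on; case: (dom_kind G) => // H1 H2 H3 t; rewrite H1 H2 H3.
- move=> k CT; apply: CKB; [|exact: CT]; apply: CK_turn; [exact: Ch1|].
  apply: CK_nrm; first exact: nz.
  by apply: CKD; [exact: CT|apply: CKZ; [exact: Cb1|exact: CK_cst]].
- move=> t tI tpq; rewrite (h1E t tI) (b1E t tI).
  have -> : h t = 0.
    apply: hs; apply: contra tpq => /andP[h2 h3].
    by rewrite (lt_le_trans pc h2) (le_lt_trans h3 dq).
  have -> : hump p q t = 0.
    by apply: hs2; apply: contra tpq => /andP[h2 h3]; apply/andP; split; lra.
  by rewrite turn0 scale0r addr0 /nrm (T1u t (points_in G t tI)) invr1 scale1r subrr.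
- by move=> t Dt; rewrite E enorm_turn // enorm_nrm // nz.
- by apply: corrects_ext Hcor => t tI; rewrite E EJ.
Qed.

End Local.

(** * The nodes of a partition given as a path *)

Section PathNodes.
Context {R : realType} (a b : R) (l : seq R) (r : R -> R -> bool).
Hypotheses (Hl : path r a l) (lb : last a l = b) (rlt : forall s t, r s t -> s < t).

Definition pnode j := nth a (a :: l) j.

Lemma pnode_r j : (j < size l)%N -> r (pnode j) (pnode j.+1).
Proof. by move=> jl; have /(pathP a)/(_ j jl) := Hl. Qed.

Lemma pnode0 : pnode 0 = a. Proof. by []. Qed.

Lemma pnode_last : pnode (size l) = b.
Proof. by rewrite /pnode nth_last. Qed.

Lemma pnode_le i j : (i <= j <= size l)%N -> pnode i <= pnode j.
Proof.
case/andP=> ij jl; elim: j ij jl => [|j IH]; first by rewrite leqn0 => /eqP->.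
rewrite leq_eqVlt => /predU1P[->//|]; rewrite ltnS => ij jl.
exact: le_trans (IH ij (ltnW jl)) (ltW (rlt _ _ (pnode_r j jl))).
Qed.

Lemma pnode_itv j : (j <= size l)%N -> a <= pnode j <= b.
Proof.
move=> jl; rewrite -{1}pnode0 -pnode_last.
by rewrite !pnode_le ?jl ?leqnn.
Qed.

Lemma pnode_patch t : a <= t <= b -> (0 < size l)%N ->
  exists2 j, (j < size l)%N & pnode j <= t <= pnode j.+1.
Proof. by move=> tI l0; apply: chain_patch; rewrite // pnode0 pnode_last. Qed.

Lemma pnode_mem x : x \in a :: l -> exists2 j, (j <= size l)%N & pnode j = x.
Proof. by move=> /(nthP a)[j jl jx]; exists j. Qed.

End PathNodes.

(** * The new tantrix on the whole domain *)

Section Tantrix.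
Context {R : realType} {n : nat}.
Variables (G : domain R) (T T1 : R -> 'rV[R]_n) (sig v : R -> R) (eps : R) (ps : seq R).
Local Notation D := (points G).
Local Notation a := (dom_a G).
Local Notation b := (dom_b G).
Hypothesis (n3 : (3 <= n)%N).
Hypotheses (mT : map_on G T) (HT : derives D T T1) (cT1 : cont D T1) (mT1 : map_on G T1).
Hypothesis (T1u : forall t, D t -> enorm (T t) = 1).
Hypotheses (cs : cont D sig) (ms : map_on G sig).
Hypotheses (Hs : forall t, D t -> enorm (T1 t) < sig t).
Hypotheses (cv : cont D v) (Hv : forall t, D t -> 0 < v t).
Hypothesis (T10 : forall t, D t -> 0 < enorm (T1 t)).
Hypothesis (eps0 : 0 < eps).
Hypothesis (psI : forall r, r \in ps -> a <= r <= b).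

Let ab : a < b := dom_lt G.

Lemma small_variation_local mu0 t : 0 < mu0 -> D t -> exists2 d, 0 < d &
  forall s s', a <= s -> s' <= b -> t - d < s -> s' < t + d -> small_variation T T1 mu0 s s'.
Proof.
move=> mu00 Dt; have cT := derives_cont _ _ _ _ HT.
have n0 : 0 < n%:R :> R by rewrite ltr0n (leq_trans _ n3).
(* Continuity is measured in the max norm; dividing by [n] prepares the passage to the Euclidean
   norm. *)
have e1 : 0 < mu0 / 4 / n%:R by rewrite !divr_gt0.
have e2 : 0 < 1 / 2 / n%:R :> R by rewrite !divr_gt0.
have /cvg_withinP/(_ _ e1)[d1 d10 H1] := cT1 t Dt.
have /cvg_withinP/(_ _ e2)[d2 d20 H2] := cT t Dt.
exists (Num.min d1 d2); first by rewrite lt_min d10.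
move=> s s' as_ s'b; rewrite ltrBlDr -ltrBlDl lt_min => /andP[s1 s2].
rewrite -ltrBlDl lt_min => /andP[s3 s4] r r' /andP[r1 r2] /andP[r3 r4].
have In x : s <= x -> x <= s' -> D x /\ `|x - t| < d1 /\ `|x - t| < d2.
  move=> sx xs; split; first by apply: points_in; rewrite (le_trans as_) ?(le_trans xs).
  by rewrite !ltr_norml; split; apply/andP; split; lra.
have F1 x : s <= x -> x <= s' -> enorm (T1 x - T1 t) <= mu0 / 4.
  move=> sx xs; have [Dx [x1 x2]] := In x sx xs; apply: le_trans (enorm_le_norm _) _.
  by rewrite mulrC -ler_pdivlMr //; exact: H1.
have F2 x : s <= x -> x <= s' -> enorm (T x - T t) <= 1 / 2.
  move=> sx xs; have [Dx [x1 x2]] := In x sx xs; apply: le_trans (enorm_le_norm _) _.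
  by rewrite mulrC -ler_pdivlMr //; exact: H2.
split.
- apply: le_trans (enorm_dist _ (T1 t) _) _; rewrite (enormBC (T1 t)).
  by have := F1 r r1 r2; have := F1 r' r3 r4; lra.
- apply: le_trans (enorm_dist _ (T t) _) _; rewrite (enormBC (T t)).
  by have := F2 r r1 r2; have := F2 r' r3 r4; lra.
Qed.

Lemma periodic_lower (g : R -> R) : map_on G g -> cont D g -> (forall t, a <= t <= b -> 0 < g t) ->
  exists2 m, 0 < m & forall t, D t -> m <= g t.
Proof.
move=> mg cg g0; have cgI := cont_sub _ _ _ _ (@points_segment _ G) cg.
have [m m0 Hm] := cont_lower a b g (ltW ab) cgI g0.
by exists m => // t Dt; rewrite -(map_on_frep G _ g t mg); apply: Hm; exact: frepP.
Qed.

Lemma map_on_enorm (g : R -> 'rV[R]_n) : map_on G g -> map_on G (fun t => enorm (g t)).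
Proof. by rewrite /map_on; case: (dom_kind G) => // H t; rewrite H. Qed.

(* The pieces of [local_correction] over a partition, added up. *)
Lemma glued_correction : exists (N : nat) (pt : nat -> R) (dT : R -> 'rV[R]_n),
  [/\ [/\ pt 0 = a, pt N = b, forall j, (j <= N)%N -> a <= pt j <= b,
          forall j, (j < N)%N -> pt j < pt j.+1 &
          forall t, a <= t <= b -> exists2 j, (j < N)%N & pt j <= t <= pt j.+1],
      forall r, r \in ps -> exists2 j, (j <= N)%N & pt j = r,
      [/\ map_on G dT, forall k, CK D k T -> CK D k dT,
          forall j, (j <= N)%N -> dT (pt j) = 0 & forall t, D t -> enorm (T t + dT t) = 1] &
      forall j, (j < N)%N -> exists S' : R -> 'rV[R]_n,
        corrects (pt j) (pt j.+1) eps T sig v (fun t => T t + dT t) S'].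
Proof.
have [mu0 mu00 Hmu0] : exists2 m, 0 < m & forall t, D t -> m <= enorm (T1 t).
  apply: periodic_lower; [exact: map_on_enorm|exact: cont_enorm|].
  by move=> t /points_in; exact: T10.
have [l [Hl lb lps]] := fine_path_through (small_variation T T1 mu0) a b ps ab
  (fun t tI => small_variation_local mu0 t mu00 (points_in G t tI)).
set r := finer _ in Hl.
have rlt s t : r s t -> s < t by move=> /asboolP[].
pose pt := pnode a l; pose N := size l.
have N0 : (0 < N)%N by rewrite /N; case: (l) lb => //= ba; have := ab; rewrite ba ltxx.
have ptN : pt N = b := pnode_last a b l lb.
have ptI j : (j <= N)%N -> a <= pt j <= b := pnode_itv a b l r Hl lb rlt j.
have ptlt j : (j < N)%N -> pt j < pt j.+1.
  by move=> jN; apply: rlt; exact: pnode_r.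
have ptle i j : (i <= j <= N)%N -> pt i <= pt j := pnode_le a l r Hl rlt i j.
have /choice[dJ HJ] : forall j, exists dT : R -> 'rV[R]_n, (j < N)%N -> exists S' : R -> 'rV[R]_n,
   [/\ map_on G dT,
    forall k, CK D k T -> CK D k dT,
    forall t, dom_a G <= t <= dom_b G -> ~~ (pt j < t < pt j.+1) -> dT t = 0,
    forall t, D t -> enorm (T t + dT t) = 1 &
    corrects (pt j) (pt j.+1) eps T sig v (fun t => T t + dT t) S'].
  move=> j; have [jN|jN] := boolP (j < N)%N; last by exists (fun=> 0).
  have /andP[pa _] := ptI j (ltnW jN); have /andP[_ qb] := ptI j.+1 jN.
  have /asboolP[_ Hsm] := pnode_r a l r Hl j jN.
  have [dT [S' H]] := local_correction G T T1 sig v mu0 eps n3 mT HT cT1 T1u cs Hs cv Hv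
    mu00 eps0 Hmu0 (pt j) (pt j.+1) pa (ptlt j jN) qb Hsm.
  by exists dT => _; exists S'.
pose dT t := \sum_(j < N) dJ j t.
have off j t : (j < N)%N -> a <= t <= b -> ~~ (pt j < t < pt j.+1) -> dJ j t = 0.
  by move=> jN; have [S' [_ _ H _ _]] := HJ j jN; exact: H.
have dTE j t : (j < N)%N -> pt j <= t <= pt j.+1 -> dT t = dJ j t.
  move=> jN /andP[t1 t2]; rewrite /dT (bigD1 (Ordinal jN)) //= big1 ?addr0 // => i ij.
  have tI : a <= t <= b.
    have /andP[pa _] := ptI j (ltnW jN); have /andP[_ qb] := ptI j.+1 jN.
    by rewrite (le_trans pa) // (le_trans t2).
  apply: off => //; rewrite negb_and -!leNgt.
  have : (i : nat) != j by apply: contraNneq ij => ij; apply/eqP/val_inj.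
  rewrite neq_ltn => /orP[lt|gt].
  - by apply/orP; right; apply: le_trans t1; apply: ptle; rewrite lt ltnW.
  - apply/orP; left; apply: le_trans t2 _; apply: ptle; rewrite gt /=.
    exact: ltnW (ltn_ord i).
have ptz j : (j <= N)%N -> dT (pt j) = 0.
  move=> jN; rewrite /dT big1 // => i _; apply: off => //; first exact: ptI.
  rewrite negb_and -!leNgt; have [ij|ij] := leqP j i.
    by apply/orP; left; apply: ptle; rewrite ij ltnW.
  by apply/orP; right; apply: ptle; rewrite ij.
have mdT : map_on G dT.
  have mJ (j : 'I_N) : map_on G (dJ j) by have [S' []] := HJ j (ltn_ord j).
  move: mJ; rewrite /map_on; case: (dom_kind G) => // mJ t.
  by apply: eq_bigr => j _; rewrite mJ.
have patch t : a <= t <= b -> exists2 j, (j < N)%N & pt j <= t <= pt j.+1.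
  by move=> tI; exact: (pnode_patch a b l lb t tI N0).
exists N, pt, dT; split.
- by split.
- move=> x xps; have := lps x xps (psI x xps); exact: pnode_mem.
- split => //.
    by move=> k Ck; apply: CK_sum => j; have [S' [_ H _ _ _]] := HJ j (ltn_ord j); exact: H.
  have mn : map_on G (fun t => enorm (T t + dT t)).
    by apply: map_on_enorm; exact: (map_on_op2 (fun x y => x + y) mT mdT).
  move=> t Dt; rewrite -(map_on_frep G _ _ t mn).
  have tI := frepP G t Dt; have [j jN tj] := patch _ tI.
  rewrite (dTE j) //; have [S' [_ _ _ H _]] := HJ j jN; apply: H; exact: points_in.
- move=> j jN; have [S' [_ _ _ _ H]] := HJ j jN; exists S'.
  by apply: corrects_ext H => t tj; rewrite (dTE j t jN tj).
Qed.

Lemma frep_id t : a <= t -> t < b -> frep G t = t.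
Proof.
move=> at_ tb; rewrite /frep; case: (dom_kind G) => //.
by rewrite (perE _ _ ab _ 0) ?mulr0 ?subr0 // at_.
Qed.

Lemma frep_Interval t : dom_kind G = Defs.Interval -> frep G t = t.
Proof. by rewrite /frep => ->. Qed.

Lemma frep_b : dom_kind G = Circle -> frep G b = a.
Proof.
rewrite /frep => ->; rewrite (perE _ _ ab _ 1) mulr1; last first.
  by apply/andP; split; have := ab; lra.
by rewrite opprB addrC subrK.
Qed.

Lemma frep_shift t : dom_kind G = Circle -> frep G (t + (b - a)) = frep G t.
Proof. by rewrite /frep => ->; exact: per_shift. Qed.

(** * The global reparametrization and its regularity *)

Section Reparametrization.
Variables (g phi0 : R -> R) (mu : R).
Hypotheses (mu0 : 0 < mu) (cg : cont D g) (mg : map_on G g) (gmu : forall t, D t -> mu <= g t).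
Hypothesis Hphi : reparam a b g sig phi0.
Hypothesis len : rint a b g = rint a b sig.

(** On the circle, the lift that commutes with translation by a period; on an interval, [phi0]
    itself. *)
Definition lifted t := phi0 (frep G t) + (t - frep G t).

Let gmuI t : a <= t <= b -> mu <= g t. Proof. by move=> /points_in/gmu. Qed.
Let cgI : cont `[a, b] g := cont_sub _ _ _ _ (@points_segment _ G) cg.

Lemma phi0_fix t : a <= t <= b -> rint a t g = rint a t sig -> phi0 t = t.
Proof.
move=> tI E; have [pI Ep] := Hphi t tI; rewrite -E in Ep.
apply/le_anti/andP; split.
  by apply: (rint_inj_le a b mu g cgI gmuI _ _ mu0 pI tI); rewrite Ep.
by apply: (rint_inj_le a b mu g cgI gmuI _ _ mu0 tI pI); rewrite Ep.
Qed.

(** Only [t = b] on the circle is at stake: its representative is [a], and equality of the total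
    lengths makes [phi0] fix both ends. *)
Lemma liftedE t : a <= t <= b -> lifted t = phi0 t.
Proof.
move=> /andP[at_ tb]; have aI : a <= a <= b by rewrite lexx ltW.
have bI : a <= b <= b by rewrite lexx ltW.
have [tltb|btlet] := ltP t b; first by rewrite /lifted frep_id // subrr addr0.
have -> : t = b by apply/le_anti; rewrite tb.
rewrite /lifted; case E : (dom_kind G); first by rewrite frep_Interval // subrr addr0.
rewrite frep_b // (phi0_fix a aI) ?rint_point // (phi0_fix b bI) // addrC subrK //.
Qed.

Lemma lifted_in t : D t -> D (lifted t).
Proof.
move=> Dt; case E : (dom_kind G); last by rewrite /points E.
rewrite /lifted frep_Interval // subrr addr0; apply: points_in.
by have [] := Hphi t; first by have := frepP G t Dt; rewrite frep_Interval.
Qed.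

Lemma lifted_shift t : dom_kind G = Circle -> lifted (t + (b - a)) = lifted t + (b - a).
Proof. by move=> E; rewrite /lifted frep_shift //; ring. Qed.

(** With [Phi] and [S] primitives of [g] and [sig], the difference [Phi (lifted t) - S t] is
    constant on [[a, b]] by definition, and periodic because [g] and [sig] have the same integral
    over a period. [isder_inverse] applies. *)
Lemma lifted_derives : derives D lifted (fun t => sig t / g (lifted t)).
Proof.
have [Phi HPhi] := primitive_on1 G g cg; have [S HS] := primitive_on1 G sig cs.
have HPhiI := derives_sub _ _ _ _ _ (@points_segment _ G) HPhi.
have HSI := derives_sub _ _ _ _ _ (@points_segment _ G) HS.
have aI : a <= a <= b by rewrite lexx ltW.
have key t : a <= t <= b -> Phi (lifted t) - S t = Phi a - S a.
  move=> tI; rewrite liftedE //; have [/andP[p1 p2] E] := Hphi t tI.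
  move: E; rewrite (rint_sub a b a (phi0 t) Phi g (lexx a) p1 p2 HPhiI).
  case/andP: tI => t1 t2; rewrite (rint_sub a b a t S sig (lexx a) t1 t2 HSI); lra.
have H t : D t -> Phi (lifted t) - S t = Phi a - S a.
  move=> Dt; rewrite -(key (frep G t)) ?frepP //.
  suff m : map_on G (fun t => Phi (lifted t) - S t) by rewrite (map_on_frep G _ _ t m).
  rewrite /map_on; case E : (dom_kind G) => // s.
  rewrite lifted_shift //.
  have E1 := derives_shift G Phi g a (lifted s) E mg HPhi.
  have E2 := derives_shift G S sig a s E ms HS.
  have ba : a + (b - a) = b by rewrite addrC subrK.
  rewrite ba in E1 E2.
  have := rint_sub a b a b Phi g (lexx a) (ltW ab) (lexx b) HPhiI.
  have := rint_sub a b a b S sig (lexx a) (ltW ab) (lexx b) HSI.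
  rewrite len => E3 E4; lra.
apply: (isder_inverse D mu Phi g S sig lifted _ mu0 HPhi gmu HS lifted_in).
- exact: points_convex.
- by move=> s t Ds Dt; have := H s Ds; have := H t Dt; lra.
Qed.

(** Bootstrapping: the derivative [sig t / g (lifted t)] has the class already known for [lifted],
    as long as this does not exceed that of [sig] and [g], so each round gains one order. *)
Lemma lifted_CK k : CK D k g -> CK D k sig -> CK D k.+1 lifted.
Proof.
move=> Cg Cs.
suff H j : (j <= k.+1)%N -> CK D j lifted by exact: H.
elim: j => [_|j IH jk]; first exact: derives_cont lifted_derives.
have Cj := IH (ltnW jk); rewrite ltnS in jk.
exists (fun t => sig t / g (lifted t)); first exact: lifted_derives.
apply: CKM; first exact: CK_le jk Cs.
apply: CKV.
  by move=> s Ds; rewrite gt_eqF // (lt_le_trans mu0) //; apply: gmu; exact: lifted_in.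
apply: (CK_comp _ _ D) => //; [exact: lifted_in|exact: CK_le jk Cg].
Qed.

End Reparametrization.

(** The integral condition is phrased for arbitrary primitives agreeing at [a]; these will be the
    new curve and the old one. [W] is exposed so that the curvature can be read off its norm. *)
Theorem tantrix_correction : exists S W : R -> 'rV[R]_n,
  [/\ map_on G S, forall k, CK D k.+1 T -> CK D k sig -> CK D k.+1 S,
      forall t, D t -> enorm (S t) = 1,
      derives D S W /\ (forall t, D t -> enorm (W t) = sig t) &
      [/\ forall t, D t -> enorm (S t - T t) <= eps,
          forall r, r \in ps -> S r = T r &
          forall F E, derives D F (fun t => v t *: S t) -> derives D E (fun t => v t *: T t) ->
            F a = E a -> F b = E b /\ forall r, r \in ps -> F r = E r]].
Proof.
have [N [pt [dT [[pt0 ptN ptI ptlt patch] Hps [mdT CdT ptz Tu] HJ]]]] :=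
  glued_correction.
pose Ts t := T t + dT t.
have CT1 : CK D 1 T by exists T1.
have CTs k : CK D k T -> CK D k Ts by move=> Ck; apply: CKD => //; exact: CdT.
have mTs : map_on G Ts by exact: (map_on_op2 (fun x y => x + y) mT mdT).
pose Ts' := deriv_on G Ts.
have [HTs cTs'] : derives D Ts Ts' /\ CK D 0 Ts' by apply: CK_deriv; exact: CTs.
have mTs' : map_on G Ts' by exact: map_on_deriv.
have psub j : (j < N)%N -> `[pt j, pt j.+1] `<=` D.
  move=> jN; have /andP[p1 _] := ptI j (ltnW jN); have /andP[_ p2] := ptI j.+1 jN.
  move=> t /=; rewrite in_itv /= => /andP[t1 t2].
  by apply: points_in; rewrite (le_trans p1 t1) (le_trans t2 p2).
pose g t := enorm (Ts' t).
have {}HJ j : (j < N)%N -> [/\ (forall t, pt j <= t <= pt j.+1 -> 0 < g t),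
    rint (pt j) (pt j.+1) g = rint (pt j) (pt j.+1) sig &
    forall phi, reparam (pt j) (pt j.+1) g sig phi ->
      (forall t, pt j <= t <= pt j.+1 -> enorm (Ts (phi t) - T t) <= eps) /\
      vint (pt j) (pt j.+1) (fun t => v t *: Ts (phi t)) =
      vint (pt j) (pt j.+1) (fun t => v t *: T t)].
  move=> jN; have [S' [H1 H2 H3 H4]] := HJ j jN.
  (* On a nondegenerate segment derivatives are unique, so the local [S'] is the restriction of the
     global [Ts']. *)
  have E t : pt j <= t <= pt j.+1 -> enorm (S' t) = g t.
    move=> tj; congr enorm; apply: (isder_itv_unique _ _ (ptlt j jN) _ _ _ _ _ tj (H1 t _) _).
      by rewrite /= in_itv.
    by apply: (derives_sub _ _ _ _ _ (psub j jN) HTs); rewrite /= in_itv.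
  split.
  - by move=> t tj; rewrite -E //; exact: H2.
  - by rewrite -H3; apply: rint_congr => t tj; rewrite E.
  - move=> phi Hphi; apply: H4 => t tj; have [/[dup] pj /andP[p1 p2] Ep] := Hphi t tj.
    split; first exact: pj.
    rewrite -Ep; apply: rint_congr => s /andP[s1 s2].
    by rewrite E // s1 (le_trans s2).
have cg : cont D g by exact: cont_enorm.
have mg : map_on G g by exact: map_on_enorm.
have [mu mu0 gmu] : exists2 m, 0 < m & forall t, D t -> m <= g t.
  apply: periodic_lower => // t /patch[j jN tj].
  by have [H _ _] := HJ j jN; exact: H.
have cgI := cont_sub _ _ _ _ (@points_segment _ G) cg.
have csI := cont_sub _ _ _ _ (@points_segment _ G) cs.
have gmuI t : a <= t <= b -> mu <= g t by move=> /points_in/gmu.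
have sg t : a <= t <= b -> 0 <= sig t.
  by move=> /points_in/Hs/ltW; apply: le_trans; exact: enorm_ge0.
have len j : (j <= N)%N -> rint a (pt j) g = rint a (pt j) sig.
  elim: j => [_|j IH jN]; first by rewrite pt0 !rint_point.
  have /andP[p1 p2] := ptI j.+1 jN; have /andP[p3 p4] := ptI j (ltnW jN).
  have lt := ltW (ptlt j jN).
  have c1 := cont_sub_itv _ _ _ _ _ _ (lexx a) p2 cgI.
  have c2 := cont_sub_itv _ _ _ _ _ _ (lexx a) p2 csI.
  rewrite (rint_chasles a (pt j.+1) (pt j) g p3 lt c1).
  rewrite (rint_chasles a (pt j.+1) (pt j) sig p3 lt c2).
  by rewrite (IH (ltnW jN)); have [_ -> _] := HJ j jN.
have lenb : rint a b g = rint a b sig by rewrite -ptN; exact: len.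
have [phi0 Hphi] := reparam_exists a b mu g sig (ltW ab) mu0 cgI csI gmuI sg lenb.
pose phi := lifted phi0.
have phiE t : a <= t <= b -> phi t = phi0 t by exact: (liftedE g phi0 mu mu0 cg gmu Hphi lenb).
have phiD t : D t -> D (phi t) by exact: (lifted_in g phi0 Hphi).
have Hd : derives D phi (fun t => sig t / g (phi t)).
  exact: (lifted_derives g phi0 mu mu0 cg mg gmu Hphi lenb).
have phi_pt j : (j <= N)%N -> phi (pt j) = pt j.
  move=> jN; rewrite phiE; last exact: ptI.
  exact: (phi0_fix g phi0 mu mu0 cg gmu Hphi _ (ptI j jN) (len j jN)).
(* [len] at both ends of the piece makes the global reparametrization an admissible one for that
   piece. *)
have local j : (j < N)%N ->
    (forall t, pt j <= t <= pt j.+1 -> enorm (Ts (phi t) - T t) <= eps) /\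
    vint (pt j) (pt j.+1) (fun t => v t *: Ts (phi t)) =
    vint (pt j) (pt j.+1) (fun t => v t *: T t).
  move=> jN; have [_ _ H] := HJ j jN; apply: H => t tj.
  have /andP[p1 p2] := ptI j.+1 jN; have /andP[p3 p4] := ptI j (ltnW jN).
  rewrite phiE; last by case/andP: tj => t1 t2; rewrite (le_trans p3 t1) (le_trans t2 p2).
  exact: (reparam_restrict a b mu (pt j) (pt j.+1) g sig phi0 mu0 cgI csI gmuI sg Hphi
    p3 (ltW (ptlt j jN)) p2 (len j (ltnW jN)) (len j.+1 jN)).
have g0 t : D t -> g (phi t) != 0.
  by move=> Dt; rewrite gt_eqF // (lt_le_trans mu0) //; apply: gmu; exact: phiD.
have mS : map_on G (fun t => Ts (phi t)).
  move: mTs; rewrite /map_on; case E : (dom_kind G) => // H t.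
  by rewrite /phi (lifted_shift phi0) // H.
exists (fun t => Ts (phi t)), (fun t => (sig t / g (phi t)) *: Ts' (phi t)); split.
- exact: mS.
- move=> k Ck Csk; have CTk := CTs _ Ck.
  have [_ CTk'] := CK_deriv G _ _ _ CTk.
  apply: (CK_comp _ _ D) => //.
  apply: (lifted_CK g phi0 mu mu0 cg mg gmu Hphi lenb) => //.
  apply: CK_enorm => // s Ds; apply: contraTneq (lt_le_trans mu0 (gmu s Ds)).
  by rewrite /g /Ts' => ->; rewrite enorm0 ltxx.
- by move=> t Dt; apply: Tu; exact: phiD.
- split.
    by move=> t Dt; apply: (isder_comp _ D D) => //; [exact: Hd|apply: HTs; exact: phiD].
  move=> t Dt; rewrite enormZ ger0_norm; first by rewrite -/(g (phi t)) divfK // g0.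
  rewrite divr_ge0 ?enorm_ge0 //; apply: le_trans (ltW (Hs t Dt)); exact: enorm_ge0.
- split.
  + have m : map_on G (fun t => enorm (Ts (phi t) - T t)).
      by apply: map_on_enorm; exact: (map_on_op2 (fun x y => x - y) mS mT).
    move=> t Dt; rewrite -(map_on_frep G _ _ t m).
    have [j jN tj] := patch _ (frepP G t Dt).
    by have [H _] := local j jN; exact: H.
  + move=> r /Hps[j jN <-]; rewrite phi_pt // /Ts ptz // addr0 //.
  + move=> F E HF HE Fa.
    have key j : (j <= N)%N -> F (pt j) = E (pt j).
      elim: j => [_|j IH jN]; first by rewrite pt0.
      have [_ K] := local j jN.
      rewrite (vint_eq _ _ F _ (ltW (ptlt j jN)) (derives_sub _ _ _ _ _ (psub j jN) HF)) in K.
      rewrite (vint_eq _ _ E _ (ltW (ptlt j jN)) (derives_sub _ _ _ _ _ (psub j jN) HE)) in K.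
      by move: K; rewrite (IH (ltnW jN)) => /addIr.
    split; first by rewrite -ptN; exact: key.
    by move=> r /Hps[j jN <-]; exact: key.
Qed.

End Tantrix.

(** * The curve *)

(** The orders guaranteed by [alpha], so that finite and infinite regularity are treated by the same
    arguments. *)
Definition has_order (alpha : regularity) (k : nat) : bool :=
  if alpha is Defs.Finite m then (k <= m)%N else true.

Lemma C_classP {R : realType} (G : domain R) (V : normedModType R) alpha (g : R -> V) :
  C_class G alpha g <-> map_on G g /\ forall k, has_order alpha k -> CK (points G) k g.
Proof.
case: alpha => [m|]; rewrite /C_class /=; split=> -[mg Cg]; split => //.
- by move=> k km; apply: CK_le km _; exact/Ck_CK.
- by apply/Ck_CK; exact: Cg.
- by move=> k _; exact/Ck_CK.
- by move=> k; apply/Ck_CK; exact: Cg.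
Qed.

Lemma has_order_sub2 alpha k : regularity_ge 2 alpha ->
  has_order (regularity_sub alpha 2) k = has_order alpha k.+2.
Proof. by case: alpha => [m|] //= m2; rewrite leq_subRL. Qed.

Lemma has_order_le alpha j k : (j <= k)%N -> has_order alpha k -> has_order alpha j.
Proof. by case: alpha => [m|] //= jk; exact: leq_trans. Qed.

Lemma C0norm_le {R : realType} (G : domain R) n (g : R -> 'rV[R]_n) (eps : R) :
  (forall t, points G t -> enorm (g t) <= eps) -> (C0norm G g <= eps%:E)%E.
Proof. by move=> H; apply: ge_ereal_sup => _ [t Gt <-]; rewrite lee_fin; exact: H. Qed.

Theorem theorem1p1 (R : realType) (G : domain R) (n : nat) (alpha : regularity)
    (f : R -> 'rV[R]_n) (kt : R -> R) (P : set R) (eps : R)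
    (hn : (3 <= n)%N) (halpha : regularity_ge 2 alpha)
    (hf : Imm G alpha f)
    (hcurv : forall t, points G t -> 0 < curvature G f t)
    (hkt : C_class G (regularity_sub alpha 2) kt)
    (hlt : forall t, points G t -> curvature G f t < kt t)
    (hPfin : finite_set P) (hP : P `<=` points G)
    (heps : 0 < eps) :
  exists ft : R -> 'rV[R]_n,
    [/\ Imm G alpha ft,
        forall t, points G t -> curvature G ft t = kt t,
        (C1norm G (fun t => (ft t - f t)%R) <= eps%:E)%E,
        unit_speed G f -> unit_speed G ft
      & forall p, P p -> tangent_at G ft f p].
Proof.
have [/C_classP[mf Cf] f0] := hf; have /C_classP[mk Ck] := hkt.
have {}Ck k : has_order alpha k.+2 -> CK (points G) k kt.
  by move=> o; apply: Ck; rewrite has_order_sub2.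
have o2 : has_order alpha 2 by move: halpha; case: (alpha).
set D := points G in Cf f0 Ck *; pose a := dom_a G; pose b := dom_b G.
have ab : a < b := dom_lt G.
pose f' := deriv_on G f; pose v t := enorm (f' t); pose T := tantrix G f.
have [Hf _] := CK_deriv G _ _ _ (Cf 2 o2).
have Cf' k : has_order alpha k.+1 -> CK D k f' by move=> /Cf/CK_deriv[].
have Cv k : has_order alpha k.+1 -> CK D k v by move=> /Cf' H; exact: CK_enorm.
have CT k : has_order alpha k.+1 -> CK D k T by move=> /Cf' H; exact: CK_nrm.
have vpos t : D t -> 0 < v t by move=> /f0; exact: enorm_gt0.
have Tu t : D t -> enorm (T t) = 1 by move=> /f0; exact: enorm_nrm.
have mf' : map_on G f' by exact: map_on_deriv.
have mv : map_on G v by exact: map_on_enorm.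
have mT : map_on G T.
  exact: (map_on_op2 (fun x _ : 'rV[R]_n => nrm x) mf' mf').
pose T1 := deriv_on G T.
have [HT cT1] := CK_deriv G _ _ _ (CT 1 o2).
have mT1 : map_on G T1 by exact: map_on_deriv.
pose sig t := kt t * v t.
have Cs k : has_order alpha k.+2 -> CK D k sig.
  by move=> o; apply: CKM; [exact: Ck|apply: Cv; exact: has_order_le o].
have ms : map_on G sig.
  exact: (map_on_op2 ( *%R) mk mv).
have Hs t : D t -> enorm (T1 t) < sig t.
  by move=> Dt; have := hlt t Dt; rewrite /curvature ltr_pdivrMr //; exact: vpos.
have T10 t : D t -> 0 < enorm (T1 t).
  move=> Dt; have := hcurv t Dt; rewrite /curvature pmulr_lgt0 // invr_gt0; exact: vpos.
have cv : cont D v by apply: (Cv 0%N); exact: has_order_le o2.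
have [V V0 HV] := cont_bounded a b v (ltW ab) (cont_sub _ _ _ _ (@points_segment _ G) cv).
have {}HV t : D t -> v t <= V.
  by move=> Dt; rewrite -(map_on_frep G _ v t mv); apply: HV; exact: frepP.
(* The derivative of [ft - f] will have norm at most [V * e1], and its integral from [a] at most
   [V * e1 * (b - a)]; both are then within [eps]. *)
pose e1 := eps / (V * (1 + (b - a))).
have l0 : 0 < b - a by rewrite subr_gt0.
have den0 : 0 < V * (1 + (b - a)) by rewrite mulr_gt0 // addr_gt0.
have e10 : 0 < e1 by rewrite divr_gt0.
have e1E : e1 * (V * (1 + (b - a))) = eps by rewrite divfK // gt_eqF.
have Ve0 : 0 < V * e1 by rewrite mulr_gt0.
have Ve1 : V * e1 <= eps by have := mulr_gt0 Ve0 l0; lra.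
have Ve2 : V * e1 * (b - a) <= eps by lra.
have /finite_seqP[s Ps] := hPfin.
(* On the circle the points of [P] may lie anywhere on the line; they are replaced by their
   representatives. *)
have psI r : r \in map (frep G) s -> a <= r <= b.
  by move=> /mapP[x xs ->]; apply: frepP; apply: hP; rewrite Ps.
have [S [W [mS CS Su [HW Wn] [Sclose SP SI]]]] := tantrix_correction G T T1 sig v e1
  (map (frep G) s) hn mT HT cT1 mT1 Tu (Cs 0%N o2) ms Hs cv vpos T10 e10 psI.
(* For [k = 0] continuity is read off the derivative; beyond that, [sig] of one class less than [S]
   suffices, as the reparametrization gains one order. *)
have {}CS k : has_order alpha k.+1 -> CK D k S.
  case: k => [_|k o]; first exact: derives_cont HW.
  by apply: CS; [exact: CT|exact: Cs].
have CvS k : has_order alpha k.+1 -> CK D k (fun t => v t *: S t).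
  by move=> o; apply: CKZ; [exact: Cv|exact: CS].
have [F HF] := primitive_on G n _ (CvS 0%N (has_order_le _ 1 2 isT o2)).
pose ft t := F t - F a + f a.
have Hft : derives D ft (fun t => v t *: S t).
  move=> t Dt; rewrite -[v t *: S t]addr0 -[v t *: S t]subr0.
  by apply: isderD; [apply: isderB; [exact: HF|exact: isder_cst]|exact: isder_cst].
have HfT : derives D f (fun t => v t *: T t).
  apply: derives_ext Hf => // t Dt.
  by rewrite /T /tantrix scalerA mulfV ?scale1r // gt_eqF // vpos.
have fta : ft a = f a by rewrite /ft subrr add0r.
have [ftb ftP] := SI ft f Hft HfT fta.
have dft t : D t -> deriv_on G ft t = v t *: S t.
  by move=> Dt; apply: deriv_onE => //; exact: Hft.
have dftn t : D t -> enorm (deriv_on G ft t) = v t.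
  by move=> Dt; rewrite dft // enormZ gtr0_norm ?vpos // Su // mulr1.
have ttx t : D t -> S t = tantrix G ft t.
  move=> Dt; rewrite /tantrix dftn // dft // scalerA mulVf ?scale1r // gt_eqF //; exact: vpos.
(* The curve closes up: over [[a, b]] the increments of [ft] and [f] agree, that of [f] is 0, and
   the velocity is periodic, so the increment over every period is 0. *)
have mft : map_on G ft.
  have := vderives_shift G n ft (fun t => v t *: S t); rewrite -/D /map_on.
  case E : (dom_kind G) => // H t.
  have ba : a + (b - a) = b by rewrite addrC subrK.
  have fb : f b = f a by rewrite -ba; move: mf; rewrite /map_on E; exact.
  have m : (forall t0, v (t0 + (b - a)) *: S (t0 + (b - a)) = v t0 *: S t0).
    by move: mv mS; rewrite /map_on E => H1 H2 x; rewrite H1 H2.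
  have := H a t erefl m Hft; rewrite -/a -/b ba ftb fb fta.
  by move=> /addIr.
have mdist : map_on G (fun t => enorm (ft t - f t)).
  by apply: map_on_enorm; exact: (map_on_op2 (fun x y => x - y) mft mf).
have Hdist : derives D (fun t => ft t - f t) (fun t => v t *: (S t - T t)).
  by move=> t Dt; rewrite scalerBr; apply: isderB; [exact: Hft|exact: HfT].
have Ddist t : D t -> enorm (v t *: (S t - T t)) <= V * e1.
  move=> Dt; rewrite enormZ gtr0_norm ?vpos //.
  by apply: ler_pM; [rewrite ltW ?vpos|exact: enorm_ge0|exact: HV|exact: Sclose].
exists ft; split.
- split; last first.
    move=> t Dt; apply: contraTneq (vpos t Dt) => E.
    by rewrite -(dftn t Dt) E enorm0 ltxx.
  apply/C_classP; split => // -[|[|k]] o.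
  + exact: derives_cont Hft.
  + exists (fun t => v t *: S t); first exact: Hft.
    by apply: CvS; exact: has_order_le o2.
  + exists (fun t => v t *: S t); first exact: Hft.
    exact: CvS.
- move=> t Dt; rewrite /curvature dftn //.
  rewrite (deriv_on_ext G _ (tantrix G ft) S t Dt) => [|x Dx]; last by rewrite ttx.
  by rewrite (deriv_onE G _ S t _ Dt (HW t Dt)) Wn // /sig mulfK // gt_eqF // vpos.
- rewrite /C1norm ge_max; apply/andP; split; apply: C0norm_le => t Dt.
    (* The difference is estimated from [a], where it vanishes, to the representative of [t], at
       distance at most [b - a]. *)
    rewrite -(map_on_frep G _ _ t mdist); apply: le_trans Ve2.
    have /andP[t1 t2] := frepP G t Dt.
    have := enorm_mvt a b (fun t => ft t - f t) _ (V * e1)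
      (derives_sub _ _ _ _ _ (@points_segment _ G) Hdist)
      (fun x xI => Ddist x (points_in G x xI)) a (frep G t).
    rewrite fta subrr subr0 lexx t1 t2 (ltW ab) => /(_ isT isT) /le_trans; apply.
    by apply: ler_wpM2l; [exact: ltW|rewrite ger0_norm ?subr_ge0 ?lerB].
  rewrite (deriv_onE G _ _ t _ Dt (Hdist t Dt)); apply: le_trans Ve1; exact: Ddist.
- by move=> us t Dt; rewrite dftn //; exact: us.
- move=> p Pp; have Dp := hP p Pp.
  have ps : frep G p \in map (frep G) s by apply: map_f; move: Pp; rewrite Ps.
  split.
    by rewrite -(map_on_frep G _ ft p mft) -(map_on_frep G _ f p mf); exact: ftP.
  rewrite -ttx // -(map_on_frep G _ S p mS) -(map_on_frep G _ (tantrix G f) p mT).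
  exact: SP.
Qed.
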